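(* Let $F\colon L\to H$ be a groupoid fibration with fibre $G$, where $G$ and $H$ are locally Hausdorff, locally compact groupoids with Hausdorff object spaces. Let $(\lambda^x)_{x\in G^0}$ and $(\mu^y)_{y\in H^0}$ be Haar systems on $G$ and $H$. These induce a Haar system $(\nu^x)_{x\in L^0}$ on $L$, given by $$\int_{L^1} f(l)\,d\nu^x(l)=\int_{H^1}\int_{L^1} f(l)\,d\dot\lambda^{(h,x)}(l)\,d\mu^{F^0(x)}(h)$$ for the continuous family of measures $\dot\lambda$ along the fibres of the open surjection $(F^1,r)\colon L^1\to H^1\times_{r,H^0,F^0}L^0=\{(h,x): r(h)=F^0(x)\}$ given by $$\int_{L^1} f(l)\,d\dot\lambda^{(h,x)}(l)=\int_{G} f(kg)\,d\lambda^{s(k)}(g)$$ for any $k\in L^1$ with $F^1(k)=h$ and $r(k)=x$.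
   Context: A topological groupoid $L$ has topological spaces $L^0$ of objects and $L^1$ of arrows, open continuous range and source maps $r,s\colon L^1\to L^0$, and continuous multiplication, inversion and unit maps. A groupoid fibration is a continuous functor $F\colon L\to H$ (continuous maps $F^i\colon L^i\to H^i$, $i=0,1$, compatible with $r$, $s$ and multiplication) such that $(F^1,s)\colon L^1\to H^1\times_{s,H^0,F^0}L^0=\{(h,x): s(h)=F^0(x)\}$ is an open surjection (equivalently, $(F^1,r)\colon L^1\to H^1\times_{r,H^0,F^0}L^0$ is an open surjection). Its fibre is the subgroupoid $G\subseteq L$ with $G^0=L^0$ and $G^1=\{g\in L^1: F^1(g)=1_{F^0(s(g))}\}$, with the subspace topology. Under the hypotheses of the claim, $L$ is automatically locally Hausdorff and locally compact, with Hausdorff object space. A space is locally Hausdorff if every point has a Hausdorff open neighbourhood; a locally Hausdorff space is locally compact if every point has a neighbourhood basis of compact Hausdorff sets. A quasi-continuous function on a locally Hausdorff, locally compact space $X$ is a finite linear combination of compactly supported continuous functions on Hausdorff open subsets of $X$, extended by $0$; they form the space $\mathfrak S(X)$. A continuous family of measures along the fibres of a continuous map $p\colon X\to Y$ is a family of Radon measures $\beta^y$ on the fibres $p^{-1}(y)$ such that $y\mapsto\int f\,d\beta^y$ is continuous with compact support if $Y$ is Hausdorff and $f\in\mathfrak S(X)$; for locally Hausdorff $Y$, continuity means that for each Hausdorff open subset $V\subseteq Y$ the restriction of the family to $p^{-1}(V)\to V$ is continuous. A Haar system on a locally Hausdorff, locally compact groupoid $G$ with Hausdorff object space is a continuous family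 of measures $(\lambda^x)_{x\in G^0}$ along the fibres $G^x=r^{-1}(x)$ of $r\colon G^1\to G^0$, such that $\lambda^x$ has support $G^x$ and the family is left invariant: $\int f(kg)\,d\lambda^{s(k)}(g)=\int f(g)\,d\lambda^{r(k)}(g)$ for all $k\in G^1$. *)

(* Defs.v *)
From HB Require Import structures.
From mathcomp Require Import all_boot all_order all_algebra.
From mathcomp Require Import all_classical all_reals all_analysis.
Set Implicit Arguments.
Unset Strict Implicit.
Unset Printing Implicit Defensive.
Import Order.TTheory GRing.Theory Num.Theory.
Import numFieldNormedType.Exports.
Local Open Scope classical_set_scope.
Local Open Scope ring_scope.

(* Throughout, a subset A of a topological space is turned into the space      *)
(* [set_type A], which carries the subspace topology.                          *)

Definition open_surjection (X Y : topologicalType) (p : X -> Y) : Prop :=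
  [/\ continuous p, forall U, open U -> open (p @` U) &
      forall y, exists x, p x = y].

Definition locally_hausdorff (X : topologicalType) : Prop :=
  forall x : X, exists U : set X,
    [/\ open U, U x & hausdorff_space (set_type U)].

Definition lh_locally_compact (X : topologicalType) : Prop :=
  forall (x : X) (V : set X), nbhs x V -> exists K : set X,
    [/\ nbhs x K, K `<=` V, compact K & hausdorff_space (set_type K)].

Definition Cc (R : realType) (X : topologicalType) (f : X -> R) : Prop :=
  continuous f /\ compact (closure [set x | f x != 0]).

(* [valL_ 0 g] is the extension of g : U -> R by 0 to the ambient space. The   *)
(* scalars are real: a complex function is quasi-continuous iff its real and   *)
(* imaginary parts are, and positive measures integrate it componentwise.      *)
Definition quasi_continuous (R : realType) (X : topologicalType) (f : X -> R) :
    Prop :=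
  exists (n : nat) (c : 'I_n -> R) (U : 'I_n -> set X)
      (g : forall i, set_type (U i) -> R),
    [/\ forall i, open (U i),
        forall i, hausdorff_space (set_type (U i)),
        forall i, Cc (g i) &
        forall x, f x = \sum_(i < n) c i * valL_ 0 (g i) x].

(* The measurable types of the library are pointed; [pointed_at z0] is the     *)
(* space Z, pointed by z0.                                                     *)
Definition pointed_at (Z : topologicalType) (z0 : Z) : Type := Z.
HB.instance Definition _ (Z : topologicalType) (z0 : Z) :=
  Topological.on (pointed_at z0).
HB.instance Definition _ (Z : topologicalType) (z0 : Z) :=
  isPointed.Build (pointed_at z0) z0.

Definition borel (Z : topologicalType) (z0 : Z) :=
  g_sigma_algebraType (@open (pointed_at z0)).

(* The base point serves only to form the measurable type; hence only nonempty *)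
(* spaces carry a [radon_measure], and a family of them along the fibres of p  *)
(* forces p to be surjective, as range maps of groupoids are.                  *)
Record radon_measure (R : realType) (Z : topologicalType) := RadonMeasure {
  radon_point : Z;
  radon_mu :> {measure set (borel radon_point) -> \bar R};
  radon_compact : forall K : set Z, compact K -> (radon_mu K < +oo)%E;
  radon_outer : forall A : set Z, measurable (A : set (borel radon_point)) ->
    radon_mu A = ereal_inf [set radon_mu U | U in [set U | open U /\ A `<=` U]];
  radon_inner : forall U : set Z, open U ->
    radon_mu U =
      ereal_sup [set radon_mu K | K in [set K | compact K /\ K `<=` U]] }.

Definition radon_integral (R : realType) (Z : topologicalType)
    (m : radon_measure R Z) (f : Z -> R) : R :=
  (\int[radon_mu m]_(z in setT) f z)%R.

Definition radon_support (R : realType) (Z : topologicalType)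
    (m : radon_measure R Z) : set Z :=
  [set z | forall U : set Z, open U -> U z -> (0 < radon_mu m U)%E].

Definition map_fibre (X Y : Type) (p : X -> Y) (y : Y) : set X :=
  p @^-1` [set y].

Definition measure_family (R : realType) (X Y : topologicalType) (p : X -> Y) :=
  forall y : Y, radon_measure R (set_type (map_fibre p y)).

Definition family_integral (R : realType) (X Y : topologicalType) (p : X -> Y)
    (beta : measure_family R p) (f : X -> R) (y : Y) : R :=
  radon_integral (beta y) (fun z => f (\val z)).

(* A function on p^-1(V) is written as the restriction of some f : X -> R; for *)
(* y in V the integral over p^-1(y) only involves that restriction. If Y is    *)
(* Hausdorff, V = setT gives the requirement for all quasi-continuous f on X,  *)
(* which in turn implies the one for the other V.                              *)
Definition continuous_family (R : realType) (X Y : topologicalType)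
    (p : X -> Y) (beta : measure_family R p) : Prop :=
  forall V : set Y, open V -> hausdorff_space (set_type V) ->
  forall f : X -> R,
    quasi_continuous (fun x : set_type (p @^-1` V) => f (\val x)) ->
    Cc (fun y : set_type V => family_integral beta f (\val y)).

(* The product [gmul k l] is meaningful only if src k = rng l; on the other    *)
(* pairs its value is unconstrained.                                           *)
Record topGroupoid := TopGroupoid {
  gobj : topologicalType;
  garr : topologicalType;
  rng : garr -> gobj;
  src : garr -> gobj;
  gmul : garr -> garr -> garr;
  ginv : garr -> garr;
  gone : gobj -> garr;
  rng_mul : forall k l, src k = rng l -> rng (gmul k l) = rng k;
  src_mul : forall k l, src k = rng l -> src (gmul k l) = src l;
  gmulA : forall k l m, src k = rng l -> src l = rng m ->
    gmul k (gmul l m) = gmul (gmul k l) m;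
  rng_one : forall x, rng (gone x) = x;
  src_one : forall x, src (gone x) = x;
  gmul1l : forall k, gmul (gone (rng k)) k = k;
  gmul1r : forall k, gmul k (gone (src k)) = k;
  rng_inv : forall k, rng (ginv k) = src k;
  src_inv : forall k, src (ginv k) = rng k;
  gmulVl : forall k, gmul (ginv k) k = gone (src k);
  gmulVr : forall k, gmul k (ginv k) = gone (rng k);
  rng_continuous : continuous rng;
  src_continuous : continuous src;
  rng_open : forall U, open U -> open (rng @` U);
  src_open : forall U, open U -> open (src @` U);
  gmul_continuous : continuous
    (fun kl : set_type [set kl : garr * garr | src kl.1 = rng kl.2] =>
       gmul (\val kl).1 (\val kl).2);
  ginv_continuous : continuous ginv;
  gone_continuous : continuous gone }.

Definition lhlc_groupoid (G : topGroupoid) : Prop :=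
  [/\ locally_hausdorff (garr G), lh_locally_compact (garr G),
      lh_locally_compact (gobj G) & hausdorff_space (gobj G)].

Definition haar_system (R : realType) (G : topGroupoid)
    (lam : measure_family R (@rng G)) : Prop :=
  [/\ lhlc_groupoid G,
      continuous_family lam,
      forall x, radon_support (lam x) = setT &
      forall (k : garr G) (f : garr G -> R), quasi_continuous f ->
        radon_integral (lam (src k)) (fun g => f (gmul k (\val g))) =
        radon_integral (lam (rng k)) (fun g => f (\val g))].

Record groupoid_functor (L H : topGroupoid) := GroupoidFunctor {
  fobj : gobj L -> gobj H;
  farr : garr L -> garr H;
  fobj_continuous : continuous fobj;
  farr_continuous : continuous farr;
  rng_farr : forall l, rng (farr l) = fobj (rng l);
  src_farr : forall l, src (farr l) = fobj (src l);
  farr_mul : forall k l, src k = rng l ->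
    farr (gmul k l) = gmul (farr k) (farr l) }.

Section Fibration.
Variables (L H : topGroupoid) (F : groupoid_functor L H).

Definition src_pullback : set (garr H * gobj L) :=
  [set hx | src hx.1 = fobj F hx.2].
Definition rng_pullback : set (garr H * gobj L) :=
  [set hx | rng hx.1 = fobj F hx.2].

Definition arr_src (l : garr L) : set_type src_pullback :=
  @SigSub _ _ src_pullback (farr F l, src l) (mem_set (src_farr F l)).
Definition arr_rng (l : garr L) : set_type rng_pullback :=
  @SigSub _ _ rng_pullback (farr F l, rng l) (mem_set (rng_farr F l)).

Definition is_fibration : Prop := open_surjection arr_src.

End Fibration.

Section Fibre.
Variables (L H : topGroupoid) (F : groupoid_functor L H).

Definition fibre_arr : set (garr L) :=
  [set g | farr F g = gone (fobj F (src g))].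

Lemma gmul_idem (G : topGroupoid) (e : garr G) :
  src e = rng e -> gmul e e = e -> e = gone (src e).
Proof.
move=> se ee.
have h : gmul (ginv e) (gmul e e) = gmul (gmul (ginv e) e) e.
  by apply: gmulA => //; rewrite src_inv.
by move: h; rewrite ee gmulVl {2}se gmul1l => ->.
Qed.

Lemma farr_one (x : gobj L) : farr F (gone x) = gone (fobj F x).
Proof.
have sr : src (gone x) = rng (gone x) by rewrite src_one rng_one.
rewrite (@gmul_idem H (farr F (gone x))) ?src_farr ?rng_farr ?src_one ?rng_one//.
rewrite -farr_mul//.
by have := gmul1l (gone x); rewrite rng_one => ->.
Qed.

Lemma fibre_src_rng (g : garr L) : fibre_arr g ->
  fobj F (src g) = fobj F (rng g).
Proof. by move=> Fg; rewrite -rng_farr Fg rng_one. Qed.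

Lemma fibre_arr_mul (k l : garr L) : src k = rng l ->
  fibre_arr k -> fibre_arr l -> fibre_arr (gmul k l).
Proof.
move=> kl Fk Fl; rewrite /fibre_arr /= farr_mul // Fk Fl src_mul //.
rewrite kl -(fibre_src_rng Fl).
by have := gmul1l (gone (fobj F (src l))); rewrite rng_one.
Qed.

Lemma fibre_arr_inv (k : garr L) : fibre_arr k -> fibre_arr (ginv k).
Proof.
move=> Fk; rewrite /fibre_arr /= src_inv -(fibre_src_rng Fk).
have h : gmul (farr F (ginv k)) (farr F k) = gone (fobj F (src k)).
  by rewrite -farr_mul ?src_inv // gmulVl farr_one.
have := gmul1r (farr F (ginv k)).
by rewrite src_farr src_inv -(fibre_src_rng Fk) -{1}Fk h.
Qed.

Lemma fibre_arr_one (x : gobj L) : fibre_arr (gone x).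
Proof. by rewrite /fibre_arr /= farr_one src_one. Qed.

Local Notation A := (set_type fibre_arr).

Definition fibre_rng (g : A) : gobj L := rng (\val g).
Definition fibre_src (g : A) : gobj L := src (\val g).
Definition fibre_inv (g : A) : A :=
  @SigSub _ _ fibre_arr (ginv (\val g)) (mem_set (fibre_arr_inv (set_valP g))).
Definition fibre_one (x : gobj L) : A :=
  @SigSub _ _ fibre_arr (gone x) (mem_set (fibre_arr_one x)).
Definition fibre_mul (k l : A) : A :=
  match pselect (src (\val k) = rng (\val l)) with
  | left e => @SigSub _ _ fibre_arr (gmul (\val k) (\val l))
      (mem_set (fibre_arr_mul e (set_valP k) (set_valP l)))
  | right _ => k
  end.

Lemma val_fibre_mul (k l : A) : fibre_src k = fibre_rng l ->
  \val (fibre_mul k l) = gmul (\val k) (\val l).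
Proof. by rewrite /fibre_mul; case: pselect. Qed.

Lemma val_continuous (X : topologicalType) (B : set X) :
  continuous (fun x : set_type B => \val x).
Proof. exact: initial_continuous. Qed.

Lemma continuous_val_comp (X Y : topologicalType) (B : set X)
    (f : Y -> set_type B) :
  continuous (fun y => \val (f y)) -> continuous f.
Proof. by move=> cf; apply: continuous_comp_initial. Qed.

Lemma continuous_comp_fun (X Y Z : topologicalType) (f : X -> Y) (g : Y -> Z) :
  continuous f -> continuous g -> continuous (fun x => g (f x)).
Proof. by move=> cf cg x; apply: continuous_comp; [exact: cf | exact: cg]. Qed.

Lemma continuous_pair (X Y Z : topologicalType) (f : X -> Y) (g : X -> Z) :
  continuous f -> continuous g -> continuous (fun x => (f x, g x)).
Proof. by move=> cf cg x; apply: cvg_pair; [exact: cf | exact: cg]. Qed.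

Lemma fibre_rng_mul k l : fibre_src k = fibre_rng l ->
  fibre_rng (fibre_mul k l) = fibre_rng k.
Proof. by move=> e; rewrite /fibre_rng val_fibre_mul// rng_mul. Qed.

Lemma fibre_src_mul k l : fibre_src k = fibre_rng l ->
  fibre_src (fibre_mul k l) = fibre_src l.
Proof. by move=> e; rewrite /fibre_src val_fibre_mul// src_mul. Qed.

Lemma fibre_mulA k l m : fibre_src k = fibre_rng l ->
  fibre_src l = fibre_rng m ->
  fibre_mul k (fibre_mul l m) = fibre_mul (fibre_mul k l) m.
Proof.
move=> kl lm; apply/val_inj.
by rewrite !val_fibre_mul ?fibre_rng_mul ?fibre_src_mul// gmulA.
Qed.

Lemma fibre_mul1l k : fibre_mul (fibre_one (fibre_rng k)) k = k.
Proof.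
apply/val_inj; rewrite val_fibre_mul ?gmul1l//.
by rewrite /fibre_src src_one.
Qed.

Lemma fibre_mul1r k : fibre_mul k (fibre_one (fibre_src k)) = k.
Proof.
apply/val_inj; rewrite val_fibre_mul ?gmul1r//.
by rewrite /fibre_rng rng_one.
Qed.

Lemma fibre_mulVl k : fibre_mul (fibre_inv k) k = fibre_one (fibre_src k).
Proof.
apply/val_inj; rewrite val_fibre_mul ?gmulVl//.
by rewrite /fibre_src src_inv.
Qed.

Lemma fibre_mulVr k : fibre_mul k (fibre_inv k) = fibre_one (fibre_rng k).
Proof.
apply/val_inj; rewrite val_fibre_mul ?gmulVr//.
by rewrite /fibre_rng rng_inv.
Qed.

Lemma fibre_rng_continuous : continuous fibre_rng.
Proof.
exact: (continuous_comp_fun (@val_continuous _ _) (@rng_continuous L)).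
Qed.

Lemma fibre_src_continuous : continuous fibre_src.
Proof.
exact: (continuous_comp_fun (@val_continuous _ _) (@src_continuous L)).
Qed.

Lemma fibre_inv_continuous : continuous fibre_inv.
Proof.
apply: continuous_val_comp.
exact: (continuous_comp_fun (@val_continuous _ _) (@ginv_continuous L)).
Qed.

Lemma fibre_one_continuous : continuous fibre_one.
Proof. by apply: continuous_val_comp; exact: gone_continuous. Qed.

Lemma fibre_mul_continuous : continuous
  (fun kl : set_type [set kl : A * A | fibre_src kl.1 = fibre_rng kl.2] =>
     fibre_mul (\val kl).1 (\val kl).2).
Proof.
apply: continuous_val_comp.
set D := [set kl : A * A | _].
pose C := [set kl : garr L * garr L | src kl.1 = rng kl.2].
pose j (kl : set_type D) : set_type C :=
  @SigSub _ _ C (\val (\val kl).1, \val (\val kl).2) (mem_set (set_valP kl)).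
have -> : (fun kl : set_type D => \val (fibre_mul (\val kl).1 (\val kl).2)) =
    (fun kl : set_type C => gmul (\val kl).1 (\val kl).2) \o j.
  by apply/funext => kl /=; rewrite val_fibre_mul//; exact: (set_valP kl).
have cj : continuous j.
  apply: continuous_val_comp; apply: continuous_pair.
  - apply: (continuous_comp_fun _ (@val_continuous _ _)).
    apply: (continuous_comp_fun (@val_continuous _ _)) => y; exact: cvg_fst.
  - apply: (continuous_comp_fun _ (@val_continuous _ _)).
    apply: (continuous_comp_fun (@val_continuous _ _)) => y; exact: cvg_snd.
move=> x; apply: continuous_comp; first exact: cj.
exact: gmul_continuous.
Qed.

Hypothesis Ffib : is_fibration F.

(* src : fibre -> L^0 is the pullback of the open surjection [arr_src F] along *)
(* x |-> (1_{F(x)}, x).                                                        *)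
Lemma fibre_src_open (U : set A) : open U -> open (fibre_src @` U).
Proof.
case=> W oW <-; have [_ oF _] := Ffib.
pose i (x : gobj L) : set_type (src_pullback F) :=
  @SigSub _ _ (src_pullback F) (gone (fobj F x), x)
    (mem_set (src_one (fobj F x) : src_pullback F (_, _))).
have ci : continuous i.
  apply: continuous_val_comp; apply: continuous_pair; last by move=> ?; exact: cvg_id.
  exact: (continuous_comp_fun (@fobj_continuous _ _ F) (@gone_continuous H)).
have -> : fibre_src @` (\val @^-1` W) = i @^-1` (arr_src F @` W).
  apply/seteqP; split => x /=.
    case=> g Wg <-; exists (\val g) => //; apply/val_inj => /=.
    by rewrite (set_valP g).
  case=> l Wl /(congr1 (fun z => \val z)) /= [Fl sl].
  have Al : fibre_arr l by rewrite /fibre_arr /= sl.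
  by exists (@SigSub _ _ fibre_arr l (mem_set Al)).
by apply: open_comp; [move=> + _; exact: ci | exact: oF].
Qed.

Lemma fibre_rng_open (U : set A) : open U -> open (fibre_rng @` U).
Proof.
move=> oU.
have invK : involutive fibre_inv.
  move=> g; apply/val_inj => /=; set k := \val g.
  have h : gmul (ginv (ginv k)) (gmul (ginv k) k) =
      gmul (gmul (ginv (ginv k)) (ginv k)) k.
    by apply: gmulA; rewrite src_inv.
  move: h; rewrite !gmulVl src_inv gmul1l => {2}<-.
  by rewrite -(rng_inv k) -(src_inv (ginv k)) gmul1r.
have -> : fibre_rng @` U = fibre_src @` (fibre_inv @^-1` U).
  apply/seteqP; split => x /= [g Ug <-].
    by exists (fibre_inv g); rewrite ?invK// /fibre_src /= src_inv.
  by exists (fibre_inv g) => //; rewrite /fibre_rng /= rng_inv.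
apply: fibre_src_open; apply: open_comp => //.
by move=> + _; exact: fibre_inv_continuous.
Qed.

Definition fibre : topGroupoid := @TopGroupoid (gobj L) A
  fibre_rng fibre_src fibre_mul fibre_inv fibre_one
  fibre_rng_mul fibre_src_mul fibre_mulA
  (fun x => rng_one x) (fun x => src_one x) fibre_mul1l fibre_mul1r
  (fun k => rng_inv (\val k)) (fun k => src_inv (\val k)) fibre_mulVl fibre_mulVr
  fibre_rng_continuous fibre_src_continuous fibre_rng_open fibre_src_open
  fibre_mul_continuous fibre_inv_continuous fibre_one_continuous.

End Fibre.

(* The point (h, x) of the base of [arr_rng F], for h in H^{F(x)}.             *)
Definition rng_pair (L H : topGroupoid) (F : groupoid_functor L H) (x : gobj L)
    (h : set_type (map_fibre (@rng H) (fobj F x))) : set_type (rng_pullback F) :=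
  @SigSub _ _ (rng_pullback F) (\val h, x)
    (mem_set (set_valP h : rng_pullback F (\val h, x))).

(* Main.v *)
Require Import Defs.
From HB Require Import structures.
From mathcomp Require Import all_boot all_order all_algebra.
From mathcomp Require Import all_classical all_reals all_analysis.
From mathcomp Require Import lra.
Import Order.TTheory GRing.Theory Num.Theory.
Import numFieldNormedType.Exports.
Local Open Scope classical_set_scope.
Local Open Scope ring_scope.
Set Implicit Arguments.
Unset Strict Implicit.
Unset Printing Implicit Defensive.

(* Both families are obtained from positive functionals through the Riesz representation theorem:
   on a fibre of (F, r) the functional is f |-> int f(kg) dlam(g), which by left invariance of lam
   does not depend on the arrow k, and on L^x it is the iterated integral.  Functions on a closed
   Hausdorff fibre extend to quasi-continuous functions on the ambient space (Tietze), so the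
   invariance of lam and mu, available for quasi-continuous functions only, can be applied fibrewise.
   Continuity is local: on small Hausdorff open sets U the arrows a^-1 b, with a, b in U over the
   same point, stay in a compact subset of a Hausdorff chart of the fibre groupoid, where a
   partition of unity approximates the integrand uniformly.  The same division argument shows that
   L is locally Hausdorff and locally compact and that its range fibres are Hausdorff. *)

(** * Hausdorff subspaces and local compactness *)

(** A compact subset of a locally Hausdorff space need not be closed, so a quasi-continuous function
    may be discontinuous outside its charts, and cut-offs exist only inside a chart. On a closed
    Hausdorff subspace, such as a range fibre, this defect disappears. The measure [lamdot] at a
    point could also be transported along g |-> kg, but [nu] is known only as a functional, so the
    Riesz theorem serves for both. The map (F, r) need not have continuous local sections, hence k
    cannot be chosen continuously over (h, x). The integral of f(kg) is therefore shown to be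
    continuous in k, and this descends to the base because (F, r) is open. The delicate pairs are
    those with kg outside the chart of f: there f vanishes at kg, but its compact support need not
    be closed, and nearby products must still be shown to avoid it. Invariance of [nu] combines that
    of [mu] with the independence of k: if l lies over (h, s(k)), then kl lies over (F(k)h,
    r(k)). *)

Section Subspaces.
Context {X : topologicalType}.
Implicit Types A B K : set X.

Definition subp A x (Ax : A x) : set_type A := @SigSub _ _ A x (mem_set Ax).

(** The subspace A is Hausdorff, expressed with open sets of the ambient space to avoid subtypes;
    the separating sets may meet outside A. *)
Definition hausdorff_on A := forall x y, A x -> A y -> x <> y ->
  exists U V : set X, [/\ open U, open V, U x, V y &
    forall z, A z -> U z -> V z -> False].

Lemma hausdorff_onP A : hausdorff_space (set_type A) <-> hausdorff_on A.
Proof.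
rewrite open_hausdorff; split => [h x y Ax Ay xy|h [x Ax] [y Ay] xy].
  have /h[[U V] /= [] /[!inE]] : subp Ax != subp Ay.
    by apply/eqP => /(congr1 \val).
  move=> Ux Vy [[U' oU' U'E] [V' oV' V'E] UV].
  exists U', V'; split => //.
  - by move: Ux; rewrite -U'E.
  - by move: Vy; rewrite -V'E.
  - move=> z Az U'z V'z; have : (U `&` V) (subp Az) by split; rewrite -?U'E -?V'E.
    by rewrite UV.
have [|U [V [oU oV Ux Vy UV]]] := h x y (set_mem Ax) (set_mem Ay).
  by move=> e; move/eqP: xy; apply; apply/val_inj.
exists (\val @^-1` U, \val @^-1` V); first by rewrite !inE.
split => //=.
- by exists U.
- by exists V.
- have e : (\val @^-1` U : set (set_type A)) `&` (\val @^-1` V) = set0.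
    by rewrite -subset0 => -[z Az] /= [Uz Vz]; exact: (UV _ (set_mem Az) Uz Vz).
  by apply/eqP; exact: e.
Qed.

Lemma hausdorff_onS A B : A `<=` B -> hausdorff_on B -> hausdorff_on A.
Proof.
move=> AB h x y Ax Ay xy; have [U [V [? ? ? ? UV]]] := h _ _ (AB _ Ax) (AB _ Ay) xy.
by exists U, V; split => // z /AB; exact: UV.
Qed.

Lemma hausdorff_onT : hausdorff_space X <-> hausdorff_on setT.
Proof.
rewrite open_hausdorff; split => [h x y _ _ /eqP/h[[U V] /= []]|h x y /eqP].
  rewrite !inE => Ux Vy [oU oV /eqP UV]; exists U, V; split => // z _ Uz Vz.
  by have : (U `&` V) z by []; rewrite (eqP UV).
move=> /(h _ _ I I)[U [V [oU oV Ux Vy UV]]]; exists (U, V); [by rewrite !inE|split => //].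
have e : U `&` V = set0 by rewrite -subset0 => z [Uz Vz]; exact: (UV z I Uz Vz).
by apply/eqP; exact: e.
Qed.

Lemma compact_val A (B : set (set_type A)) : compact B <-> compact (\val @` B).
Proof.
split=> cB.
  apply: continuous_compact => //; apply: continuous_subspaceT.
  exact: val_continuous.
move=> F PF FB.
have PG : ProperFilter (\val @ F) by exact: fmap_proper_filter.
have [|x [[z Bz <-] clz]] := cB (\val @ F) PG.
  by rewrite /fmap /=; apply: filterS FB; exact: preimage_image.
exists z; split => // U V FU [_ [[W oW <-] /= Wz] WV].
have GU : (\val @ F) (\val @` U) by rewrite /fmap /=; apply: filterS FU; exact: preimage_image.
have [_ [[w Uw <-] Ww]] := clz _ _ GU (open_nbhs_nbhs (conj oW Wz)).
by exists w; split => //; exact: WV.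
Qed.

Lemma compact_preval A K : K `<=` A -> compact K ->
  compact (\val @^-1` K : set (set_type A)).
Proof.
move=> KA cK; apply/compact_val.
suff -> : \val @` (\val @^-1` K : set (set_type A)) = K by [].
by apply/seteqP; split => [_ [z Kz <-]//|x Kx]; exists (subp (KA _ Kx)).
Qed.

Lemma nbhs_val A (z : set_type A) (U : set X) :
  nbhs (\val z) U -> nbhs z (\val @^-1` U : set (set_type A)).
Proof. by move=> ?; exact: (@val_continuous X A z). Qed.

Lemma nbhs_valP A (z : set_type A) (V : set (set_type A)) :
  nbhs z V -> exists2 U : set X, open U & U (\val z) /\ \val @^-1` U `<=` V.
Proof. by move=> [_ [[W oW <-] Wz WV]]; exists W. Qed.

Lemma open_val A (V : set (set_type A)) : open A -> open V -> open (\val @` V).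
Proof.
move=> oA [W oW <-].
suff -> : \val @` (\val @^-1` W : set (set_type A)) = A `&` W by exact: openI.
apply/seteqP; split => [_ [z Wz <-]|x [Ax Wx]]; last by exists (subp Ax).
by split => //; exact: (set_valP z).
Qed.

Lemma lh_locally_compactP : lh_locally_compact X <->
  forall (x : X) (V : set X), nbhs x V -> exists K : set X,
    [/\ nbhs x K, K `<=` V, compact K & hausdorff_on K].
Proof.
by split=> h x V /h[K [? ? ? /hausdorff_onP ?]]; exists K.
Qed.

Lemma locally_hausdorffP : locally_hausdorff X <->
  forall x : X, exists U : set X, [/\ open U, U x & hausdorff_on U].
Proof. by split=> h x; have [U [? ? /hausdorff_onP ?]] := h x; exists U. Qed.

Lemma locally_hausdorff_T1 : locally_hausdorff X -> accessible_space X.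
Proof.
move=> /locally_hausdorffP lX x y /eqP xy; have [U [oU Ux hU]] := lX x.
have [Uy|nUy] := pselect (U y); last by exists U; split; rewrite ?inE.
have [V [W [oV _ Vx Wy VW]]] := hU _ _ Ux Uy xy.
by exists V; split; rewrite ?inE//= => Vy; exact: VW Uy Vy Wy.
Qed.

End Subspaces.

Lemma hausdorff_on_preimage (X Y : topologicalType) (f : Y -> X) (K : set X) (B : set Y) :
  continuous f -> (forall x y, B x -> B y -> f x = f y -> x = y) ->
  (forall x, B x -> K (f x)) -> hausdorff_on K -> hausdorff_on B.
Proof.
move=> cf fI BK hK x y Bx By xy.
have [|U [V [oU oV Ux Vy UV]]] := hK _ _ (BK _ Bx) (BK _ By).
  by move=> /(fI _ _ Bx By).
exists (f @^-1` U), (f @^-1` V); split => //; try by apply: open_comp => // + _; exact: cf.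
by move=> z /BK; exact: UV.
Qed.

Section Subspaces2.
Context {X : topologicalType}.
Implicit Types A B K : set X.

Lemma hausdorff_on_preval A K : hausdorff_on K ->
  hausdorff_on (\val @^-1` K : set (set_type A)).
Proof.
move=> hK; apply: (hausdorff_on_preimage _ _ _ hK); first exact: val_continuous.
  by move=> x y _ _ /val_inj.
by [].
Qed.

(** Common core of the open and the closed case: only the trace of K on A has to be compact and
    Hausdorff. *)
Lemma lhlc_sub A :
  (forall x U, A x -> nbhs x U -> exists K, [/\ nbhs x K, K `<=` U, compact (K `&` A) &
     hausdorff_on (K `&` A)]) -> lh_locally_compact (set_type A).
Proof.
move=> h; apply/lh_locally_compactP => -[x Ax] V /nbhs_valP[U oU [/= Ux UV]].
have [K [nK KU cK hK]] := h x U (set_mem Ax) (open_nbhs_nbhs (conj oU Ux)).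
exists (\val @^-1` K); split.
- exact: nbhs_val.
- by move=> z Kz; apply: UV; exact: KU.
- apply/compact_val.
  suff -> : \val @` (\val @^-1` K : set (set_type A)) = K `&` A by [].
  apply/seteqP; split => [_ [z Kz <-]|y [Ky Ay]]; last by exists (subp Ay).
  by split => //; exact: (set_valP z).
- apply: hausdorff_on_preimage hK; first exact: val_continuous.
    by move=> y z _ _ /val_inj.
  by move=> z Kz; split => //; exact: (set_valP z).
Qed.

Lemma lhlc_open A : open A -> lh_locally_compact X -> lh_locally_compact (set_type A).
Proof.
move=> oA /lh_locally_compactP lX; apply: lhlc_sub => x U Ax nU.
have [K [nK KU cK hK]] := lX x (U `&` A) (filterI nU (open_nbhs_nbhs (conj oA Ax))).
have KA : K `&` A = K by apply/setIidPl => z /KU[].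
by exists K; rewrite KA; split => // z /KU[].
Qed.

Lemma lhlc_closed A : closed A -> lh_locally_compact X -> lh_locally_compact (set_type A).
Proof.
move=> cA /lh_locally_compactP lX; apply: lhlc_sub => x U Ax nU.
have [K [nK KU cK hK]] := lX x U nU.
exists K; split => //; first exact: compact_closedI.
exact: hausdorff_onS hK.
Qed.

(** Substitute for closedness of compact sets, which fails in X: inside a Hausdorff subset A, a
    point outside a compact K has a neighbourhood missing K. Each point of K is separated from x,
    and compactness makes the neighbourhood of x uniform. *)
Lemma hausdorff_compact_sep A K x : hausdorff_on A -> K `<=` A -> compact K ->
  A x -> ~ K x -> exists2 O : set X, open O /\ O x & forall z, A z -> O z -> ~ K z.
Proof.
move=> hA KA /compact_near_coveringP cK Ax nKx.
have : \forall y \near nbhs x, K `<=` fun z => A y -> y <> z.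
  apply: (cK _ (nbhs x) (fun y z => A y -> y <> z)) => z Kz.
  have [|U [V [oU oV Uz Vx UV]]] := hA _ _ (KA _ Kz) Ax.
    by move=> e; apply: nKx; rewrite -e.
  exists (U, V); first by split => /=; exact: open_nbhs_nbhs.
  by move=> [z' y] [/= Uz' Vy] Ay e; apply: (UV y) => //; rewrite e.
rewrite nbhsE => -[ O [oO Ox] OK]; exists O => // z Az Oz Kz.
exact: (OK z Oz z Kz Az).
Qed.

(** The subcover is indexed by natural numbers below n, the form in which partitions of unity are
    built by induction. The covering form of compactness is available on pointed spaces, hence the
    separate case of empty K. *)
Lemma compact_finite_cover K (O : X -> set X) : compact K ->
  (forall x, K x -> open (O x) /\ O x x) ->
  exists n (U : nat -> set X), (forall i, (i < n)%N -> exists2 x, K x & U i = O x) /\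
    K `<=` \bigcup_(i in [set i | (i < n)%N]) U i.
Proof.
move=> cK h; have [->|/set0P[x0 Kx0]] := eqVneq K set0.
  by exists 0%N, (fun=> set0); split.
have {}cK : cover_compact (K : set (pointed_at x0)) by rewrite -compact_cover.
have [|x Kx|D DK KD] := cK X K O; first by move=> x /h[].
  by exists x => //; have [] := h x Kx.
pose s := finmap.enum_fset D; exists (size s), (fun i => O (nth x0 s i)); split.
  move=> i iD; exists (nth x0 s i) => //.
  by have := DK _ (mem_nth x0 iD); rewrite inE.
move=> x /KD[y /= yD Oy]; exists (index y s); first by rewrite /= index_mem.
by rewrite nth_index.
Qed.

End Subspaces2.

(** * Compactly supported functions *)

Section CompactInd.
Context {X : topologicalType}.

(** Compactness as an induction principle: a property stable under finite unions that holds near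
    each point of K holds on an open set around K. *)
Lemma compact_ind (K : set X) (Q : set X -> Prop) : compact K ->
  Q set0 -> (forall A B, Q A -> Q B -> Q (A `|` B)) ->
  (forall x, K x -> exists2 N : set X, open N /\ N x & Q N) ->
  exists2 N : set X, open N & K `<=` N /\ Q N.
Proof.
move=> cK Q0 QU h.
have /choice[N hO] : forall x, exists N : set X, K x -> [/\ open N, N x & Q N].
  move=> x; have [/h[N [? ?] ?]|nK] := pselect (K x); first by exists N.
  by exists set0.
have [|n [U [hU KU]]] := @compact_finite_cover X K N cK.
  by move=> x /hO[].
exists (\bigcup_(i in [set i | (i < n)%N]) U i).
  by apply: bigcup_open => i /= /hU[x /hO[oO _ _] ->].
split => //; rewrite bigcup_mkord; elim/big_ind : _ => // i _.
by have [x /hO[_ _ QO] ->] := hU i (ltn_ord i).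
Qed.

Lemma compact_sandwich (K U : set X) : lh_locally_compact X -> compact K ->
  open U -> K `<=` U ->
  exists C, [/\ compact C, K `<=` C^° & C `<=` U].
Proof.
move=> /lh_locally_compactP lX cK oU KU.
have [|A B [C [cC AC CU]] [D [cD BD DU]]|x Kx|N oO [KO [C [cC OC CU]]]] :=
  @compact_ind K (fun A => exists C, [/\ compact C, A `<=` C & C `<=` U]) cK.
- by exists set0; split => //; exact: compact0.
- exists (C `|` D); split; first exact: compactU.
    by apply: setUSS.
  by rewrite subUset.
- have [C [nC CU cC _]] := lX x U (open_nbhs_nbhs (conj oU (KU _ Kx))).
  exists (C^°); first by split; [exact: open_interior|].
  by exists C; split => //; exact: interior_subset.
- exists C; split => // x /KO Ox.
  by apply: (filterS OC); exact: open_nbhs_nbhs.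
Qed.

End CompactInd.

Section Cc.
Context {R : realType} {X : topologicalType}.
Implicit Types f g : X -> R.

(** The support condition asks for a compact S inside U rather than for a compact closure, because
    closures of compact sets need not be compact without the Hausdorff property. *)
Definition CcOn (U : set X) f := continuous f /\
  exists2 S, compact S & S `<=` U /\ forall x, ~ S x -> f x = 0.

Lemma Cc_closed f (K : set X) : continuous f -> compact K -> closed K ->
  (forall x, ~ K x -> f x = 0) -> Cc f.
Proof.
move=> cf cK clK f0; split => //; apply: (@subclosed_compact _ _ K) => //.
  exact: closed_closure.
rewrite [X in _ `<=` X]((closure_id K).1 clK); apply: closureS => x /= /eqP fx.
by apply: contrapT => /f0.
Qed.

Lemma CcOn_Cc f U : hausdorff_space X -> CcOn U f -> Cc f.
Proof.
move=> hX [cf [S cS [_ S0]]]; apply: Cc_closed S0 => //; exact: compact_closed.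
Qed.

Lemma CcOnS f U V : U `<=` V -> CcOn U f -> CcOn V f.
Proof.
by move=> UV [cf [S cS [SU S0]]]; split => //; exists S => //; split => // x /SU/UV.
Qed.

Lemma Cc_support f : Cc f -> exists K, [/\ compact K, closed K & forall x, ~ K x -> f x = 0].
Proof.
move=> [cf cK]; exists (closure [set x | f x != 0]); split => //.
  exact: closed_closure.
move=> x nK; apply/eqP; apply: contrapT => /negP fx; apply: nK.
exact: subset_closure.
Qed.

Lemma Cc_CcOn f : Cc f -> CcOn setT f.
Proof.
by move=> fC; have [K [cK _ K0]] := Cc_support fC; split; [case: fC|exists K].
Qed.

Lemma Cc0 : Cc (fun _ : X => 0 : R).
Proof.
apply: (@Cc_closed _ set0) => //; first exact: cst_continuous.
  exact: compact0.
exact: closed0.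
Qed.

Lemma Cc_dom f g : Cc f -> continuous g -> (forall x, f x = 0 -> g x = 0) -> Cc g.
Proof.
move=> fC cg fg; have [K [cK clK K0]] := Cc_support fC.
by apply: (Cc_closed cg cK clK) => x /K0/fg.
Qed.

Lemma CcD f g : Cc f -> Cc g -> Cc (fun x => f x + g x).
Proof.
move=> fC gC; have [K [cK clK K0]] := Cc_support fC.
have [K' [cK' clK' K'0]] := Cc_support gC.
apply: (@Cc_closed _ (K `|` K')).
- by move=> x; apply: continuousD; [case: fC => + _; exact|case: gC => + _; exact].
- exact: compactU.
- exact: closedU.
- by move=> x /not_orP[/K0 -> /K'0 ->]; rewrite addr0.
Qed.

Lemma CcZ f c : Cc f -> Cc (fun x => c * f x).
Proof.
move=> fC; apply: (Cc_dom fC); last by move=> x ->; rewrite mulr0.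
by move=> x; apply: continuousM; [exact: cst_continuous|case: fC => + _; exact].
Qed.

Lemma Cc_sum n (f : nat -> X -> R) : (forall i, (i < n)%N -> Cc (f i)) ->
  Cc (fun x => \sum_(i < n) f i x).
Proof.
elim: n => [|n IH] h.
  by under eq_fun do rewrite big_ord0; exact: Cc0.
under eq_fun do rewrite big_ord_recr/=.
by apply: CcD; [apply: IH => i /ltnW; exact: h|exact: h].
Qed.

Lemma Cc_bounded f : Cc f -> exists2 M, 0 <= M & forall x, `|f x| <= M.
Proof.
move=> fC; have [K [cK _ K0]] := Cc_support fC.
have cfK : {within K, continuous f} by apply: continuous_subspaceT; case: fC.
have /compact_bounded[M [Mr Mf]] := continuous_compact cfK cK.
exists (`|M| + 1) => [|x]; first by rewrite addr_ge0.
have [Kx|/K0 ->] := pselect (K x); last by rewrite normr0 addr_ge0.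
by apply: Mf; [rewrite (le_lt_trans (ler_norm M))// ltrDl|exists x].
Qed.

End Cc.

Lemma Cc_homeo (R : realType) (X Y : topologicalType) (f : Y -> R)
  (phi : X -> Y) (psi : Y -> X) : continuous phi -> continuous psi ->
  cancel phi psi -> cancel psi phi -> Cc f -> Cc (f \o phi).
Proof.
move=> cphi cpsi phiK psiK fC; have [K [cK clK K0]] := Cc_support fC.
apply: (@Cc_closed _ _ _ (phi @^-1` K)).
- by move=> x; apply: continuous_comp; [exact: cphi|case: fC => + _; exact].
- suff -> : phi @^-1` K = psi @` K.
    by apply: continuous_compact => //; exact: continuous_subspaceT.
  apply/seteqP; split=> [x Kx|_ [y Ky <-]]; last by rewrite /preimage/= psiK.
  by exists (phi x).
- by apply: closed_comp => // x _; exact: cphi.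
- by move=> x /K0.
Qed.

(** * Urysohn, Tietze and partitions in locally compact Hausdorff spaces *)

Section LCH.
Context {R : realType} {X : topologicalType}.
Hypothesis hX : hausdorff_space X.
Hypothesis lX : lh_locally_compact X.

(** The one-point compactification is compact Hausdorff, hence normal, so Urysohn and Tietze are
    applied there and pulled back along [Some]. *)
Let opc := @one_point_compactification X.

Let lcX : locally_compact [set: X].
Proof.
move=> x _; rewrite withinET.
have [K [nK _ cK _]] := lX (@filterT _ (nbhs x) _).
by exists K => //; split => //; exact: compact_closed.
Qed.

Let opc_hausdorff : hausdorff_space opc.
Proof. exact: one_point_compactification_hausdorff. Qed.

Let opc_normal : normal_space opc.
Proof. exact/compact_normal/one_point_compactification_compact. Qed.

Let compact_some (K : set X) : compact K -> closed (Some @` K : set opc).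
Proof.
move=> cK; apply: compact_closed => //; apply: continuous_compact => //.
apply: continuous_subspaceT; exact: one_point_compactification_some_continuous.
Qed.

(** Two nested compact neighbourhoods D and C of K inside U: the function is 1 on D, hence on an
    open set around K, and 0 off the interior of C, the point at infinity included. *)
Lemma lch_urysohn (K U : set X) : compact K -> open U -> K `<=` U ->
  exists f : X -> R, [/\ continuous f, forall x, 0 <= f x <= 1,
    exists2 N : set X, open N & K `<=` N /\ (forall x, N x -> f x = 1) &
    exists2 C, compact C & C `<=` U /\ (forall x, ~ C x -> f x = 0)].
Proof.
move=> cK oU KU; have [C [cC KC CU]] := compact_sandwich lX cK oU KU.
have [D [cD KD DC]] := compact_sandwich lX cK (open_interior C) KC.
have clA : closed (~` (Some @` C^°) : set opc).
  apply: open_closedC; apply: one_point_compactification_open_some.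
  exact: open_interior.
have [|g [cg gA gD g01]] := @urysohn_ext_itv opc R opc_normal _ _ 0 1 clA (compact_some cD) _ ltr01.
  by rewrite -subset0 => z [/= nz [x /DC Cx xz]]; apply: nz; exists x.
exists (g \o Some); split.
- move=> x; apply: continuous_comp; last exact: cg.
  exact: one_point_compactification_some_continuous.
- by move=> x; have := g01 (g (Some x)) (imageT _ _); rewrite /= in_itv.
- exists D^°; first exact: open_interior.
  split => // x /interior_subset Dx /=; apply: gD; exists (Some x) => //.
- exists C => //; split => // x nC; apply: gA; exists (Some x) => // -[y /interior_subset Cy [yx]].
  by apply: nC; rewrite -yx.
Qed.

Lemma lch_tietze (Q : set X) (f : X -> R) : compact Q -> {within Q, continuous f} ->
  exists2 g : X -> R, continuous g & forall x, Q x -> g x = f x.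
Proof.
move=> cQ cf.
have /compact_bounded[M [Mr Mf]] := continuous_compact cf cQ.
pose M' := `|M| + 1.
have M'0 : 0 < M' by rewrite ltr_wpDl.
have fM x : Q x -> `|f x| <= M'.
  move=> Qx; apply: Mf; last by exists x.
  by rewrite (le_lt_trans (ler_norm M))// ltrDl.
(* The value at infinity is arbitrary: the image of Q does not contain that point. *)
pose f' (z : opc) : R := if z is Some x then f x else 0.
have cf' : {within (Some @` Q : set opc), continuous f'}.
  apply/subspace_continuousP => _ [x Qx <-] W /= Wx.
  have cfx : \forall y \near x, Q y -> W (f y).
    by move/subspace_continuousP : cf => /(_ x Qx W Wx).
  suff : \forall y \near x, (Some @` Q : set opc) (Some y) -> W (f y) by [].
  by apply: filterS cfx => y /= h [z Qz [zy]]; apply: h; rewrite -zy.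
have [|g [gf cg _]] := @continuous_bounded_extension opc R opc_normal _ (compact_some cQ) f' M' M'0 cf'.
  by move=> _ [x Qx <-]; exact: fM.
exists (g \o Some).
  move=> x; apply: continuous_comp; last exact: cg.
  exact: one_point_compactification_some_continuous.
by move=> x Qx /=; rewrite -gf//; rewrite inE; exists x.
Qed.

(** Take chi equal to 1 near the part of the support S outside V, with compact support in U. Then
    [f * (1 - chi)] lives on S minus that neighbourhood, a compact subset of V. *)
Lemma CcOn_split (U V : set X) (f : X -> R) : open U -> open V -> CcOn (U `|` V) f ->
  exists chi : X -> R, [/\ forall x, 0 <= chi x <= 1, CcOn U (fun x => f x * chi x) &
    CcOn V (fun x => f x * (1 - chi x))].
Proof.
move=> oU oV [cf [S cS [SUV S0]]].
have cSV : compact (S `&` ~` V) by apply: compact_closedI => //; exact: open_closedC.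
have [|chi [cchi chi01 [N oN [KN N1]] [C cC [CU C0]]]] := lch_urysohn cSV oU.
  by move=> x [/SUV[]].
exists chi; split => //; split.
- by move=> x; apply: continuousM; [exact: cf|exact: cchi].
- by exists C => //; split => // x /C0 ->; rewrite mulr0.
- move=> x; apply: (@continuousM _ _ f (fun x => 1 - chi x)); first exact: cf.
  by apply: continuousB; [exact: cst_continuous|exact: cchi].
- exists (S `&` ~` N); first by apply: compact_closedI => //; exact: open_closedC.
  split => [x [Sx nNx]|x nSN].
    by apply: contrapT => nVx; apply: nNx; exact: KN.
  have [Sx|/S0 ->] := pselect (S x); last by rewrite mul0r.
  rewrite N1 ?subrr ?mulr0//; apply: contrapT => nN; exact: nSN.
Qed.

(** It is f itself, not the constant 1, that is decomposed; the last open set is peeled off with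
    [CcOn_split]. The factors chi and 1 - chi preserve positivity. *)
Lemma CcOn_partition n (U : nat -> set X) (f : X -> R) :
  (forall i, (i < n)%N -> open (U i)) -> CcOn (\bigcup_(i in [set i | (i < n)%N]) U i) f ->
  exists g : nat -> X -> R, [/\ forall i, (i < n)%N -> CcOn (U i) (g i),
    forall x, f x = \sum_(i < n) g i x &
    (forall x, 0 <= f x) -> forall i x, (i < n)%N -> 0 <= g i x].
Proof.
elim: n f => [|n IH] f oU.
  move=> [_ [S _ [S0 f0]]]; exists (fun=> cst 0); split => // x.
  by rewrite big_ord0 f0// => /S0[].
have -> : \bigcup_(i in [set i | (i < n.+1)%N]) U i =
    (\bigcup_(i in [set i | (i < n)%N]) U i) `|` U n.
  by rewrite !bigcup_mkord big_ord_recr.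
move=> /CcOn_split[||chi [chi01 c1 c2]].
- by apply: bigcup_open => i /= ilt; apply: oU; rewrite ltnS ltnW.
- exact: oU.
have [i /ltnW|g [gC gs g0]] := IH _ _ c1; first exact: oU.
exists (fun i => if i == n then fun x => f x * (1 - chi x) else g i); split.
- move=> i; rewrite ltnS leq_eqVlt; case: eqP => [-> _//|_ /=]; exact: gC.
- move=> x; rewrite big_ord_recr/= eqxx.
  rewrite (eq_bigr (fun i : 'I_n => g i x)); last by move=> i _; rewrite ltn_eqF.
  by rewrite -gs -mulrDr addrC subrK mulr1.
- move=> f0 i x; rewrite ltnS leq_eqVlt; case: eqP => [_ _|_ /=].
    by rewrite mulr_ge0// subr_ge0; case/andP: (chi01 x).
  by apply: g0 => y; rewrite mulr_ge0//; case/andP: (chi01 y).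
Qed.

End LCH.

(** * The Riesz representation theorem *)

Lemma Cc_additive_sum (R : realType) (X : topologicalType) (T : (X -> R) -> R) n
  (g : nat -> X -> R) :
  (forall f g, Cc f -> Cc g -> T (fun x => f x + g x) = T f + T g) ->
  (forall i, (i < n)%N -> Cc (g i)) ->
  T (fun x => \sum_(i < n) g i x) = \sum_(i < n) T (g i).
Proof.
move=> TD; elim: n => [_|n IH gC].
  rewrite big_ord0 (_ : (fun _ => _) = fun=> 0); last first.
    by apply/funext => x; rewrite big_ord0.
  (* Additivity alone gives T 0 = 0, by cancelling in T 0 + T 0 = T (0 + 0). *)
  apply: (addIr (T (fun=> 0))); rewrite add0r -TD; try exact: Cc0.
  by congr T; apply/funext => x; rewrite addr0.
rewrite big_ord_recr/= -IH => [|i ni]; last by apply: gC; exact: ltnW.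
rewrite -TD; [|apply: Cc_sum => i ni; apply: gC; exact: ltnW|exact: gC].
by congr T; apply/funext => x; rewrite big_ord_recr.
Qed.

Section RieszOuter.
Context {R : realType} {X : topologicalType}.
Hypothesis hX : hausdorff_space X.
Hypothesis lX : lh_locally_compact X.
Variable Lam : (X -> R) -> R.
Hypothesis LamD : forall f g, Cc f -> Cc g -> Lam (fun x => f x + g x) = Lam f + Lam g.
Hypothesis LamZ : forall c f, Cc f -> Lam (fun x => c * f x) = c * Lam f.
Hypothesis Lam_ge0 : forall f, Cc f -> (forall x, 0 <= f x) -> 0 <= Lam f.

Lemma riesz_le f g : Cc f -> Cc g -> (forall x, f x <= g x) -> Lam f <= Lam g.
Proof.
move=> fC gC fg; rewrite -subr_ge0.
have -> : Lam g - Lam f = Lam (fun x => g x + -1 * f x).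
  by rewrite LamD ?LamZ ?mulN1r//; exact: CcZ.
apply: Lam_ge0; first by apply: CcD => //; exact: CcZ.
by move=> x; rewrite mulN1r subr_ge0.
Qed.

Lemma riesz0 : Lam (fun=> 0) = 0.
Proof.
have := LamZ 0 (@Cc0 R X).
by rewrite !mul0r.
Qed.

Definition unit_Cc (U : set X) (f : X -> R) := CcOn U f /\ forall x, 0 <= f x <= 1.

Lemma unit_Cc0 U : unit_Cc U (fun=> 0).
Proof.
split; last by move=> x; rewrite lexx ler01.
split; first exact: cst_continuous.
by exists set0; [exact: compact0|split].
Qed.

(** The usual content of the Riesz construction: the supremum of [Lam f] over functions with values
    in [0, 1] and compact support in U. The outer measure below extends it to all sets by outer
    regularity. *)
Definition riesz_open (U : set X) : \bar R :=
  ereal_sup [set (Lam f)%:E | f in unit_Cc U].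

Definition riesz_outer (A : set X) : \bar R :=
  ereal_inf [set riesz_open U | U in [set U | open U /\ A `<=` U]].

Local Open Scope ereal_scope.

Lemma le_riesz_open U V : U `<=` V -> riesz_open U <= riesz_open V.
Proof.
move=> UV; apply: ereal_sup_le => _ [f [fU f01] <-]; exists f => //; split => //.
exact: CcOnS fU.
Qed.

Lemma riesz_open_ge0 U : 0 <= riesz_open U.
Proof. by apply: ereal_sup_ubound; exists (fun=> 0%R); [exact: unit_Cc0|rewrite riesz0]. Qed.

Lemma riesz_open_ge U f : unit_Cc U f -> (Lam f)%:E <= riesz_open U.
Proof. by move=> fU; apply: ereal_sup_ubound; exists f. Qed.

Lemma riesz_outer_open U : open U -> riesz_outer U = riesz_open U.
Proof.
move=> oU; apply/eqP; rewrite eq_le; apply/andP; split.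
  by apply: ereal_inf_lbound; exists U => //; split.
by apply: le_ereal_inf_tmp => _ [V [oV UV] <-]; exact: le_riesz_open.
Qed.

Lemma riesz_outer_le A U : open U -> A `<=` U -> riesz_outer A <= riesz_open U.
Proof. by move=> oU AU; apply: ereal_inf_lbound; exists U. Qed.

Lemma riesz_outer0 : riesz_outer set0 = 0.
Proof.
rewrite riesz_outer_open; last exact: open0.
apply/eqP; rewrite eq_le riesz_open_ge0 andbT; apply: ge_ereal_sup.
move=> _ [f [[_ [S _ [S0 f0]]] _] <-].
have -> : f = (fun=> 0%R) by apply/funext => x; apply: f0 => /S0.
by rewrite riesz0.
Qed.

Lemma riesz_outer_ge0 A : 0 <= riesz_outer A.
Proof. by apply: le_ereal_inf_tmp => _ [U _ <-]; exact: riesz_open_ge0. Qed.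

Lemma le_riesz_outer : {homo riesz_outer : A B / A `<=` B >-> A <= B}.
Proof.
move=> A B AB; apply: ereal_inf_le_tmp => _ [U [oU BU] <-]; exists U => //.
by split => //; exact: subset_trans BU.
Qed.

(** The compact support of a test function f is covered by finitely many of the U i, so f is a
    finite sum of test functions for them; each summand stays below f, hence below 1. *)
Lemma riesz_open_bigcup (U : (set X)^nat) : (forall i, open (U i)) ->
  riesz_open (\bigcup_i U i) <= \sum_(i <oo) riesz_open (U i).
Proof.
move=> oU; apply: ge_ereal_sup => _ [f [[cf [S cS [SU S0]]] f01] <-].
have [||x /SU[i _ Uix]|N oN [SN [n Nn]]] :=
  @compact_ind X S (fun A => exists n, A `<=` \bigcup_(i in [set i | (i < n)%N]) U i) cS.
- by exists 0%N.
- move=> A B [n An] [m Bm]; exists (maxn n m); rewrite subUset; split.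
    move=> x /An[i /= ni Ui]; exists i => //=; exact: leq_trans ni (leq_maxl _ _).
  move=> x /Bm[i /= ni Ui]; exists i => //=; exact: leq_trans ni (leq_maxr _ _).
- by exists (U i) => //; exists i.+1 => y Uy; exists i => /=.
have fU : CcOn (\bigcup_(i in [set i | (i < n)%N]) U i) f.
  by split => //; exists S => //; split => // x /SN/Nn.
have [i _|g [gC gs g0]] := CcOn_partition hX lX _ fU; first exact: oU.
have f0 x : (0 <= f x)%R by case/andP: (f01 x).
have -> : Lam f = (\sum_(i < n) Lam (g i))%R.
  rewrite (_ : f = (fun x => \sum_(i < n) g i x)%R); last exact/funext.
  by apply: (Cc_additive_sum LamD) => i ni; exact: CcOn_Cc hX (gC i ni).
rewrite -sumEFin; apply: (@le_trans _ _ (\sum_(i < n) riesz_open (U i))).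
  apply: lee_sum => i _; apply: riesz_open_ge; split; first exact: gC.
  move=> x; rewrite g0//=; apply: le_trans (proj2 (andP (f01 x))).
  rewrite gs (bigD1 i)//= lerDl sumr_ge0// => j _; exact: g0.
rewrite -(big_mkord xpredT (fun i => riesz_open (U i))).
by apply: nneseries_lim_ge => i _ _; exact: riesz_open_ge0.
Qed.

Lemma riesz_outer_sigma_subadditive : sigma_subadditive riesz_outer.
Proof.
move=> A; suff add2e (e : {posnum R}) :
    riesz_outer (\bigcup_n A n) <= \sum_(i <oo) riesz_outer (A i) + e%:num%:E.
  by apply/lee_addgt0Pr => _/posnumP[].
apply: le_trans (@epsilon_trick R (fun n => riesz_outer (A n)) e%:num xpredT _ _) => //;
  last by move=> n; exact: riesz_outer_ge0.
have /choice[U hU] : forall n, exists U, [/\ open U, A n `<=` U &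
    riesz_open U <= riesz_outer (A n) + (e%:num / (2 ^ n.+1)%:R)%:E].
  move=> n; have [fA|] := boolP (riesz_outer (A n) \is a fin_num).
    have en1 : (0 < e%:num / (2 ^ n.+1)%:R)%R by [].
    by have [_ [U [oU AU] <-] /ltW] := lb_ereal_inf_adherent en1 fA; exists U.
  (* If the outer measure of [A n] is infinite, the whole space is an admissible open superset. *)
  rewrite ge0_fin_numE ?riesz_outer_ge0// -leNgt leye_eq => /eqP ->.
  by exists setT; split; [exact: openT|exact: subsetT|rewrite addye// leey].
apply: (@le_trans _ _ (riesz_open (\bigcup_n U n))).
  apply: riesz_outer_le; first by apply: bigcup_open => i _; case: (hU i).
  by apply: subset_bigcup => i _; case: (hU i).
apply: (le_trans (riesz_open_bigcup _)); first by move=> i; case: (hU i).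
by apply: lee_nneseries => [i _ _|i _]; [exact: riesz_open_ge0|case: (hU i)].
Qed.

(** If f is a test function for the intersection of V and U, with support S, and g one for V minus
    S, then the supports are disjoint and f + g is a test function for V. Moreover V minus U is
    contained in the open set V minus S. *)
Lemma riesz_open_split U V : open U -> open V ->
  riesz_open (V `&` U) + riesz_outer (V `&` ~` U) <= riesz_open V.
Proof.
move=> oU oV; have [->|] := eqVneq (riesz_open V) +oo; first exact: leey.
rewrite -ltey => Voo.
have fc : riesz_outer (V `&` ~` U) \is a fin_num.
  rewrite ge0_fin_numE ?riesz_outer_ge0//; apply: le_lt_trans Voo.
  by apply: riesz_outer_le => // x [].
rewrite -leeBrDr//; apply: ge_ereal_sup => _ [f [fVU f01] <-].
have [cf [S cS [SVU S0]]] := fVU.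
rewrite leeBrDr// addeC -leeBrDr//.
have oVS : open (V `&` ~` S).
  by apply: openI => //; apply: closed_openC; exact: compact_closed.
apply: (@le_trans _ _ (riesz_open (V `&` ~` S))).
  by apply: riesz_outer_le => // x [Vx nUx]; split => // /SVU[].
apply: ge_ereal_sup => _ [g [gVS g01] <-]; rewrite leeBrDr// -EFinD.
rewrite -LamD; [|exact: CcOn_Cc gVS|exact: CcOn_Cc fVU].
have [cg [S' cS' [S'VS S'0]]] := gVS.
apply: riesz_open_ge; split; first split.
- by move=> x; apply: continuousD; [exact: cg|exact: cf].
- exists (S' `|` S); first exact: compactU.
  split; first by rewrite subUset; split => x => [/S'VS[]|/SVU[]].
  by move=> x /not_orP[/S'0 -> /S0 ->]; rewrite addr0.
- move=> x; have [S'x|/S'0 ->] := pselect (S' x); last by rewrite add0r.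
  by have [_ /S0 ->] := S'VS _ S'x; rewrite addr0.
Qed.

Lemma riesz_caratheodory U : open U -> riesz_outer.-caratheodory U.
Proof.
move=> oU Y.
apply/eqP; rewrite eq_le; apply/andP; split; last first.
  apply: le_ereal_inf_tmp => _ [V [oV YV] <-].
  apply: le_trans (riesz_open_split oU oV); apply: leeD.
    by apply: riesz_outer_le; [exact: openI|exact: setSI].
  by apply: le_riesz_outer; exact: setSI.
have := riesz_outer_sigma_subadditive (bigcup2 (Y `&` U) (Y `&` ~` U)).
rewrite bigcup2E -setIUr setUv setIT => /le_trans; apply.
rewrite (nneseries_split 0 2)//; last by move=> k _; exact: riesz_outer_ge0.
rewrite !big_nat_recl//= big_nil adde0 eseries0 ?adde0 ?lexx//.
by move=> [|[|i]]//= _ _; rewrite riesz_outer0.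
Qed.

(** A Urysohn function f equal to 1 on an open N around K dominates every test function for N, so
    [Lam f] bounds the outer measure of N. *)
Lemma riesz_outer_compact_lty K : compact K -> riesz_outer K < +oo.
Proof.
move=> cK.
have [f [cf f01 [N oN [KN N1]] [C cC [_ C0]]]] := @lch_urysohn R X hX lX K setT cK openT (subsetT _).
have fC : Cc f by apply: (@CcOn_Cc _ _ _ setT) => //; split => //; exists C.
apply: le_lt_trans (riesz_outer_le oN KN) _.
apply: (@le_lt_trans _ _ (Lam f)%:E); last exact: ltry.
apply: ge_ereal_sup => _ [g [gN g01] <-]; rewrite lee_fin.
apply: riesz_le => //; first exact: CcOn_Cc gN.
move=> x; have [Nx|nN] := pselect (N x); first by rewrite N1//; case/andP: (g01 x).
have [_ [S _ [SN S0]]] := gN; rewrite S0; last by move/SN.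
by case/andP: (f01 x).
Qed.

(** A test function f for U with support S is a test function for every open set containing S, so
    [Lam f] is at most the outer measure of the compact S. *)
Lemma riesz_inner U : open U ->
  riesz_outer U = ereal_sup [set riesz_outer K | K in [set K | compact K /\ K `<=` U]].
Proof.
move=> oU; apply/eqP; rewrite eq_le; apply/andP; split; last first.
  by apply: ge_ereal_sup => _ [K [_ KU] <-]; exact: le_riesz_outer.
rewrite riesz_outer_open//; apply: ge_ereal_sup => _ [f [[cf [S cS [SU S0]]] f01] <-].
apply: (@le_trans _ _ (riesz_outer S)); last by apply: ereal_sup_ubound; exists S.
apply: le_ereal_inf_tmp => _ [V [oV SV] <-]; apply: riesz_open_ge; split => //.
by split => //; exists S.
Qed.

Lemma riesz_bound_ge f c C : Cc f -> (0 <= c)%R -> (forall x, 0 <= f x <= c)%R ->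
  compact C -> (forall x, ~ C x -> f x = 0%R) -> (Lam f)%:E <= c%:E * riesz_outer C.
Proof.
move=> fC; rewrite le_eqVlt => /predU1P[<-|c0] fc cC C0.
  have -> : f = (fun=> 0%R) by apply/funext => x; apply/eqP; rewrite eq_le andbC.
  by rewrite riesz0 mul0e.
have -> : Lam f = (c * Lam (fun x => c^-1 * f x))%R.
  by rewrite LamZ// mulrA divff ?mul1r// gt_eqF.
rewrite EFinM lee_pmul2l//.
apply: le_ereal_inf_tmp => _ [V [oV CV] <-]; apply: riesz_open_ge; split.
  split; first by case: (CcZ c^-1 fC).
  by exists C => //; split => // x /C0 ->; rewrite mulr0.
move=> x; have /andP[f0 fxc] := fc x.
by rewrite mulr_ge0 ?invr_ge0 ?(ltW c0)//= ler_pdivrMl// mulr1.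
Qed.

(** For 0 < e < 1 the set where f exceeds c(1 - e) is an open neighbourhood of D, and every test
    function g for it satisfies g <= f / (c(1 - e)). The bound follows by letting e tend to 0. *)
Lemma riesz_bound_le f c D : Cc f -> (0 <= c)%R -> (forall x, 0 <= f x)%R ->
  compact D -> (forall x, D x -> f x = c) -> c%:E * riesz_outer D <= (Lam f)%:E.
Proof.
move=> fC; rewrite le_eqVlt => /predU1P[<-|c0] f0 cD D1.
  by rewrite mul0e lee_fin Lam_ge0.
have fD : riesz_outer D \is a fin_num.
  by rewrite ge0_fin_numE ?riesz_outer_ge0// riesz_outer_compact_lty.
rewrite -(fineK fD) -EFinM lee_fin; set a := fine _.
have a0 : (0 <= a)%R by rewrite fine_ge0// riesz_outer_ge0.
suff h (e : R) : (0 < e < 1)%R -> (c * (1 - e) * a <= Lam f)%R.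
  apply/ler_addgt0Pr => e e0.
  (* With d this minimum, c a d <= e and d < 1; the summand 1 in the denominator keeps the quotient
     defined when a = 0. *)
  have d0 : (0 < Num.min (1 / 2) (e / (c * a + 1)))%R.
    by rewrite lt_min !divr_gt0// ltr_wpDl// mulr_ge0// ltW.
  have d1 : (Num.min (1 / 2) (e / (c * a + 1)) < 1)%R.
    by rewrite gt_min ltr_pdivrMr// mul1r ltr1n.
  rewrite -lerBlDr; apply: le_trans (h _ (introT andP (conj d0 d1))).
  rewrite mulrBr mulr1 mulrBl lerB// mulrAC.
  apply: (@le_trans _ _ (c * a * (e / (c * a + 1)))%R).
    by rewrite ler_wpM2l ?mulr_ge0 ?(ltW c0)// ge_min lexx orbT.
  rewrite mulrA ler_pdivrMr ?ltr_wpDl ?mulr_ge0 ?(ltW c0)//.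
  by rewrite mulrC ler_pM2l// lerDl.
move=> /andP[e0 e1]; have c1 : (0 < c * (1 - e))%R by rewrite mulr_gt0// subr_gt0.
have oV : open [set x | c * (1 - e) < f x]%R.
  rewrite (_ : [set x | _] = f @^-1` [set y | c * (1 - e) < y]%R)//.
  by apply: open_comp; [move=> x _; case: fC => + _; exact|exact: open_gt].
have : riesz_outer D <= ((c * (1 - e))^-1 * Lam f)%:E.
  apply: (le_trans (riesz_outer_le oV _)) => [x /D1 /= ->|].
    by rewrite gtr_pMr// ltrBlDr ltrDl.
  apply: ge_ereal_sup => _ [g [gV g01] <-]; rewrite lee_fin -LamZ//.
  apply: riesz_le; [exact: CcOn_Cc gV|exact: CcZ|move=> x].
  have [fx|fx] := ltP (c * (1 - e))%R (f x).
    apply: (@le_trans _ _ 1%R); first by case/andP: (g01 x).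
    by rewrite ler_pdivlMl// mulr1 ltW.
  have [_ [S _ [SV S0]]] := gV; rewrite S0 ?mulr_ge0// ?invr_ge0 ?(ltW c1)//.
  by move/SV => /=; rewrite ltNge fx.
by rewrite -(fineK fD) lee_fin ler_pdivlMl.
Qed.

End RieszOuter.

(** * Integration of compactly supported functions against a Radon measure *)

Section RadonIntegral.
Context {R : realType} {Z : topologicalType}.
Variable m : radon_measure R Z.
Implicit Types f g : Z -> R.

Local Notation T := (borel (radon_point m)).

Lemma open_borel (z : Z) (U : set Z) : open U -> measurable (U : set (borel z)).
Proof. by move=> oU; exact: sub_sigma_algebra. Qed.

Lemma closed_borel (z : Z) (U : set Z) : closed U -> measurable (U : set (borel z)).
Proof.
by move=> cU; rewrite -[U]setCK; apply: measurableC; apply: open_borel; exact: closed_openC.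
Qed.

Lemma continuous_borel (z : Z) f : continuous f -> measurable_fun setT (f : borel z -> R).
Proof.
move=> cf; apply: (measurability _ (measurable_realfun.RGenOpens.measurableE R)) => _ [_ [a [b ->] <-]].
rewrite setTI; apply: open_borel.
by apply: open_comp; [move=> ? _; exact: cf|exact: interval_open].
Qed.

Lemma Cc_integrable f : Cc f -> (radon_mu m).-integrable setT (EFin \o (f : T -> R)).
Proof.
move=> fC; have [K [cK clK K0]] := Cc_support fC.
have [M M0 fM] := Cc_bounded fC.
have mK : measurable (K : set T) by exact: closed_borel.
have -> : EFin \o f = ((EFin \o f) \_ K)%E.
  apply/funext => x; rewrite patchE; case: ifPn => //.
  by rewrite notin_setE => /K0 /= ->.
apply: (integrable_mkcond _ mK).1.
apply: measurable_bounded_integrable => //.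
- exact: radon_compact.
- by apply: measurable_funTS; apply: continuous_borel; case: fC.
- exists M; split; [by rewrite num_real|move=> x Mx y _ /=].
  by rewrite (le_trans (fM y))// ltW.
Qed.

Lemma radon_integralD f g : Cc f -> Cc g ->
  radon_integral m (fun x => f x + g x) = radon_integral m f + radon_integral m g.
Proof. by move=> fC gC; rewrite /radon_integral RintegralD//; exact: Cc_integrable. Qed.

Lemma radon_integralZ c f : Cc f ->
  radon_integral m (fun x => c * f x) = c * radon_integral m f.
Proof. by move=> fC; rewrite /radon_integral RintegralZl//; exact: Cc_integrable. Qed.

Lemma radon_integral_ge0 f : (forall x, 0 <= f x) -> 0 <= radon_integral m f.
Proof. by move=> f0; apply: Rintegral_ge0. Qed.

Lemma radon_integral0 : radon_integral m (fun=> 0) = 0.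
Proof. by rewrite /radon_integral Rintegral_cst// mul0r. Qed.

(** Together with [radon_integral_bound_le] this gives for the integral the two bounds already known
    for the functional; they are the input of [Cc_slices]. *)
Lemma radon_integral_bound_ge f c (C : set Z) : Cc f -> (forall x, 0 <= f x <= c) ->
  compact C -> closed C -> (forall x, ~ C x -> f x = 0) ->
  radon_integral m f <= c * fine (radon_mu m C).
Proof.
move=> fC fc cC clC C0; have mC : measurable (C : set T) by exact: closed_borel.
rewrite /radon_integral (_ : f = f \_ C); last first.
  apply/funext => x; rewrite patchE; case: ifPn => //.
  by rewrite notin_setE => /C0.
rewrite -Rintegral_mkcond -Rintegral_cst//; apply: le_Rintegral => //.
- exact: integrableS (Cc_integrable fC).
- apply: measurable_bounded_integrable => //; first exact: radon_compact.
  exists `|c|; split; [by rewrite num_real|move=> x Mx y _ /=].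
  by rewrite ltW.
- by move=> x _; case/andP: (fc x).
Qed.

Lemma radon_integral_bound_le f c (D : set Z) : Cc f -> (forall x, 0 <= f x) ->
  measurable (D : set T) -> (radon_mu m D < +oo)%E -> (forall x, D x -> c <= f x) ->
  c * fine (radon_mu m D) <= radon_integral m f.
Proof.
move=> fC f0 mD Doo D1.
rewrite -Rintegral_cst//; apply: (@le_trans _ _ (\int[radon_mu m]_(x in D) f x)).
  apply: le_Rintegral => //.
  - apply: measurable_bounded_integrable => //.
    exists `|c|; split; [by rewrite num_real|move=> x Mx y _ /=].
    by rewrite ltW.
  - exact: integrableS (Cc_integrable fC).
rewrite Rintegral_mkcond; apply: le_Rintegral => //.
- rewrite (_ : EFin \o _ = ((EFin \o f) \_ D)%E); last first.
    by apply/funext => x; rewrite /= !patchE; case: ifPn.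
  by apply: (integrable_mkcond _ mD).1 => //; exact: integrableS (Cc_integrable fC).
- exact: Cc_integrable.
- by move=> x _; rewrite patchE; case: ifPn.
Qed.

End RadonIntegral.

(* [f] is the sum of the slices [min f (d (i+1)) - min f (d i)], each of which takes values in
   [0, d], vanishes where [f <= d i] and equals [d] where [f >= d (i+1)]. *)
Lemma Cc_slices (R : realType) (X : topologicalType) (v : set X -> R) (T : (X -> R) -> R)
    (f : X -> R) (d : R) n (S : set X) :
  (forall f g, Cc f -> Cc g -> T (fun x => f x + g x) = T f + T g) ->
  (forall f c C D, Cc f -> 0 <= c -> (forall x, 0 <= f x <= c) -> compact C -> compact D ->
    (forall x, ~ C x -> f x = 0) -> (forall x, D x -> f x = c) ->
    c * v D <= T f <= c * v C) ->
  0 < d -> Cc f -> (forall x, 0 <= f x) -> (forall x, f x <= d * n%:R) ->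
  compact S -> (forall x, ~ S x -> f x = 0) ->
  \sum_(0 <= i < n) d * v (S `&` [set x | d * i.+1%:R <= f x]) <= T f <=
  \sum_(0 <= i < n) d * v (S `&` [set x | d * i%:R <= f x]).
Proof.
move=> TD Tb d0 fC f0 fn cS S0.
pose K i := S `&` [set x | d * i%:R <= f x].
have cf : continuous f by case: fC.
have cK i : compact (K i).
  apply: compact_closedI => //; rewrite (_ : [set x | _] = f @^-1` [set y | d * i%:R <= y])//.
  by apply: closed_comp => [x _|]; [exact: cf|exact: closed_ge].
have di i : 0 <= d * i%:R by rewrite mulr_ge0 ?ler0n// ltW.
pose h i x := Num.min (f x) (d * i%:R).
pose g i x := h i.+1 x - h i x.
have gC i : Cc (g i).
  apply: (Cc_dom fC) => [x|x fx].
    by apply: continuousB; apply: continuous_min; first [exact: cf|exact: cst_continuous].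
  by rewrite /g /h fx !min_l ?subrr.
have hf : f = fun x => \sum_(i < n) g i x.
  apply/funext => x; rewrite -(big_mkord xpredT (fun i => g i x)) /g.
  rewrite (telescope_sumr (fun i => h i x))// /h mulr0 (min_l (fn x)) min_r ?subr0//.
have gb i x : 0 <= g i x <= d.
  rewrite /g /h subr_ge0 lerBlDr -natr1 mulrDr mulr1.
  by rewrite /Num.min; case: ltP => ?; case: ltP => ?; apply/andP; split; lra.
have K0 i x : ~ K i x -> g i x = 0.
  move=> nK; have [Sx|/S0 fx] := pselect (S x); last first.
    by rewrite /g /h fx !min_l ?subrr.
  have fxi : f x < d * i%:R by rewrite ltNge; apply/negP => ?; apply: nK.
  rewrite /g /h !min_l ?subrr// ?(ltW fxi)// (le_trans (ltW fxi))//.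
  by rewrite ler_pM2l// ler_nat.
have K1 i x : K i.+1 x -> g i x = d.
  move=> [Sx /= fx]; rewrite /g /h !min_r//; first by rewrite -mulrBr -natrB// subSnn mulr1.
  by rewrite (le_trans _ fx)// ler_pM2l// ler_nat.
have -> : T f = \sum_(0 <= i < n) T (g i).
  by rewrite [in LHS]hf Cc_additive_sum// big_mkord.
apply/andP; split; apply: ler_sum => i _;
  by have /andP[] := Tb (g i) d (K i) (K i.+1) (gC i) (ltW d0) (gb i) (cK i) (cK _) (K0 i) (K1 i).
Qed.

(** * The Radon measure representing a positive functional *)

Section RieszMeasure.
Context {R : realType} {X : topologicalType}.
Hypothesis hX : hausdorff_space X.
Hypothesis lX : lh_locally_compact X.
Variable Lam : (X -> R) -> R.
Hypothesis LamD : forall f g, Cc f -> Cc g -> Lam (fun x => f x + g x) = Lam f + Lam g.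
Hypothesis LamZ : forall c f, Cc f -> Lam (fun x => c * f x) = c * Lam f.
Hypothesis Lam_ge0 : forall f, Cc f -> (forall x, 0 <= f x) -> 0 <= Lam f.
Variable x0 : X.

(** The same set function appears twice: here it carries the outer measure structure, and as
    [riesz_mu] on the Borel type it becomes a measure. *)
Definition riesz_pointed (A : set (pointed_at x0)) : \bar R := riesz_outer Lam A.

HB.instance Definition _ := isOuterMeasure.Build R (pointed_at x0) riesz_pointed
  (riesz_outer0 LamZ) (riesz_outer_ge0 LamZ) (@le_riesz_outer R X Lam)
  (riesz_outer_sigma_subadditive hX lX LamD LamZ).

Definition riesz_mu (A : set (borel x0)) : \bar R := riesz_outer Lam A.

Let borel_caratheodory (A : set (borel x0)) : measurable A ->
  riesz_pointed.-cara.-measurable A.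
Proof.
apply: smallest_sub; first exact: sigma_algebra_measurable.
by move=> U oU; apply: riesz_caratheodory.
Qed.

Let riesz_mu_sigma : semi_sigma_additive riesz_mu.
Proof.
move=> A mA tA mU.
apply: (@caratheodory_measure_sigma_additive _ _ riesz_pointed) => //.
  by move=> i; exact: borel_caratheodory.
exact: borel_caratheodory.
Qed.

HB.instance Definition _ := isMeasure.Build _ (borel x0) R riesz_mu
  (riesz_outer0 LamZ) (riesz_outer_ge0 LamZ) riesz_mu_sigma.

Let riesz_radon_outer (A : set X) : measurable (A : set (borel x0)) ->
  riesz_mu A = ereal_inf [set riesz_mu U | U in [set U | open U /\ A `<=` U]].
Proof.
move=> _; rewrite /riesz_mu {1}/riesz_outer; congr ereal_inf.
by apply: eq_imagel => U [oU _]; rewrite riesz_outer_open.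
Qed.

Let riesz_radon_inner (U : set X) : open U ->
  riesz_mu U = ereal_sup [set riesz_mu K | K in [set K | compact K /\ K `<=` U]].
Proof. by move=> oU; apply: riesz_inner. Qed.

Let riesz_radon_compact (K : set X) : compact K -> (riesz_mu K < +oo)%E.
Proof. by move=> cK; apply: riesz_outer_compact_lty. Qed.

Definition riesz_radon : radon_measure R X :=
  @RadonMeasure R X x0 riesz_mu riesz_radon_compact riesz_radon_outer riesz_radon_inner.

Let mu := radon_mu riesz_radon.

(** Integral and functional lie between the same lower and upper sums of step M / (n+1), whose
    difference is at most M mu(S) / (n+1). *)
Lemma riesz_radonE_ge0 f : Cc f -> (forall x, 0 <= f x) ->
  radon_integral riesz_radon f = Lam f.
Proof.
move=> fC f0; have [M [M0 fM]] : exists M, 0 < M /\ forall x, `|f x| <= M.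
  have [M M0 fM] := Cc_bounded fC; exists (M + 1); split; first by rewrite ltr_wpDl.
  by move=> x; rewrite (le_trans (fM x))// lerDl.
have [S [cS clS S0]] := Cc_support fC.
have fK (K : set X) : compact K -> mu K \is a fin_num.
  by move=> cK; rewrite ge0_fin_numE// radon_compact.
have b1 f' c C D : Cc f' -> 0 <= c -> (forall x, 0 <= f' x <= c) ->
    compact C -> compact D -> (forall x, ~ C x -> f' x = 0) -> (forall x, D x -> f' x = c) ->
    c * fine (mu D) <= radon_integral riesz_radon f' <= c * fine (mu C).
  move=> f'C c0 f'c cC cD C0 D1.
  rewrite radon_integral_bound_ge//; last exact: compact_closed.
  rewrite radon_integral_bound_le//.
  - by move=> x; case/andP: (f'c x).
  - by apply: closed_borel; exact: compact_closed.
  - exact: radon_compact.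
  - by move=> x /D1 ->.
have b2 f' c C D : Cc f' -> 0 <= c -> (forall x, 0 <= f' x <= c) ->
    compact C -> compact D -> (forall x, ~ C x -> f' x = 0) -> (forall x, D x -> f' x = c) ->
    c * fine (mu D) <= Lam f' <= c * fine (mu C).
  move=> f'C c0 f'c cC cD C0 D1; rewrite -!lee_fin !EFinM !fineK ?fK//.
  apply/andP; split.
    by apply: riesz_bound_le => // x; case/andP: (f'c x).
  exact: riesz_bound_ge.
have b3 n : `|radon_integral riesz_radon f - Lam f| <= M * fine (mu S) / n.+1%:R.
  have d0 : 0 < M / n.+1%:R by rewrite divr_gt0.
  have fn x : f x <= M / n.+1%:R * n.+1%:R.
    by rewrite divfK// (le_trans (ler_norm _)).
  have /andP[i1 i2] := @Cc_slices _ _ (fun K => fine (mu K)) _ _ _ n.+1 _ (radon_integralD riesz_radon) b1 d0 fC f0 fn cS S0.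
  have /andP[l1 l2] := @Cc_slices _ _ (fun K => fine (mu K)) _ _ _ n.+1 _ LamD b2 d0 fC f0 fn cS S0.
  set d := M / _ in i1 i2 l1 l2.
  pose a i := d * fine (mu (S `&` [set x | d * i%:R <= f x])).
  (* The upper sum is the lower sum shifted by one index, so the difference telescopes to a 0 - a
     (n+1). *)
  have : \sum_(0 <= i < n.+1) a i - \sum_(0 <= i < n.+1) a i.+1 <= a 0.
    rewrite -sumrB (eq_bigr (fun i => - (a i.+1 - a i))) => [|i _]; last by rewrite opprB.
    rewrite sumrN telescope_sumr// opprB gerBl mulr_ge0 ?(ltW d0)// fine_ge0//.
  have -> : a 0 = M * fine (mu S) / n.+1%:R.
    rewrite /a mulr0 mulrAC (_ : S `&` _ = S)//; apply/setIidPl => x _; exact: f0.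
  have near_eq (p q s1 s2 b : R) : s2 <= p -> p <= s1 -> s2 <= q -> q <= s1 ->
    s1 - s2 <= b -> `|p - q| <= b by move=> *; rewrite ler_norml; lra.
  exact: near_eq i1 i2 l1 l2.
apply/eqP; rewrite -subr_eq0 -normr_le0; apply/ler_addgt0Pr => e e0; rewrite add0r.
set c := M * fine (mu S) in b3.
have c0 : 0 <= c / e by rewrite divr_ge0 ?(ltW e0)// mulr_ge0 ?(ltW M0)// fine_ge0.
apply: le_trans (b3 (Num.bound (c / e))) _.
rewrite ler_pdivrMr// mulrC -ler_pdivrMr// (le_trans (ltW (archi_boundP c0)))// ler_nat.
exact: leqnSn.
Qed.

Lemma riesz_radonE f : Cc f -> radon_integral riesz_radon f = Lam f.
Proof.
move=> fC; have cf : continuous f by case: fC.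
pose fp x := Num.max (f x) 0; pose fn x := Num.max (- f x) 0.
have fpC : Cc fp.
  apply: (Cc_dom fC) => [x|x fx]; last by rewrite /fp fx maxxx.
  by apply: continuous_max; [exact: cf|exact: cst_continuous].
have fnC : Cc fn.
  apply: (Cc_dom fC) => [x|x fx]; last by rewrite /fn fx oppr0 maxxx.
  apply: (@continuous_max _ _ (fun x => - f x) (fun=> 0)); last exact: cst_continuous.
  by apply: continuousN; exact: cf.
have -> : f = fun x => fp x + -1 * fn x.
  apply/funext => x; rewrite /fp /fn /Num.max.
  by case: ltP => ?; case: ltP => ?; lra.
rewrite LamD ?radon_integralD ?LamZ ?radon_integralZ//; try exact: CcZ.
by rewrite !riesz_radonE_ge0// => x; rewrite le_max lexx orbT.
Qed.

End RieszMeasure.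

(** * Full support and strict positivity of the integral *)

Section RadonSupport.
Context {R : realType} {Z : topologicalType}.
Variable m : radon_measure R Z.

(** The set U where f exceeds f z / 2 is an open neighbourhood of z: its measure is positive by full
    support and finite because U lies in the compact support of f. *)
Lemma radon_integral_gt0 (f : Z -> R) z : radon_support m = setT -> Cc f ->
  (forall x, 0 <= f x) -> 0 < f z -> 0 < radon_integral m f.
Proof.
move=> sm fC f0 fz; have cf : continuous f by case: fC.
pose U := f @^-1` [set y | f z / 2 < y].
have oU : open U.
  by apply: open_comp; [move=> x _; exact: cf|exact: open_gt].
have Uz : U z by rewrite /U /= ltr_pdivrMr// ltr_pMr// ltr1n.
have mU : measurable (U : set (borel (radon_point m))) by exact: open_borel.
have U0 : (0 < radon_mu m U)%E.
  by have : radon_support m z by [rewrite sm]; exact.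
have [K [cK clK K0]] := Cc_support fC.
have Uoo : (radon_mu m U < +oo)%E.
  apply: le_lt_trans (radon_compact m cK); apply: le_measure.
  - by rewrite inE.
  - by rewrite inE; exact: closed_borel.
  - move=> x Ux; apply: contrapT => /K0 fx; move: Ux; rewrite /U /= fx.
    by rewrite ltNge divr_ge0.
apply: (@lt_le_trans _ _ (f z / 2 * fine (radon_mu m U))).
  by rewrite mulr_gt0 ?divr_gt0// fine_gt0// U0.
by apply: radon_integral_bound_le => // x Ux; exact: ltW.
Qed.

(** Full support can be tested on functions: for a bump f at z with values in [0, 1] and compact
    support C in U, the integral of f is positive and at most m(C) <= m(U). *)
Lemma radon_supportT : hausdorff_space Z -> lh_locally_compact Z ->
  (forall f z, Cc f -> (forall x, 0 <= f x) -> 0 < f z -> 0 < radon_integral m f) ->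
  radon_support m = setT.
Proof.
move=> hZ lZ h; apply/seteqP; split => // z _ U oU Uz.
have [|f [cf f01 [N oN [KN N1]] [C cC [CU C0]]]] := @lch_urysohn R Z hZ lZ [set z] U (@compact_set1 _ z) oU.
  by move=> _ ->.
have fC : Cc f by apply: (CcOn_Cc (U := setT)) => //; split => //; exists C.
have f0 x : 0 <= f x by case/andP: (f01 x).
have clC := compact_closed hZ cC.
have h0 : 0 < radon_integral m f by apply: (h f z) => //; rewrite N1//; exact: KN.
have h1 := radon_integral_bound_ge m fC f01 cC clC C0.
rewrite mul1r in h1; have {}h1 := lt_le_trans h0 h1.
apply: (@lt_le_trans _ _ (radon_mu m C)).
  rewrite lt_neqAle measure_ge0 andbT; apply/eqP => e.
  by move: h1; rewrite -e ltxx.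
by apply: le_measure => //; rewrite inE; [exact: closed_borel|exact: open_borel].
Qed.

End RadonSupport.

(** * Quasi-continuous functions *)

Lemma radon_integral_le (R : realType) (Z : topologicalType) (m : radon_measure R Z)
  (f g : Z -> R) : Cc f -> Cc g -> (forall x, f x <= g x) ->
  radon_integral m f <= radon_integral m g.
Proof. by move=> fC gC fg; apply: le_Rintegral => //; exact: Cc_integrable. Qed.

Lemma radon_integral_norm_le (R : realType) (Z : topologicalType) (m : radon_measure R Z)
  (f g : Z -> R) : Cc f -> Cc g -> (forall x, `|f x| <= g x) ->
  `|radon_integral m f| <= radon_integral m g.
Proof.
move=> fC gC fg; rewrite ler_norml -mulN1r -radon_integralZ//.
apply/andP; split; apply: radon_integral_le => //; first exact: CcZ.
  by move=> x; have := fg x; rewrite ler_norml mulN1r => /andP[].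
by move=> x; have := fg x; rewrite ler_norml => /andP[].
Qed.

Lemma valL_val (X : Type) (V : Type) (v : V) (A : set X) (f : set_type A -> V) z :
  valL_ v f (\val z) = f z.
Proof. exact: (congr1 (@^~ z) (valLK v f)). Qed.

Lemma valL_out (X : Type) (V : Type) (v : V) (A : set X) (f : set_type A -> V) x :
  ~ A x -> valL_ v f x = v.
Proof. by move=> nAx; rewrite /valL_ /= oinv_set_val/= insubN// notin_setE. Qed.

Lemma fun_sum_ind (R : realType) (X I : Type) (P : (X -> R) -> Prop) (s : seq I)
    (h : I -> X -> R) :
  P (fun=> 0) -> (forall f g, P f -> P g -> P (fun x => f x + g x)) ->
  (forall i, P (h i)) -> P (fun x => \sum_(i <- s) h i x).
Proof.
move=> P0 PD hP; elim: s => [|i s IH]; first by under eq_fun do rewrite big_nil.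
by under eq_fun do rewrite big_cons; exact: PD.
Qed.

Lemma near0_continuous (R : realType) (X : topologicalType) (f : X -> R) x :
  (\forall y \near x, f y = 0) -> {for x, continuous f}.
Proof.
move=> f0 W; rewrite (nbhs_singleton f0) => W0.
by apply: filterS f0 => y /= ->; exact: nbhs_singleton.
Qed.

(** The extension by 0 of a compactly supported continuous function on U, as a function on X.
    Continuity is asked only at points of U, since it may fail at boundary points of U when S is not
    closed in X. *)
Definition elementary (R : realType) (X : topologicalType) (U : set X) (f : X -> R) :=
  (forall x, U x -> {for x, continuous f}) /\
  exists2 S, compact S & S `<=` U /\ forall x, ~ S x -> f x = 0.

Lemma CcOn_elementary (R : realType) (X : topologicalType) (U : set X)
  (f : X -> R) : CcOn U f -> elementary U f.
Proof. by move=> [cf [S cS [SU S0]]]; split; [move=> x _; exact: cf|exists S]. Qed.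

Section Elementary.
Context {R : realType} {X : topologicalType}.
Implicit Types (f g : X -> R) (U V A D : set X).

Lemma elementary_val U f : open U -> hausdorff_on U -> elementary U f ->
  CcOn setT (fun z : set_type U => f (\val z)).
Proof.
move=> oU hU [cf [S cS [SU S0]]]; split.
  move=> z; apply: (@continuous_comp _ _ _ (\val : set_type U -> X) f).
    exact: val_continuous.
  by apply: cf; exact: set_valP.
exists (\val @^-1` S); first exact: compact_preval.
by split=> // z Sz; apply: S0.
Qed.

Lemma elementary_valL A (V : set (set_type A)) (g : set_type A -> R) :
  open A -> elementary V g -> elementary (\val @` V) (valL_ 0 g).
Proof.
move=> oA [cg [S cS [SV S0]]]; split; last first.
  exists (\val @` S); first exact/compact_val.
  split; first exact: image_subset.
  move=> x nS; have [Ax|nA] := pselect (A x); last by rewrite valL_out.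
  rewrite -[x]/(\val (subp Ax)) valL_val S0// => Sx; apply: nS.
  by exists (subp Ax).
move=> _ [z Vz <-] W; rewrite valL_val => Wz.
have [N oN [Nz NW]] := nbhs_valP (cg z Vz W Wz).
suff : nbhs (\val z) (N `&` A).
  apply: filterS => x [Nx Ax]; suff : W (valL_ 0 g (\val (subp Ax))) by [].
  by rewrite valL_val; exact: (NW (subp Ax)).
by apply: open_nbhs_nbhs; split; [exact: openI|split => //; exact: set_valP].
Qed.

Lemma elementaryT U (g : set_type U -> R) : open U -> Cc g -> elementary U (valL_ 0 g).
Proof.
move=> oU gC; have UE : \val @` (setT : set (set_type U)) = U.
  by apply/seteqP; split => [_ [z _ <-]|x Ux]; [exact: set_valP|exists (subp Ux)].
by have := elementary_valL oU (CcOn_elementary (Cc_CcOn gC)); rewrite UE.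
Qed.

Lemma elementaryZ U f c : elementary U f -> elementary U (fun x => c * f x).
Proof.
move=> [cf [S cS [SU S0]]]; split.
  by move=> x Ux; apply: continuousM; [exact: cst_continuous|exact: cf].
by exists S => //; split => // x /S0 ->; rewrite mulr0.
Qed.

Lemma quasi_continuousP f : quasi_continuous f <->
  exists n (h : 'I_n -> X -> R) (U : 'I_n -> set X),
    [/\ forall i, open (U i), forall i, hausdorff_on (U i), forall i, elementary (U i) (h i) &
      forall x, f x = \sum_(i < n) h i x].
Proof.
split => [[n [c [U [g [oU hU gC fE]]]]]|[n [h [U [oU hU hC fE]]]]].
  exists n, (fun i x => c i * valL_ 0 (g i) x), U; split => //.
    by move=> i; exact/hausdorff_onP.
  by move=> i; apply/elementaryZ/elementaryT.
exists n, (fun=> 1), U, (fun i z => h i (\val z)); split => //.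
- by move=> i; exact/hausdorff_onP.
- move=> i; apply: (CcOn_Cc (U := setT)); first exact/hausdorff_onP.
  exact: elementary_val.
- move=> x; rewrite fE; apply: eq_bigr => i _; rewrite mul1r.
  have [Ux|nU] := pselect (U i x).
    by rewrite -[x in RHS]/(\val (subp Ux)) valL_val.
  rewrite valL_out//; have [_ [S _ [SU S0]]] := hC i.
  by apply: S0 => /SU.
Qed.

Lemma elementary_qc U f : open U -> hausdorff_on U -> elementary U f -> quasi_continuous f.
Proof.
move=> oU hU fU; apply/quasi_continuousP; exists 1%N, (fun=> f), (fun=> U).
by split => // x; rewrite big_ord1.
Qed.

Lemma quasi_continuousD f g : quasi_continuous f -> quasi_continuous g ->
  quasi_continuous (fun x => f x + g x).
Proof.
move=> /quasi_continuousP[n [h [U [oU hU hC fE]]]].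
move=> /quasi_continuousP[m [h' [U' [oU' hU' hC' gE]]]]; apply/quasi_continuousP.
exists (n + m)%N, (fun i => match fintype.split i with inl j => h j | inr j => h' j end),
  (fun i => match fintype.split i with inl j => U j | inr j => U' j end).
split; try by move=> i; case: (fintype.split i).
move=> x; rewrite fE gE big_split_ord/=; congr (_ + _); apply: eq_bigr => i _.
  by rewrite (unsplitK (inl _ i)).
by rewrite (unsplitK (inr _ i)).
Qed.

Lemma quasi_continuous0 : quasi_continuous (fun _ : X => 0 : R).
Proof.
apply: (@elementary_qc set0); [exact: open0|by []|split => //].
by exists set0; [exact: compact0|split].
Qed.

Lemma quasi_continuous_sum (I : Type) (s : seq I) (h : I -> X -> R) :
  (forall i, quasi_continuous (h i)) ->
  quasi_continuous (fun x => \sum_(i <- s) h i x).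
Proof.
by apply: fun_sum_ind; [exact: quasi_continuous0|exact: quasi_continuousD].
Qed.

(* A partition of unity on each Hausdorff chart reduces quasi-continuous functions to
   ones supported in members of a given cover by small open sets. *)
Lemma qc_ind (P : (X -> R) -> Prop) (good : set X -> Prop) : lh_locally_compact X ->
  (forall x, exists N : set X, [/\ open N, N x & good N]) ->
  (forall A B, A `<=` B -> good B -> good A) ->
  P (fun=> 0) -> (forall f g, P f -> P g -> P (fun x => f x + g x)) ->
  (forall U f, open U -> hausdorff_on U -> good U -> elementary U f -> P f) ->
  forall f, quasi_continuous f -> P f.
Proof.
move=> lX /choice[N hN] goodS P0 PD Pe.
move=> f /quasi_continuousP[n [h [U [oU hU hC fE]]]].
suff Ph i : P (h i) by rewrite (funext fE); exact: fun_sum_ind.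
move: (U i) (h i) (oU i) (hU i) (hC i) => {n h U oU hU hC fE i}{}U {}f oU hU fU.
have [cf [S cS [_ S0]]] := elementary_val oU hU fU.
have [n [V [VE SV]]] : exists n (V : nat -> set (set_type U)),
    (forall i, (i < n)%N -> exists2 z, S z & V i = \val @^-1` (N (\val z))) /\
    S `<=` \bigcup_(i in [set i | (i < n)%N]) V i.
  apply: (@compact_finite_cover (set_type U) S (fun z => \val @^-1` (N (\val z)))) => // z _.
  have [oN Nz _] := hN (\val z).
  by split => //; apply: open_comp => // ? _; exact: val_continuous.
have oV k : (k < n)%N -> open (V k).
  move=> /VE[z _ ->]; have [oN _ _] := hN (\val z).
  by apply: open_comp => // ? _; exact: val_continuous.
have fV : CcOn (\bigcup_(i in [set i | (i < n)%N]) V i) (fun z => f (\val z)).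
  by split => //; exists S.
have [g [gC gs _]] := CcOn_partition (iffRL (hausdorff_onP U) hU) (lhlc_open oU lX) oV fV.
have -> : f = fun x => \sum_(i < n) valL_ 0 (g i) x.
  apply/funext => x; have [Ux|nU] := pselect (U x).
    rewrite -[x]/(\val (subp Ux)) gs; apply: eq_bigr => k _.
    by rewrite valL_val.
  have [_ [S' _ [SU' S'0]]] := fU; rewrite S'0; last by move/SU'.
  by rewrite big1// => k _; rewrite valL_out.
apply: fun_sum_ind => // -[k kn] /=; apply: (Pe (\val @` V k)).
- by apply: open_val => //; exact: oV.
- apply: hausdorff_onS hU => _ [z _ <-]; exact: set_valP.
- have [z _ ->] := VE k kn; have [_ _ gN] := hN (\val z).
  by apply: goodS gN => _ [w Nw <-].
- by apply: elementary_valL => //; apply/CcOn_elementary/gC.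
Qed.

(** In the Hausdorff space D the trace of each compact support is closed. A point of D outside the
    chart therefore has a neighbourhood in D on which the summand vanishes, and the possible
    discontinuities disappear. *)
Lemma qc_restrict D f : closed D -> hausdorff_on D -> quasi_continuous f ->
  Cc (fun z : set_type D => f (\val z)).
Proof.
move=> clD hD /quasi_continuousP[n [h [U [oU hU hC fE]]]].
rewrite (funext fE); apply: (@fun_sum_ind _ _ _ _ _ (fun i z => h i (\val z))).
- exact: Cc0.
- by move=> ? ?; exact: CcD.
move=> i; move: (h i) (U i) (hC i) => f' U' [cf [S cS [SU S0]]].
have cSD : compact (\val @^-1` S : set (set_type D)).
  apply/compact_val.
  suff -> : \val @` (\val @^-1` S : set (set_type D)) = S `&` D by exact: compact_closedI.
  apply/seteqP; split => [_ [z Sz <-]|x [Sx Dx]]; last by exists (subp Dx).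
  by split => //; exact: set_valP.
have clSD := compact_closed (iffRL (hausdorff_onP D) hD) cSD.
apply: (Cc_closed _ cSD clSD) => [z|z]; last exact: S0.
have [Uz|nUz] := pselect (U' (\val z)).
  apply: (@continuous_comp _ _ _ (\val : set_type D -> X) f'); first exact: val_continuous.
  exact: cf.
apply: near0_continuous.
have : nbhs z (~` (\val @^-1` S)).
  by apply: open_nbhs_nbhs; split; [exact: closed_openC|move=> /SU].
by apply: filterS => y /S0.
Qed.

Lemma hausdorff_on_val A (V : set (set_type A)) : hausdorff_on V -> hausdorff_on (\val @` V).
Proof.
move=> hV _ _ [z Vz <-] [w Vw <-] zw.
have [|_ [_ [[P oP <-] [Q oQ <-] Pz Qw PQ]]] := hV z w Vz Vw; first by move=> e; apply: zw; rewrite e.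
by exists P, Q; split => // _ [v Vv <-]; exact: PQ.
Qed.

(** * Bumps and partitions of unity inside a Hausdorff chart *)

Section Bumps.
Hypothesis lX : lh_locally_compact X.
Variable W : set X.
Hypotheses (oW : open W) (hW : hausdorff_on W).

Let hW' : hausdorff_space (set_type W).
Proof. exact/hausdorff_onP. Qed.

Let lW' : lh_locally_compact (set_type W).
Proof. exact: lhlc_open. Qed.

Lemma bump (C : set X) : compact C -> C `<=` W ->
  exists eta : X -> R, [/\ elementary W eta, forall x, 0 <= eta x <= 1 &
    exists N : set X, [/\ open N, C `<=` N, N `<=` W & forall x, N x -> eta x = 1]].
Proof.
move=> cC CW.
have [//|eta [ceta eta01 [N oN [CN N1]] [K cK [_ K0]]]] :=
  @lch_urysohn R _ hW' lW' (\val @^-1` C) setT (compact_preval CW cC) openT.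
exists (valL_ 0 eta); split.
- by apply: elementaryT => //; apply: (CcOn_Cc (U := setT)) => //; split => //; exists K.
- move=> x; have [Wx|nW] := pselect (W x).
    by rewrite -[x]/(\val (subp Wx)) valL_val.
  by rewrite valL_out// lexx ler01.
- exists (\val @` N); split.
  + exact: open_val.
  + by move=> x Cx; exists (subp (CW _ Cx)) => //; exact: CN.
  + by move=> _ [z _ <-]; exact: set_valP.
  + by move=> _ [z Nz <-]; rewrite valL_val N1.
Qed.

(** A bump chi equal to 1 on C and supported in the union of the U i is decomposed; hence the sum is
    1 on C and only at most 1 elsewhere. *)
Lemma bump_partition (C : set X) n (U : nat -> set X) : compact C -> C `<=` W ->
  (forall i, (i < n)%N -> open (U i)) -> C `<=` \bigcup_(i in [set i | (i < n)%N]) U i ->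
  exists g : 'I_n -> X -> R, [/\ forall i, elementary W (g i), forall (i : 'I_n) x, 0 <= g i x,
    forall (i : 'I_n) x, ~ U i x -> g i x = 0, forall x, \sum_(i < n) g i x <= 1 &
    forall x, C x -> \sum_(i < n) g i x = 1].
Proof.
move=> cC CW oU CU.
have oV i : (i < n)%N -> open (\val @^-1` (U i) : set (set_type W)).
  by move=> /oU ?; apply: open_comp => // ? _; exact: val_continuous.
have [||chi [cchi chi01 [N oN [CN N1]] [K cK [KU K0]]]] := @lch_urysohn R _ hW' lW'
    (\val @^-1` C) (\bigcup_(i in [set i | (i < n)%N]) \val @^-1` (U i)) (compact_preval CW cC).
- by apply: bigcup_open => i /oV.
- by move=> z /CU.
have chiU : CcOn (\bigcup_(i in [set i | (i < n)%N]) (\val @^-1` (U i) : set (set_type W))) chi.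
  by split => //; exists K.
have [g [gC gs g0]] := CcOn_partition hW' lW' oV chiU.
have chi0 z : 0 <= chi z by case/andP: (chi01 z).
have sumE z : \sum_(i < n) valL_ 0 (g i) (\val z) = chi z.
  by rewrite gs; apply: eq_bigr => i _; rewrite valL_val.
exists (fun i => valL_ 0 (g i)); split.
- by move=> i; apply: elementaryT => //; apply: CcOn_Cc (gC i (ltn_ord i)).
- move=> i x; have [Wx|nW] := pselect (W x); last by rewrite valL_out.
  by rewrite -[x]/(\val (subp Wx)) valL_val g0.
- move=> i x nU; have [Wx|nW] := pselect (W x); last by rewrite valL_out.
  rewrite -[x]/(\val (subp Wx)) valL_val.
  by have [_ [S _ [SU S0]]] := gC i (ltn_ord i); apply: S0 => /SU.
- move=> x; have [Wx|nW] := pselect (W x).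
    by rewrite -[x]/(\val (subp Wx)) sumE; case/andP: (chi01 (subp Wx)).
  by rewrite big1// => i _; rewrite valL_out.
- move=> x Cx; rewrite -[x]/(\val (subp (CW _ Cx))) sumE N1//; exact: CN.
Qed.

End Bumps.

(** Inside the chart U, Tietze extends g from the compact trace of D on C, and the product with a
    cut-off chi, equal to 1 near the support S and 0 off C, is extended by 0. On D the product is g:
    chi is 1 on S, g vanishes on the rest of C, and chi vanishes off C. *)
Lemma elementary_extend D U (g : set_type D -> R) : lh_locally_compact X ->
  closed D -> open U -> hausdorff_on U -> CcOn (\val @^-1` U : set (set_type D)) g ->
  exists2 F : X -> R, elementary U F & forall z, F (\val z) = g z.
Proof.
move=> lX clD oU hU [cg [S cS [SU S0]]].
have hU' : hausdorff_space (set_type U) by exact/hausdorff_onP.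
have lU' := lhlc_open oU lX.
have cS1 : compact (\val @` S) by exact/compact_val.
have S1U : \val @` S `<=` U by move=> _ [z /SU ? <-].
have [//|chi [cchi chi01 [N oN [SN N1]] [C cC [_ C0]]]] :=
  @lch_urysohn R _ hU' lU' (\val @^-1` (\val @` S)) setT (compact_preval S1U cS1) openT.
have cQ : compact (C `&` \val @^-1` D).
  by apply: compact_closedI => //; apply: closed_comp => // ? _; exact: val_continuous.
pose h (y : set_type U) := valL_ 0 g (\val y).
have ch : {within C `&` \val @^-1` D, continuous h}.
  apply/subspace_continuousP => y [_ Dy0] W.
  have Dy : D (\val y) := Dy0.
  have hy : h y = g (subp Dy) by exact: (valL_val 0 g (subp Dy)).
  move=> Wy; have /cg/nbhs_valP[ O' oO [/= Oy OW]] : nbhs (g (subp Dy)) W.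
    by rewrite -hy.
  have : nbhs y (\val @^-1` O') by apply: nbhs_val; exact: open_nbhs_nbhs.
  apply: filterS => y' Oy' [_ Dy0']; have Dy' : D (\val y') := Dy0'.
  suff : W (valL_ 0 g (\val (subp Dy'))) by [].
  by rewrite valL_val; exact: (OW (subp Dy')).
have [k ck kh] := lch_tietze hU' lU' cQ ch.
exists (valL_ 0 (fun y => k y * chi y)).
  apply: elementaryT => //; apply: (CcOn_Cc (U := setT)) => //; split.
    by move=> y; apply: continuousM; [exact: ck|exact: cchi].
  by exists C => //; split => // y /C0 ->; rewrite mulr0.
move=> z; have [Uz|nU] := pselect (U (\val z)); last first.
  by rewrite valL_out// S0// => /SU.
rewrite -[\val z in LHS]/(\val (subp Uz)) valL_val.
have kE : C (subp Uz) -> k (subp Uz) = g z.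
  by move=> Cz; rewrite kh /h; [rewrite [LHS]valL_val|split => //; exact: (set_valP z)].
have [Sz|nS] := pselect (S z).
  have chi1 : chi (subp Uz) = 1 by apply: N1; apply: SN; exists z.
  rewrite chi1 mulr1; apply: kE; apply: contrapT => /C0; rewrite chi1 => /eqP.
  by rewrite oner_eq0.
have [Cz|/C0 ->] := pselect (C (subp Uz)); last by rewrite mulr0 S0.
by rewrite kE// S0// mul0r.
Qed.

(** Lets the invariance of a Haar system, stated for quasi-continuous functions on the arrow space,
    be used for functions given on one range fibre only: g is split into pieces supported in charts,
    and each piece is extended. *)
Lemma qc_extend D (g : set_type D -> R) : lh_locally_compact X -> locally_hausdorff X ->
  closed D -> hausdorff_on D -> Cc g ->
  exists2 F : X -> R, quasi_continuous F & forall z, F (\val z) = g z.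
Proof.
move=> lX /locally_hausdorffP/choice[N hN] clD hD gC.
have hD' : hausdorff_space (set_type D) by exact/hausdorff_onP.
have [cg [S cS [_ S0]]] := Cc_CcOn gC.
have [z _|n [V [VE SV]]] := @compact_finite_cover _ S (fun z => \val @^-1` (N (\val z))) cS.
  have [oN Nz _] := hN (\val z).
  by split => //; apply: open_comp => // ? _; exact: val_continuous.
have oV k : (k < n)%N -> open (V k).
  move=> /VE[z _ ->]; have [oN _ _] := hN (\val z).
  by apply: open_comp => // ? _; exact: val_continuous.
have gV : CcOn (\bigcup_(i in [set i | (i < n)%N]) V i) g by split => //; exists S.
have [h [hC hs _]] := CcOn_partition hD' (lhlc_closed clD lX) oV gV.
have /choice[F hF] : forall i : 'I_n, exists F : X -> R,
    quasi_continuous F /\ forall z, F (\val z) = h i z.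
  move=> i; have [z _ Vi] := VE i (ltn_ord i); have [oN _ hNz] := hN (\val z).
  have := hC i (ltn_ord i); rewrite Vi => hi.
  have [F FU FE] := elementary_extend lX clD oN hNz hi.
  by exists F; split => //; exact: elementary_qc FU.
exists (fun x => \sum_(i < n) F i x).
  by apply: quasi_continuous_sum => i; case: (hF i).
by move=> z; rewrite hs; apply: eq_bigr => i _; case: (hF i).
Qed.

End Elementary.

(** Variant of [qc_ind] for functions given on an open subset only, as in [continuous_family], where
    the test functions live over an open subset of the base. *)
Lemma qc_open_ind (R : realType) (X : topologicalType) (P : (X -> R) -> Prop)
    (good : set X -> Prop) (A : set X) : open A ->
  lh_locally_compact X -> (forall x, exists N : set X, [/\ open N, N x & good N]) ->
  (forall A B, A `<=` B -> good B -> good A) ->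
  P (fun=> 0) -> (forall f g, P f -> P g -> P (fun x => f x + g x)) ->
  (forall U f, open U -> U `<=` A -> hausdorff_on U -> good U -> elementary U f -> P f) ->
  forall f : set_type A -> R, quasi_continuous f -> P (valL_ 0 f).
Proof.
move=> oA lX hN goodS P0 PD Pe.
have valLE (h : set_type A -> R) f :
    (forall z, f (\val z) = h z) -> (forall x, ~ A x -> f x = 0) -> valL_ 0 h = f.
  move=> fh f0; apply/funext => x; have [Ax|nA] := pselect (A x).
    by rewrite -[x]/(\val (subp Ax)) valL_val fh.
  by rewrite valL_out// f0.
apply: (@qc_ind R _ (fun f => P (valL_ 0 f)) (fun U => good (\val @` U))).
- exact: lhlc_open.
- move=> z; have [N [oN Nz gN]] := hN (\val z).
  exists (\val @^-1` N); split => //.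
    by apply: open_comp => // ? _; exact: val_continuous.
  by apply: goodS gN => _ [w Nw <-].
- by move=> B C BC; apply: goodS; exact: image_subset.
- by rewrite (valLE _ (fun=> 0)).
- move=> f g Pf Pg; rewrite (valLE _ (fun x => valL_ 0 f x + valL_ 0 g x)).
  + exact: PD.
  + by move=> z; rewrite !valL_val.
  + by move=> x nA; rewrite !valL_out// addr0.
- move=> U f oU hU gU fU; apply: (Pe (\val @` U)) => //.
  + exact: open_val.
  + by move=> _ [z _ <-]; exact: set_valP.
  + exact: hausdorff_on_val.
  + exact: elementary_valL.
Qed.

Lemma quasi_continuous_valL (R : realType) (X : topologicalType) (A : set X)
  (f : set_type A -> R) : lh_locally_compact X -> open A ->
  quasi_continuous f -> quasi_continuous (valL_ 0 f).
Proof.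
move=> lX oA; move: f; apply: (@qc_open_ind R X (@quasi_continuous R X) (fun=> True)) => //.
- by move=> x; exists setT; split => //; exact: openT.
- exact: quasi_continuous0.
- exact: quasi_continuousD.
- by move=> U f oU _ hU _ fU; exact: elementary_qc fU.
Qed.

(** * Continuous families over a Hausdorff base and their pull-backs *)

Section ContinuousFamily.
Context {R : realType} {X Z : topologicalType} (q : X -> Z) (beta : measure_family R q).
Hypothesis hZ : hausdorff_space Z.

Lemma quasi_continuous_valT (A : set X) (f : X -> R) : (forall x, A x) ->
  quasi_continuous f -> quasi_continuous (fun z : set_type A => f (\val z)).
Proof.
move=> AT /quasi_continuousP[n [h [U [oU hU hC fE]]]]; apply/quasi_continuousP.
exists n, (fun i z => h i (\val z)), (fun i => \val @^-1` (U i)); split.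
- by move=> i; apply: open_comp => // ? _; exact: val_continuous.
- by move=> i; apply: hausdorff_on_preval.
- move=> i; have [cf [S cS [SU S0]]] := hC i; split.
    move=> z Uz; apply: (@continuous_comp _ _ _ (\val : set_type A -> X) (h i)).
      exact: val_continuous.
    exact: cf.
  exists (\val @^-1` S); first by apply: compact_preval.
  by split => [z /SU|z /S0].
- by move=> z; rewrite fE.
Qed.

(** The case V = setT of the definition, transported along the homeomorphism of Z with its full
    subtype. *)
Lemma family_integral_Cc (f : X -> R) : continuous_family beta -> quasi_continuous f ->
  Cc (family_integral beta f).
Proof.
move=> cb fC; have hT : hausdorff_space (set_type (setT : set Z)).
  by apply/hausdorff_onP/hausdorff_onT.
have := cb setT openT hT f (quasi_continuous_valT (A := q @^-1` setT) (fun=> I) fC).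
have cphi : continuous (fun z => subp (I : setT z) : set_type (setT : set Z)).
  by apply: continuous_val_comp => z; exact: cvg_id.
move=> /(Cc_homeo cphi (@val_continuous Z setT)); apply => // z.
exact/val_inj.
Qed.

(* Continuity of the pull-back of a continuous family along [t]: near [t0] the integrand
   is approximated, uniformly on the compact set C, by a fixed combination of bumps. *)
Lemma pullback_continuous (T : topologicalType) (t : T -> Z) (phi : X -> T -> R)
    (W C : set X) (t0 : T) :
  lh_locally_compact X -> continuous q -> (forall z, hausdorff_on (map_fibre q z)) ->
  continuous_family beta -> {for t0, continuous t} ->
  open W -> hausdorff_on W -> compact C -> C `<=` W ->
  (\forall s \near t0, forall x, q x = t s -> ~ C x -> phi x s = 0) ->
  (forall x e, C x -> q x = t t0 -> 0 < e ->
    \forall x' \near x & s \near t0, q x' = t s -> `|phi x' s - phi x t0| < e) ->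
  (\forall s \near t0, Cc (fun z : set_type (map_fibre q (t s)) => phi (\val z) s)) ->
  {for t0, continuous (fun s => radon_integral (beta (t s)) (fun z => phi (\val z) s))}.
Proof.
move=> lX cq hq cb ct oW hW cC CW phi0 phic phiC.
have clq z : closed (map_fibre q z).
  apply: closed_comp => [x _|]; first exact: cq.
  exact/accessible_closed_set1/hausdorff_accessible.
have elC f s : elementary W f -> Cc (fun z : set_type (map_fibre q (t s)) => f (\val z)).
  by move=> fW; apply: qc_restrict => //; exact: elementary_qc fW.
have elI f : elementary W f -> {for t0, continuous (fun s => family_integral beta f (t s))}.
  move=> fW; have [cf _] := family_integral_Cc cb (elementary_qc oW hW fW).
  by apply: continuous_comp; [exact: ct|exact: cf].
have [eta [etaW eta01 [N [oN CN NW N1]]]] := @bump R X lX W oW hW C cC CW.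
have approx e : 0 < e -> exists2 psi, elementary W psi &
    \forall s \near t0, forall x, q x = t s -> `|phi x s - psi x| <= e * eta x.
  move=> e0.
  have /choice[A hA] : forall x, exists A : set X, C x -> [/\ open A, A x, A `<=` N &
      exists c, \forall s \near t0, forall x, A x -> q x = t s -> `|phi x s - c| <= e].
    move=> x; have [Cx|nC] := pselect (C x); last by exists set0.
    have [qx|qx] := pselect (q x = t t0).
      have [[A B] [/= nA nB] AB] := phic x e Cx qx e0.
      have [A' [oA' A'x] A'A] : exists2 A' : set X, open A' /\ A' x & A' `<=` A.
        by move: nA; rewrite nbhsE => -[A' [? ?] ?]; exists A'.
      exists (A' `&` N) => _; split; [exact: openI|by split => //; exact: CN|by move=> y []|].
      exists (phi x t0); apply: filterS nB => s Bs y [A'y _] qy.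
      by apply/ltW/(AB (y, s)) => //; split => //=; exact: A'A.
    (* When x does not lie over [t t0], no point near x lies over [t s] for s near t0. The condition
       is vacuous and the constant 0 serves. *)
    have [U [V [oU oV Uq Vt UV]]] := iffLR hausdorff_onT hZ _ _ I I qx.
    exists (q @^-1` U `&` N) => _; split.
    - by apply: openI => //; apply: open_comp => // ? _; exact: cq.
    - by split => //; exact: CN.
    - by move=> y [].
    exists 0; have Vs : \forall s \near t0, V (t s).
      by apply: ct; exact: open_nbhs_nbhs.
    apply: filterS Vs => s Vs y [Uy _] qy; exfalso.
    by apply: (UV (t s)) => //; rewrite -qy.
  have [x Cx|n [U [UE CU]]] := compact_finite_cover (O := A) cC; first by case: (hA x Cx).
  have /choice[c hc] : forall i : 'I_n, exists c,
      \forall s \near t0, forall x, U i x -> q x = t s -> `|phi x s - c| <= e.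
    by move=> i; have [x Cx ->] := UE i (ltn_ord i); have [_ _ _] := hA x Cx.
  have UN i : (i < n)%N -> U i `<=` N by move=> /UE[x Cx ->]; case: (hA x Cx).
  have oU i : (i < n)%N -> open (U i) by move=> /UE[x Cx ->]; case: (hA x Cx).
  have [g [gW g0 gU gs1 gC]] := @bump_partition R X lX W oW hW C n U cC CW oU CU.
  exists (fun x => \sum_(i < n) c i * g i x).
    apply: (@fun_sum_ind _ _ _ (elementary W) _ (fun i x => c i * g i x)).
    - by split => [x _|]; [exact: cst_continuous|exists set0; [exact: compact0|split]].
    - move=> f h [cf [S cS [SW S0]]] [ch [S' cS' [SW' S0']]]; split.
        by move=> x Wx; apply: continuousD; [exact: cf|exact: ch].
      exists (S `|` S'); first exact: compactU.
      by split => [x [/SW|/SW']//|x /not_orP[/S0 -> /S0' ->]]; rewrite addr0.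
    - by move=> i; exact: elementaryZ.
  have hc' : \forall s \near t0, forall (i : 'I_n) x, U i x -> q x = t s -> `|phi x s - c i| <= e.
    by apply: filter_forall => i; exact: hc.
  apply: filterS2 phi0 hc' => s s0 sc x qx.
  (* On C the g i sum to 1; at the other points of the fibre phi vanishes. *)
  have -> : phi x s = \sum_(i < n) phi x s * g i x.
    rewrite -mulr_sumr; have [/gC ->|/(s0 x qx) ->] := pselect (C x); last by rewrite mul0r.
    by rewrite mulr1.
  rewrite -sumrB; apply: (@le_trans _ _ (\sum_(i < n) e * g i x)).
    apply: (le_trans (ler_norm_sum _ _ _)); apply: ler_sum => i _.
    rewrite -mulrBl normrM (ger0_norm (g0 i x)).
    have [Ui|/gU ->] := pselect (U i x); last by rewrite !mulr0.
    by apply: ler_wpM2r => //; exact: sc.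
  rewrite -mulr_sumr ler_pM2l//.
  have [Nx|nN] := pselect (N x); first by rewrite N1.
  rewrite big1; first by case/andP: (eta01 x).
  by move=> i _; apply: gU => /UN-/(_ (ltn_ord i)).
pose J s := radon_integral (beta (t s)) (fun z => phi (\val z) s).
(* The added 1 makes B positive and, by continuity, a bound for the integral of eta over all fibres
   [t s] with s near t0. *)
pose B := family_integral beta eta (t t0) + 1.
have B0 : 0 < B.
  by rewrite ltr_wpDl//; apply: radon_integral_ge0 => z; case/andP: (eta01 (\val z)).
have etaB : \forall s \near t0, family_integral beta eta (t s) < B.
  have := elI _ etaW [set y | y < B]; apply.
  by apply: open_nbhs_nbhs; split; [exact: open_lt|rewrite /B /= ltrDl].
have bound e : 0 < e -> exists2 psi, elementary W psi &
    \forall s \near t0, `|J s - family_integral beta psi (t s)| <= e * B.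
  move=> e0; have [psi psiW hpsi] := approx e e0; exists psi => //.
  near=> s.
  have sC : Cc (fun z : set_type (map_fibre q (t s)) => phi (\val z) s) by near: s.
  have h z : `|phi (\val (z : set_type (map_fibre q (t s)))) s - psi (\val z)| <= e * eta (\val z).
    by move: (set_valP z); move: (\val z); near: s; apply: filterS hpsi => s h z; exact: h.
  have -> : J s - family_integral beta psi (t s) =
      radon_integral (beta (t s)) (fun z => phi (\val z) s + -1 * psi (\val z)).
    rewrite radon_integralD ?radon_integralZ ?mulN1r//; first exact: elC.
    by apply: CcZ; exact: elC.
  apply: (@le_trans _ _ (e * family_integral beta eta (t s))); last first.
    by rewrite ler_pM2l// ltW//; near: s.
  rewrite -radon_integralZ; last exact: elC.
  apply: radon_integral_norm_le.
  - by apply: CcD => //; apply: CcZ; exact: elC.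
  - by apply: CcZ; exact: elC.
  - by move=> z; rewrite mulN1r.
apply/cvgrPdist_le => e e0.
(* With this error the approximation costs at most e/3 at s and at t0; the last third is the
   variation of the integral of psi. *)
have e'0 : 0 < e / (3 * B) by rewrite divr_gt0// mulr_gt0.
have [psi psiW hpsi] := bound _ e'0.
have /cvgrPdist_le/(_ (e / 3)) := elI _ psiW; rewrite divr_gt0// => /(_ isT) hpsi'.
have hB : e / (3 * B) * B = e / 3 by rewrite invfM mulrA mulfVK// gt_eqF.
rewrite hB in hpsi; have hpsi0 := nbhs_singleton hpsi.
apply: filterS2 hpsi hpsi' => s h1 h2.
change (`|J t0 - J s| <= e).
have -> : J t0 - J s = (J t0 - family_integral beta psi (t t0)) +
  ((family_integral beta psi (t t0) - family_integral beta psi (t s)) -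
   (J s - family_integral beta psi (t s))) by lra.
apply: (le_trans (ler_normD _ _)); have -> : e = e / 3 + (e / 3 + e / 3) by lra.
by apply: lerD => //; apply: (le_trans (ler_normB _ _)); exact: lerD.
Unshelve. all: by end_near. Qed.

End ContinuousFamily.

(** * Topology of the total groupoid of a fibration *)

Lemma hausdorff_on_nbhs (X : topologicalType) (A : set X) :
  (forall x y, A x -> A y -> x <> y -> exists U V : set X,
    [/\ nbhs x U, nbhs y V & forall z, A z -> U z -> V z -> False]) -> hausdorff_on A.
Proof.
move=> h x y Ax Ay /(h x y Ax Ay)[U [V [nU nV UV]]].
exists U^°, V^°; split => //; try exact: open_interior.
by move=> z Az /interior_subset Uz /interior_subset; exact: UV.
Qed.

Lemma closed_eq_fun (X Z : topologicalType) (f g : X -> Z) : hausdorff_space Z ->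
  continuous f -> continuous g -> closed [set x | f x = g x].
Proof.
move=> /hausdorff_onT hZ cf cg x clx /=; apply: contrapT => fg.
have [U [V [oU oV Ux Vx UV]]] := hZ _ _ I I fg.
have : nbhs x (f @^-1` U `&` g @^-1` V).
  by apply: filterI; [apply: cf|apply: cg]; exact: open_nbhs_nbhs.
by move=> /clx[y [/= e [Uy Vy]]]; apply: (UV (f y)) => //; rewrite e.
Qed.

Lemma lhlc_prod (X Y : topologicalType) : lh_locally_compact X -> lh_locally_compact Y ->
  lh_locally_compact (X * Y)%type.
Proof.
move=> /lh_locally_compactP lX /lh_locally_compactP lY; apply/lh_locally_compactP.
move=> [x y] V [[A B] [/= nA nB] AB].
have [K [nK KA cK hK]] := lX x A nA; have [K' [nK' KB cK' hK']] := lY y B nB.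
exists (K `*` K'); split.
- by exists (K, K').
- by move=> [a b] [/= /KA Aa /KB Bb]; apply: AB.
- exact: compact_setX.
- move=> [a b] [a' b'] [/= Ka Kb] [/= Ka' Kb'] ab.
  have [aa|aa] := pselect (a = a').
    have [|U [U' [oU oU' Ub U'b UU']]] := hK' _ _ Kb Kb'; first by move=> bb; apply: ab; rewrite aa bb.
    exists (snd @^-1` U), (snd @^-1` U'); split => //; try by apply: open_comp => // ? _; exact: cvg_snd.
    by move=> [u v] [/= _ Kv]; exact: UU'.
  have [U [U' [oU oU' Ub U'b UU']]] := hK _ _ Ka Ka' aa.
  exists (fst @^-1` U), (fst @^-1` U'); split => //; try by apply: open_comp => // ? _; exact: cvg_fst.
  by move=> [u v] [/= Ku _]; exact: UU'.
Qed.

(** * Cancellation, continuity of division, and range fibres *)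

Section GroupoidAlgebra.
Context {G : topGroupoid}.
Implicit Types k l m : garr G.

Lemma gmulKl k l : src k = rng l -> gmul (ginv k) (gmul k l) = l.
Proof. by move=> kl; rewrite gmulA ?src_inv// gmulVl kl gmul1l. Qed.

Lemma gmulVKl k l : rng k = rng l -> gmul k (gmul (ginv k) l) = l.
Proof. by move=> kl; rewrite gmulA ?rng_inv ?src_inv// gmulVr kl gmul1l. Qed.

Lemma gmulI k l m : src k = rng l -> src k = rng m -> gmul k l = gmul k m -> l = m.
Proof. by move=> kl km e; rewrite -(gmulKl kl) e gmulKl. Qed.

Lemma ginvK k : ginv (ginv k) = k.
Proof.
apply: (@gmulI (ginv k)); rewrite ?rng_inv ?src_inv//.
by rewrite gmulVr gmulVl rng_inv.
Qed.

Lemma ginv_mul k l : src k = rng l -> ginv (gmul k l) = gmul (ginv l) (ginv k).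
Proof.
move=> kl; apply: (@gmulI (gmul k l)).
- by rewrite rng_inv.
- by rewrite src_mul// rng_mul rng_inv// src_inv.
- rewrite gmulVr rng_mul// -gmulA//; last by rewrite rng_mul rng_inv ?src_inv.
  by rewrite gmulVKl ?rng_inv// gmulVr.
Qed.

Lemma gmul_nbhs k l (W : set (garr G)) : src k = rng l -> nbhs (gmul k l) W ->
  exists A B, [/\ nbhs k A, nbhs l B &
    forall a b, A a -> B b -> src a = rng b -> W (gmul a b)].
Proof.
move=> kl nW; pose D := [set kl : garr G * garr G | src kl.1 = rng kl.2].
have /nbhs_valP[U oU [Ukl UW]] := @gmul_continuous G (@subp _ D (k, l) kl) W nW.
have [[A B] [/= nA nB] AB] : nbhs (k, l) U by exact: open_nbhs_nbhs.
exists A, B; split => // a b Aa Bb ab.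
by apply: (UW (@subp _ D (a, b) ab)); exact: AB.
Qed.

Lemma gdiv_nbhs k l (W : set (garr G)) : rng k = rng l -> nbhs (gmul (ginv k) l) W ->
  exists A B, [/\ nbhs k A, nbhs l B &
    forall a b, A a -> B b -> rng a = rng b -> W (gmul (ginv a) b)].
Proof.
move=> kl /gmul_nbhs[|A [B [nA nB AB]]]; first by rewrite src_inv.
exists (@ginv G @^-1` A), B; split => //; first exact: ginv_continuous.
by move=> a b Aa Bb ab; apply: AB => //; rewrite src_inv.
Qed.

Lemma rng_fibre_closed (x : gobj G) : hausdorff_space (gobj G) -> closed (map_fibre (@rng G) x).
Proof.
move=> hG; apply: closed_comp => [k _|]; first exact: rng_continuous.
exact/accessible_closed_set1/hausdorff_accessible.
Qed.

(* The range fibres are Hausdorff although the arrow space need not be: two points g, h of a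
   fibre that cannot be separated would make g^-1 h lie in every neighbourhood of a unit. *)
Lemma rng_fibre_hausdorff (x : gobj G) : locally_hausdorff (garr G) ->
  hausdorff_space (gobj G) -> hausdorff_on (map_fibre (@rng G) x).
Proof.
move=> /locally_hausdorff_T1 T1 /hausdorff_onT hG; apply: hausdorff_on_nbhs => g h gx hx gh.
have {}gx : rng g = x by [].
have {}hx : rng h = x by [].
have [s_gh|/(hG _ _ I I)[U [V [oU oV Ug Vh UV]]]] := pselect (src g = src h); last first.
  exists (@src G @^-1` U), (@src G @^-1` V); split.
  - by apply: src_continuous; exact: open_nbhs_nbhs.
  - by apply: src_continuous; exact: open_nbhs_nbhs.
  - by move=> z _ /= Uz Vz; exact: (UV (src z)).
pose e := gone (src g).
have /T1[V [oV]] : e != gmul (ginv g) h.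
  apply/eqP => eE; apply: gh; rewrite -(gmulVKl (etrans gx (esym hx))) -eE.
  by rewrite gmul1r.
rewrite !inE => Ve nV.
have se : src e = src g by rewrite src_one.
(* V contains the unit e but not g^-1 h. An arrow m near both g and h would give g^-1 m in A and
   m^-1 h in B, hence their product g^-1 h in V. *)
have nVe : nbhs (gmul e (ginv e)) V.
  by rewrite gmulVr rng_one; exact: open_nbhs_nbhs.
have [A [B [nA nB AB]]] := gmul_nbhs (esym (rng_inv e)) nVe.
have nW : nbhs e (A `&` @ginv G @^-1` B).
  by apply: filterI => //; exact: ginv_continuous.
have nWg : nbhs (gmul (ginv g) g) (A `&` @ginv G @^-1` B) by rewrite gmulVl.
have nWh : nbhs (gmul (ginv h) h) (A `&` @ginv G @^-1` B) by rewrite gmulVl -s_gh.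
have [C [D [nC nD CD]]] := gdiv_nbhs erefl nWg.
have [C' [D' [nC' nD' CD']]] := gdiv_nbhs erefl nWh.
exists D, D'; split => // m mx Dm D'm; have {}mx : rng m = x by [].
have [|A1 _] := CD g m (nbhs_singleton nC) Dm; first by rewrite gx.
have [|_ /= B1] := CD' h m (nbhs_singleton nC') D'm; first by rewrite hx.
apply: nV; have := AB _ _ A1 B1.
rewrite ginv_mul ?src_inv ?hx// ginvK src_mul ?rng_mul ?src_inv ?rng_inv ?gx//.
move=> /(_ erefl); rewrite -gmulA ?src_inv ?rng_inv ?gx ?mx// ?rng_mul ?rng_inv//.
by rewrite gmulVKl ?src_inv ?mx ?hx.
all: by rewrite ?src_inv mx hx.
Qed.

End GroupoidAlgebra.

Section FibrationTopology.
Context {L H : topGroupoid} {F : groupoid_functor L H}.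
Implicit Types a b k l : garr L.
Local Notation p := (arr_rng F).
Local Notation G1 := (set_type (fibre_arr F)).

Lemma farr_inv k : farr F (ginv k) = ginv (farr F k).
Proof.
apply: (@gmulI H (farr F k)); rewrite ?rng_inv ?src_farr ?rng_farr ?rng_inv//.
by rewrite -farr_mul ?rng_inv// !gmulVr farr_one rng_farr.
Qed.

Lemma arr_rngP a b : p a = p b <-> farr F a = farr F b /\ rng a = rng b.
Proof.
by split => [/(congr1 \val)[]//|[Fab rab]]; apply/val_inj => /=; rewrite Fab rab.
Qed.

Lemma fibre_div a b : p a = p b -> fibre_arr F (gmul (ginv a) b).
Proof.
move=> /arr_rngP[Fab rab]; rewrite /fibre_arr /= farr_mul ?src_inv//.
by rewrite farr_inv Fab gmulVl src_farr src_mul// src_inv.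
Qed.

Lemma arr_rng_mul k (g : G1) : src k = rng (\val g) -> p (gmul k (\val g)) = p k.
Proof.
move=> kg; apply/arr_rngP; split; last by rewrite rng_mul.
have Fg : farr F (\val g) = gone (fobj F (src (\val g))) := set_valP g.
by rewrite farr_mul// Fg (fibre_src_rng Fg) -kg -src_farr gmul1r.
Qed.

Lemma arr_rng_continuous : continuous p.
Proof.
by apply: continuous_val_comp; apply: continuous_pair;
  [exact: farr_continuous|exact: rng_continuous].
Qed.

Hypothesis HF : is_fibration F.

(** The fibration condition is stated with sources. Inversion of arrows in L and in H exchanges the
    two pull-backs and turns openness and surjectivity of (F, s) into those of (F, r). *)
Let flip (y : set_type (rng_pullback F)) : set_type (src_pullback F) :=
  @SigSub _ _ (src_pullback F) (ginv (\val y).1, (\val y).2)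
    (mem_set (etrans (src_inv (\val y).1) (set_valP y : rng (\val y).1 = _)
       : src_pullback F (ginv (\val y).1, (\val y).2))).

Let flip_continuous : continuous flip.
Proof.
apply: continuous_val_comp; apply: continuous_pair.
  apply: (continuous_comp_fun _ (@ginv_continuous H)).
  by apply: (continuous_comp_fun (@val_continuous _ _)) => ?; exact: cvg_fst.
by apply: (continuous_comp_fun (@val_continuous _ _)) => ?; exact: cvg_snd.
Qed.

Let flip_arr (y : set_type (rng_pullback F)) l : arr_src F l = flip y <-> p (ginv l) = y.
Proof.
split => [/(congr1 \val) /= [Fl sl]|<-]; apply/val_inj => /=.
  by rewrite farr_inv Fl ginvK rng_inv sl; case: (\val y).
by rewrite farr_inv ginvK rng_inv.
Qed.

Lemma arr_rng_open (U : set (garr L)) : open U -> open (p @` U).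
Proof.
move=> oU; have [_ oF _] := HF.
have -> : p @` U = flip @^-1` (arr_src F @` (@ginv L @^-1` U)).
  apply/seteqP; split => [_ [l Ul <-]|y [l Ul /flip_arr e]]; last by exists (ginv l).
  by exists (ginv l); rewrite /preimage/= ?ginvK//; apply/flip_arr; rewrite ginvK.
apply: open_comp => [? _|]; first exact: flip_continuous.
by apply: oF; apply: open_comp => // ? _; exact: ginv_continuous.
Qed.

Lemma arr_rng_surj y : exists l, p l = y.
Proof.
by have [_ _ /(_ (flip y))[l /flip_arr e]] := HF; exists (ginv l).
Qed.

Lemma arr_rng_nbhs l (A : set (garr L)) : nbhs l A -> nbhs (p l) (p @` A).
Proof.
rewrite nbhsE => -[U [oU Ul] UA].
apply: (@filterS _ _ _ (p @` U)); first exact: image_subset.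
by apply: open_nbhs_nbhs; split; [exact: arr_rng_open|exists l].
Qed.

(** Division is continuous and sends (l, l) to the unit at s(l), so arrows near l over the same base
    point differ by elements of W. This carries local properties of the fibre groupoid at units over
    to L. *)
Lemma small_nbhs l (W : set G1) : nbhs (fibre_one F (src l)) W ->
  exists N : set (garr L), [/\ open N, N l & forall a b (g : G1), N a -> N b ->
    p a = p b -> \val g = gmul (ginv a) b -> W g].
Proof.
move=> /nbhs_valP[U oU [/= U1 UW]].
have nU : nbhs (gmul (ginv l) l) U by rewrite gmulVl; exact: open_nbhs_nbhs.
have [A [B [nA nB AB]]] := gdiv_nbhs erefl nU.
exists (A `&` B)^°; split; first exact: open_interior.
  exact: (filterI nA nB).
move=> a b g /interior_subset[Aa _] /interior_subset[_ Bb] /arr_rngP[_ ab] gE.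
by apply: UW; rewrite /= gE; exact: AB.
Qed.

Hypothesis HG : lhlc_groupoid (fibre HF).
Hypothesis HH : lhlc_groupoid H.

(** Arrows k, k' near l with different images in H or different ranges are separated there.
    Otherwise k^-1 k' is not a unit but lies, with the unit at s(k), in a Hausdorff chart of the
    fibre groupoid. An arrow m close to both k and k' would put the unit m^-1 m into both separating
    sets. *)
Lemma total_locally_hausdorff : locally_hausdorff (garr L).
Proof.
have [lhG _ _ /hausdorff_onT hL0] := HG; have [/locally_hausdorffP lhH _ _ _] := HH.
have /locally_hausdorffP{}lhG : locally_hausdorff G1 := lhG.
apply/locally_hausdorffP => l.
have [V [oV V1 hV]] := lhG (fibre_one F (src l)).
have [VH [oVH VHl hVH]] := lhH (farr F l).
have [N [oN Nl NV]] := small_nbhs (open_nbhs_nbhs (conj oV V1)).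
exists (N `&` farr F @^-1` VH); split => //.
  by apply: openI => //; apply: open_comp => // ? _; exact: farr_continuous.
apply: hausdorff_on_nbhs => k k' [Nk VHk] [Nk' VHk'] kk'.
have [Fk|Fk] := pselect (farr F k = farr F k'); last first.
  have [U [U' [oU oU' Uk U'k UU']]] := hVH _ _ VHk VHk' Fk.
  exists (farr F @^-1` U), (farr F @^-1` U'); split.
  - by apply: farr_continuous; exact: open_nbhs_nbhs.
  - by apply: farr_continuous; exact: open_nbhs_nbhs.
  - by move=> z [_ VHz]; exact: UU'.
have [rk|/(hL0 _ _ I I)[U [U' [oU oU' Uk U'k UU']]]] := pselect (rng k = rng k'); last first.
  exists (@rng L @^-1` U), (@rng L @^-1` U'); split.
  - by apply: rng_continuous; exact: open_nbhs_nbhs.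
  - by apply: rng_continuous; exact: open_nbhs_nbhs.
  - by move=> z _; exact: UU'.
have pk : p k = p k' by apply/arr_rngP.
pose g : G1 := subp (fibre_div pk).
have Vg : V g by exact: (NV k k' g).
have V1k m : N m -> V (fibre_one F (src m)).
  by move=> Nm; apply: (NV m m) => //=; rewrite gmulVl.
have g1 : fibre_one F (src k) <> g.
  move=> /(congr1 \val) /= e; apply: kk'.
  by rewrite -(gmulVKl rk) -e gmul1r.
have [U [U' [oU oU' U1 U'g UU']]] := hV _ _ (V1k _ Nk) Vg g1.
case: oU oU' U1 U'g UU' => P oP <- [P' oP' <-] /= P1 P'g UU'.
have nP : nbhs (gmul (ginv k) k) P by rewrite gmulVl; exact: open_nbhs_nbhs.
have nP' : nbhs (gmul (ginv k) k') P' by exact: open_nbhs_nbhs.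
have [A [B [nA nB AB]]] := gdiv_nbhs erefl nP.
have [A' [B' [nA' nB' AB']]] := gdiv_nbhs rk nP'.
exists (A `&` B `&` A'), B'; split => //; first by do 2 apply: filterI => //.
move=> m [Nm _] [[Am Bm] A'm] B'm; apply: (UU' (fibre_one F (src m))) => /=.
- exact: V1k.
- by have := AB m m Am Bm erefl; rewrite gmulVl.
- by have := AB' m m A'm B'm erefl; rewrite gmulVl.
Qed.

Lemma rng_pullback_lhlc : lh_locally_compact (set_type (rng_pullback F)).
Proof.
have [_ _ lL0 _] := HG; have [_ lH _ hH0] := HH.
apply: lhlc_closed; last exact: lhlc_prod.
apply: closed_eq_fun => //.
- by apply: continuous_comp_fun (@rng_continuous H) => ?; exact: cvg_fst.
- by apply: continuous_comp_fun (@fobj_continuous _ _ F) => ?; exact: cvg_snd.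
Qed.

(* The compact neighbourhood of l consists of the b over a compact C such that a^-1 b lies in a
   fixed compact neighbourhood K of the unit, for all a near l over the same point as b. *)
Lemma total_lhlc : lh_locally_compact (garr L).
Proof.
have [lhG lcG _ _] := HG.
have /locally_hausdorffP{}lhG : locally_hausdorff G1 := lhG.
have /lh_locally_compactP{}lcG : lh_locally_compact G1 := lcG.
have lY := rng_pullback_lhlc.
apply/lh_locally_compactP => l U0 nU0.
have [U1 [oU1 U1l hU1]] := iffLR locally_hausdorffP total_locally_hausdorff l.
have [U oU [Ul UU0]] : exists2 U : set (garr L), open U & U l /\ U `<=` U0.
  by move: nU0; rewrite nbhsE => -[U [oU Ul] ?]; exists U.
pose e := fibre_one F (src l).
have [V [oV Ve hV]] := lhG e.
have ee : src (e : garr (fibre HF)) = rng (e : garr (fibre HF)).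
  by rewrite /= /fibre_src /fibre_rng /= src_one rng_one.
have nVee : nbhs (gmul (e : garr (fibre HF)) e) V.
  have -> : gmul (e : garr (fibre HF)) e = e.
    change (fibre_mul e e = e).
    by have := fibre_mul1l e; rewrite {1}/fibre_rng /= rng_one.
  exact: open_nbhs_nbhs.
(* The unit is idempotent, so K can be chosen with all products of two of its elements in the
   Hausdorff chart V. *)
have [W1 [W2 [nW1 nW2 WV]]] := @gmul_nbhs (fibre HF) e e V ee nVee.
have lone : src l = rng (gone (src l)) by rewrite rng_one.
have nUU : nbhs (gmul l (gone (src l))) (U `&` U1).
  by rewrite gmul1r; apply: filterI; exact: open_nbhs_nbhs.
(* As l times its unit is l, products of an arrow near l with an element of a small K stay in the
   prescribed neighbourhood and in a Hausdorff chart. *)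
have [A [B [nA nB AB]]] := gmul_nbhs lone nUU.
have nK0 : nbhs e (W1 `&` W2 `&` V `&` \val @^-1` B).
  apply: filterI; last exact: nbhs_val.
  by apply: filterI; [exact: filterI|exact: open_nbhs_nbhs].
have [K [nK KW cK _]] := lcG e _ nK0.
have KV : K `<=` V by move=> g /KW[[_ ?] _].
have [N0 [oN0 N0l N0K]] := small_nbhs nK.
pose N := N0 `&` A^°.
have nN : nbhs l N.
  by apply: filterI; [exact: open_nbhs_nbhs|exact: nbhs_interior].
have NK a b (g : G1) : N a -> N b -> p a = p b -> \val g = gmul (ginv a) b -> K g.
  by move=> [Na _] [Nb _]; exact: N0K.
have NA a : N a -> A a by move=> [_ /interior_subset].
have oN : open N by apply: openI => //; exact: open_interior.
have [C [nC CN cC _]] := iffLR lh_locally_compactP lY (p l) (p @` N) (arr_rng_nbhs nN).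
pose K' := [set b | C (p b) /\
  forall a (g : G1), N a -> p a = p b -> \val g = gmul (ginv a) b -> K g].
have K'U : K' `<=` U `&` U1.
  move=> b [/CN[a Na ab] hb]; pose g : G1 := subp (fibre_div ab).
  have /KW[_ Bg] : K g by exact: (hb a g Na ab erefl).
  have /arr_rngP[_ rab] := ab.
  rewrite -(gmulVKl rab); apply: AB => //; first exact: NA.
  by rewrite rng_mul ?src_inv// rng_inv.
exists K'; split.
- have : nbhs l (p @^-1` C `&` N) by apply: filterI => //; exact: arr_rng_continuous.
  apply: filterS => b [Cb Nb]; split => // a g Na ab gE; exact: NK Na Nb ab gE.
- by move=> b /K'U[/UU0].
- move=> Fl PF FK'.
  have pC : (p @ Fl) C by rewrite /fmap /=; apply: filterS FK' => b [].
  have PpF : ProperFilter (p @ Fl) by exact: fmap_proper_filter.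
  have [y [Cy cly]] := cC _ PpF pC.
  have [k Nk ky] := CN y Cy.
  (* Quotients a^-1 b, with a tending to k and b running along [Fl], generate a filter on the fibre
     groupoid that contains K. Its cluster point g in K yields kg as a cluster point of [Fl]. *)
  pose D (A B : set (garr L)) : set G1 := [set g | exists a b, [/\ A a, B b, p a = p b &
    \val g = gmul (ginv a) b]].
  pose F' := filter_from [set AB : set (garr L) * set (garr L) | nbhs k AB.1 /\ Fl AB.2]
    (fun AB => D AB.1 AB.2).
  have PF' : ProperFilter F'.
    apply: filter_from_proper.
      apply: filter_from_filter; first by exists (setT, setT); split; exact: filterT.
      move=> [A1 B1] [A2 B2] [/= nA1 FB1] [/= nA2 FB2]; exists (A1 `&` A2, B1 `&` B2).
        by split; exact: filterI.
      by move=> g [a [b [[? ?] [? ?] ? ?]]]; split; exists a, b.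
    move=> [A1 B1] [/= nA1 FB1].
    have nyA : nbhs y (p @` A1) by rewrite -ky; exact: arr_rng_nbhs.
    have pB : (p @ Fl) (p @` B1) by rewrite /fmap /=; apply: filterS FB1; exact: preimage_image.
    have [_ [[b Bb <-] [a Aa ab]]] := cly _ _ pB nyA.
    by exists (subp (fibre_div ab)), a, b.
  have F'K : F' K.
    exists (N, K'); first by split => //=; exact: open_nbhs_nbhs.
    by move=> g [a [b [/= Na [_ hb] ab gE]]]; exact: hb Na ab gE.
  have [g [Kg clg]] := cK F' PF' F'K.
  (* The range of a quotient a^-1 b is s(a), which tends to s(k); as L^0 is Hausdorff, the cluster
     point has range s(k). *)
  have kg : src k = rng (\val g).
    apply: contrapT => kg.
    have [_ _ _ /hausdorff_onT hL0] := HG.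
    have [P [Q [oP oQ Pk Qg PQ]]] := hL0 _ _ I I kg.
    have nP : nbhs k (@src L @^-1` P) by apply: src_continuous; exact: open_nbhs_nbhs.
    have F'D : F' (D (@src L @^-1` P) setT) by exists (@src L @^-1` P, setT) => //; split => //; exact: filterT.
    have nQ : nbhs g ((fun g : G1 => rng (\val g)) @^-1` Q).
      apply: (nbhs_val (U := @rng L @^-1` Q)).
      by apply: rng_continuous; exact: open_nbhs_nbhs.
    have [h [[a [b [Pa _ ab hE]]] Qh]] := clg _ _ F'D nQ.
    apply: (PQ (src a)) => //; move: Qh; rewrite /preimage/= hE rng_mul ?rng_inv//.
    by rewrite src_inv; have /arr_rngP[] := ab.
  pose b0 := gmul k (\val g).
  have pb0 : p b0 = p k by rewrite /b0 arr_rng_mul.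
  have clb0 : cluster Fl b0.
    move=> B1 W FB1 nW.
    have [A2 [D2 [nA2 nD2 AD]]] := gmul_nbhs kg nW.
    have F'D : F' (D A2 B1) by exists (A2, B1).
    have [h [[a [b [Aa Bb ab hE]]] Dh]] := clg _ _ F'D (nbhs_val nD2).
    have /arr_rngP[_ rab] := ab.
    exists b; split => //; rewrite -(gmulVKl rab) -hE; apply: AD => //.
    by rewrite hE rng_mul ?rng_inv ?src_inv.
  exists b0; split => //; split; first by rewrite pb0 ky.
  move=> a g' Na ab g'E; apply: contrapT => nKg'.
  have pak : p a = p k by rewrite ab pb0.
  have /arr_rngP[_ rak] := pak.
  pose h : G1 := subp (fibre_div pak).
  (* Here a^-1 b0 = (a^-1 k) g is a product of two elements of K, so it lies in V, where a point
     outside the compact K can be separated from K. *)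
  have Vg' : V g'.
    have Kh : K h by exact: (NK a k h Na Nk pak erefl).
    have hg : src (h : garr (fibre HF)) = rng (g : garr (fibre HF)).
      by rewrite /= /fibre_src /fibre_rng /= src_mul ?src_inv.
    have -> : g' = gmul (h : garr (fibre HF)) g.
      apply/val_inj; rewrite /= val_fibre_mul// g'E /b0 /= gmulA ?src_inv//.
    by apply: WV => //; [case: (KW _ Kh) => -[[]]|case: (KW _ Kg) => -[[]]].
  have [_ [[P oP <-] /= Pg'] PK] := hausdorff_compact_sep hV KV cK Vg' nKg'.
  have /arr_rngP[_ rab0] := ab.
  have nP : nbhs (gmul (ginv a) b0) P by rewrite -g'E; exact: open_nbhs_nbhs.
  have [A2 [B2 [nA2 nB2 AB2]]] := gdiv_nbhs rab0 nP.
  (* Since (F, r) is open, every b near b0 has the same image as some a' in N near a. For b in K'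
     the quotient a'^-1 b lies in K, against the separation. *)
  have nb0 : nbhs b0 (B2 `&` p @^-1` (p @` (A2 `&` N))).
    apply: filterI => //; apply: arr_rng_continuous; rewrite -ab.
    by apply: arr_rng_nbhs; apply: filterI => //; exact: open_nbhs_nbhs.
  have [b [[Cb hb] [B2b [a' [A2a' Na'] a'b]]]] := clb0 _ _ FK' nb0.
  pose h' : G1 := subp (fibre_div a'b).
  have Kh' : K h' by exact: (hb a' h' Na' a'b erefl).
  apply: (PK h') => //; first exact: KV.
  by rewrite /preimage /=; apply: AB2 => //; have /arr_rngP[] := a'b.
- by apply: hausdorff_onS hU1 => b /K'U[].
Qed.

Lemma total_lhlc_groupoid : lhlc_groupoid L.
Proof.
have [_ _ ? ?] := HG.
by split => //; [exact: total_locally_hausdorff|exact: total_lhlc].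
Qed.

End FibrationTopology.

(** * The induced family along the fibres of (F, r) *)

Lemma family_integral_eq (R : realType) (X Y : topologicalType) (p : X -> Y)
  (beta : measure_family R p) (f g : X -> R) (y : Y) :
  (forall x, p x = y -> f x = g x) -> family_integral beta f y = family_integral beta g y.
Proof.
by move=> fg; apply: eq_Rintegral => z _; apply: fg; exact: (set_valP z).
Qed.

Lemma family_integral_off (R : realType) (X Y : topologicalType) (p : X -> Y)
  (beta : measure_family R p) (f : X -> R) (y : Y) :
  (forall x, p x = y -> f x = 0) -> family_integral beta f y = 0.
Proof.
by move=> f0; rewrite (family_integral_eq _ (g := fun=> 0))//; exact: radon_integral0.
Qed.

Lemma gmul_continuous2 (G : topGroupoid) (X : topologicalType) (a b : X -> garr G) :
  continuous a -> continuous b -> (forall x, src (a x) = rng (b x)) ->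
  continuous (fun x => gmul (a x) (b x)).
Proof.
move=> ca cb ab x W nW; have [A [B [nA nB AB]]] := gmul_nbhs (ab x) nW.
have nx : nbhs x (a @^-1` A `&` b @^-1` B) by apply: filterI; [exact: ca|exact: cb].
by apply: filterS nx => y [Ay By]; exact: AB.
Qed.

Section InducedFamily.
Context {R : realType} {L H : topGroupoid} {F : groupoid_functor L H}.
Variable HF : is_fibration F.
Hypothesis HG : lhlc_groupoid (fibre HF).
Hypothesis HH : lhlc_groupoid H.
Variable lam : measure_family R (@rng (fibre HF)).
Hypothesis Hlam : haar_system lam.

Implicit Types k l : garr L.
Local Notation p := (arr_rng F).
Local Notation Y := (set_type (rng_pullback F)).
Local Notation G1 := (set_type (fibre_arr F)).

Let hL0 : hausdorff_space (gobj L).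
Proof. by case: HG. Qed.

Let lhL : locally_hausdorff (garr L).
Proof. exact: total_locally_hausdorff HG HH. Qed.

Let lcL : lh_locally_compact (garr L).
Proof. exact: total_lhlc HG HH. Qed.

Lemma arr_fibre_closed (y : Y) : closed (map_fibre p y).
Proof.
have -> : map_fibre p y = farr F @^-1` [set (\val y).1] `&` map_fibre (@rng L) (\val y).2.
  apply/seteqP; split => [l <-//|l [/= Fl rl]]; apply/val_inj => /=.
  by rewrite Fl rl; case: (\val y).
apply: closedI; last exact: rng_fibre_closed.
apply: closed_comp => [? _|]; first exact: farr_continuous.
by apply/accessible_closed_set1/locally_hausdorff_T1; case: HH.
Qed.

Lemma arr_fibre_hausdorff (y : Y) : hausdorff_on (map_fibre p y).
Proof.
apply: hausdorff_onS (rng_fibre_hausdorff (x := (\val y).2) lhL hL0).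
by move=> l <-.
Qed.

Lemma fibre_rng_closed (x : gobj L) : closed (map_fibre (@rng (fibre HF)) x).
Proof. exact: (@rng_fibre_closed (fibre HF)). Qed.

Lemma fibre_rng_hausdorff (x : gobj L) : hausdorff_on (map_fibre (@rng (fibre HF)) x).
Proof. by apply: (@rng_fibre_hausdorff (fibre HF)) => //; case: HG. Qed.

Lemma fibre_valP k (z : set_type (map_fibre (@rng (fibre HF)) (src k))) :
  src k = rng (\val (\val z)).
Proof. exact: esym (set_valP z). Qed.

(** Left translation by k, a homeomorphism of the range fibre of G at s(k) onto the fibre of (F, r)
    through k; [ltransV] is its inverse. *)
Definition ltrans k (z : set_type (map_fibre (@rng (fibre HF)) (src k))) :
    set_type (map_fibre p (p k)) :=
  subp (arr_rng_mul (fibre_valP z) :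
    map_fibre p (p k) (gmul k (\val (\val z)))).

Lemma fibre_div_rng k (b : set_type (map_fibre p (p k))) :
  map_fibre (@rng (fibre HF)) (src k) (subp (fibre_div (esym (set_valP b)))).
Proof.
have /arr_rngP[_ kb] : p k = p (\val b) := esym (set_valP b).
by rewrite /map_fibre /= /fibre_rng /= rng_mul ?rng_inv ?src_inv.
Qed.

Definition ltransV k (b : set_type (map_fibre p (p k))) :
    set_type (map_fibre (@rng (fibre HF)) (src k)) := subp (fibre_div_rng b).

Lemma ltrans_Cc k (f : set_type (map_fibre p (p k)) -> R) : Cc f ->
  Cc (fun z => f (ltrans z)).
Proof.
have cv (A : topologicalType) (B : set A) := @val_continuous A B.
apply: (@Cc_homeo _ _ _ f (@ltrans k) (@ltransV k)).
- apply: continuous_val_comp; apply: gmul_continuous2.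
  + by move=> ?; exact: cst_continuous.
  + exact: continuous_comp_fun (cv _ _) (cv _ _).
  + by move=> z; exact: fibre_valP.
- do 2 apply: continuous_val_comp; apply: gmul_continuous2.
  + by move=> ?; exact: cst_continuous.
  + exact: cv.
  + move=> b; have /arr_rngP[_ kb] : p k = p (\val b) := esym (set_valP b).
    by rewrite src_inv.
- move=> z; do 2 apply: val_inj; rewrite /= gmulKl//; exact: fibre_valP.
- move=> b; apply: val_inj; rewrite /= gmulVKl//.
  by have /arr_rngP[_ kb] : p k = p (\val b) := esym (set_valP b).
Qed.

Lemma fibre_translate_Cc k (f : garr L -> R) :
  Cc (fun z : set_type (map_fibre p (p k)) => f (\val z)) ->
  Cc (fun z : set_type (map_fibre (@rng (fibre HF)) (src k)) => f (gmul k (\val (\val z)))).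
Proof. exact: ltrans_Cc. Qed.

(* Left invariance of lam makes the choice of the base arrow irrelevant; it is only available
   for quasi-continuous functions on the whole arrow space, so the integrand is extended. *)
Lemma fibre_translate_indep k k' (f : garr L -> R) : p k = p k' ->
  Cc (fun z : set_type (map_fibre p (p k)) => f (\val z)) ->
  family_integral lam (fun g : G1 => f (gmul k (\val g))) (src k) =
  family_integral lam (fun g : G1 => f (gmul k' (\val g))) (src k').
Proof.
move=> kk' /fibre_translate_Cc fC.
have [lhG lcG _ _] := HG.
have [f' f'C f'E] := qc_extend lcG lhG (@fibre_rng_closed (src k)) (@fibre_rng_hausdorff (src k)) fC.
have /arr_rngP[_ rkk'] := kk'.
(* Left translation by gam = k^-1 k' maps the range fibre of G at s(k') to the one at s(k), and k
   gam = k'. *)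
pose gam : garr (fibre HF) := subp (fibre_div kk').
have rgam : rng gam = src k.
  by rewrite /= /fibre_rng /= rng_mul ?rng_inv ?src_inv.
have sgam : src gam = src k'.
  by rewrite /= /fibre_src /= src_mul ?src_inv.
have [_ _ _ inv] := Hlam.
have {inv} inv : family_integral lam (fun g => f' (gmul gam g)) (src gam) =
  family_integral lam f' (rng gam) := inv gam f' f'C.
have -> : family_integral lam (fun g : G1 => f (gmul k (\val g))) (src k) =
    family_integral lam f' (src k).
  apply: family_integral_eq => g gk.
  by have := f'E (@subp _ (map_fibre (@rng (fibre HF)) (src k)) g gk) => /= ->.
rewrite -rgam -inv -sgam; apply: family_integral_eq => g rg.
have rgk : map_fibre (@rng (fibre HF)) (src k) (gmul gam g).
  by rewrite /map_fibre /preimage /= -rgam -[RHS](rng_mul (esym rg)).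
have -> : f' (gmul gam g) = f (gmul k (\val (gmul gam g : G1))) := f'E (subp rgk).
have k'g : src k' = rng (\val g) by rewrite -sgam; exact: esym rg.
have -> : \val (gmul gam g : G1) = gmul (gmul (ginv k) k') (\val g).
  by apply: val_fibre_mul; exact: esym rg.
by rewrite -gmulA ?src_inv// gmulVKl// rng_mul.
Qed.

(** The functional is built from one arrow k over y, which also serves as base point of the measure;
    [fibre_translate_indep] gives the formula for all other arrows over y. *)
Lemma induced_family_exists (y : Y) : exists m : radon_measure R (set_type (map_fibre p y)),
  forall k (f : garr L -> R), p k = y -> Cc (fun z : set_type (map_fibre p y) => f (\val z)) ->
  radon_integral m (fun z => f (\val z)) =
  family_integral lam (fun g : G1 => f (gmul k (\val g))) (src k).
Proof.
have [k ky] := arr_rng_surj HF y; subst y.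
have hX := iffRL (hausdorff_onP _) (@arr_fibre_hausdorff (p k)).
have lX := lhlc_closed (@arr_fibre_closed (p k)) lcL.
pose Lam f := radon_integral (lam (src k)) (fun z => f (@ltrans k z)).
have LamD f g : Cc f -> Cc g -> Lam (fun x => f x + g x) = Lam f + Lam g.
  by move=> fC gC; apply: radon_integralD; exact: ltrans_Cc.
have LamZ c f : Cc f -> Lam (fun x => c * f x) = c * Lam f.
  by move=> fC; apply: radon_integralZ; exact: ltrans_Cc.
have Lam_ge0 f : Cc f -> (forall x, 0 <= f x) -> 0 <= Lam f.
  by move=> fC f0; apply: radon_integral_ge0.
exists (riesz_radon hX lX LamD LamZ Lam_ge0 (subp (erefl : map_fibre p (p k) k))).
move=> k' f k'k fC; rewrite riesz_radonE//.
by rewrite -(@fibre_translate_indep k k' f).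
Qed.

Lemma induced_family : exists lamdot : measure_family R p,
  forall k (f : garr L -> R), Cc (fun z : set_type (map_fibre p (p k)) => f (\val z)) ->
  family_integral lamdot f (p k) =
  family_integral lam (fun g : G1 => f (gmul k (\val g))) (src k).
Proof.
exists (fun y => projT1 (cid (induced_family_exists y))) => k f fC.
by rewrite /family_integral; case: cid => m /= /(_ k f erefl fC) ->.
Qed.

Lemma fibre_restrict_Cc (f : garr L -> R) (y : Y) : quasi_continuous f ->
  Cc (fun z : set_type (map_fibre p y) => f (\val z)).
Proof. by apply: qc_restrict; [exact: arr_fibre_closed|exact: arr_fibre_hausdorff]. Qed.

(** A hereditary smallness condition, as required by [qc_ind]. It provides one compact set C in a
    Hausdorff chart that contains every g with k and kg in U. *)
Definition division_bounded (U : set (garr L)) := exists W C : set G1,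
  [/\ open W, hausdorff_on W, compact C, C `<=` W & forall a b (g : G1), U a -> U b ->
    p a = p b -> \val g = gmul (ginv a) b -> C g].

Lemma division_bounded_nbhs l : exists N : set (garr L),
  [/\ open N, N l & division_bounded N].
Proof.
have [lhG lcG _ _] := HG.
have [W [oW Wl hW]] := iffLR locally_hausdorffP lhG (fibre_one F (src l)).
have [C [nC CW cC _]] := iffLR lh_locally_compactP lcG _ _ (open_nbhs_nbhs (conj oW Wl)).
have [N [oN Nl NC]] := small_nbhs nC.
by exists N; split => //; exists W, C.
Qed.

Lemma division_boundedS (A B : set (garr L)) : A `<=` B -> division_bounded B ->
  division_bounded A.
Proof.
move=> AB [W [C [oW hW cC CW BC]]]; exists W, C; split => // a b g /AB Ba /AB Bb.
exact: BC.
Qed.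

(** Each s in S is kept away from kg for (g, k) near (g0, k0). If s and k0 have different images
    under (F, r), these are separated in V. Otherwise s = k0 h with h in W and h different from g0,
    and h and g0 are separated in W. Compactness of S makes the neighbourhoods uniform. *)
Lemma translate_off_compact (V : set Y) (W : set G1) U S k0 (g0 : G1) :
  hausdorff_on V -> hausdorff_on W -> open U -> U `<=` p @^-1` V -> open W ->
  (forall k, U k -> forall g : G1, rng (\val g) = src k -> U (gmul k (\val g)) -> W g) ->
  compact S -> S `<=` U -> U k0 -> W g0 -> src k0 = rng (\val g0) ->
  ~ U (gmul k0 (\val g0)) ->
  exists A B, [/\ nbhs g0 A, nbhs k0 B & forall (g : G1) k, A g -> B k ->
    src k = rng (\val g) -> ~ S (gmul k (\val g))].
Proof.
move=> hV hW oU UV oW UW cS SU Uk0 Wg0 kg0 nUkg.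
have nU a : U a -> nbhs a U by move=> Ua; exact: open_nbhs_nbhs.
pose P (i : G1 * garr L) s := src i.2 = rng (\val i.1) -> gmul i.2 (\val i.1) <> s.
have [s Ss|[A B] [/= nA nB] AB] :=
    iffLR (compact_near_coveringP S) cS _ (filter_prod (nbhs g0) (nbhs k0)) P _; last first.
  by exists A, B; split => // g k Ag Bk kg Skg; exact: (AB (g, k) _ _ Skg kg).
have Us := SU _ Ss.
have [pks|pks] := pselect (p k0 = p s); last first.
  have [P1 [P2 [oP1 oP2 P1k P2s P12]]] := hV _ _ (UV _ Uk0) (UV _ Us) pks.
  exists (U `&` p @^-1` P2, [set i | (U `&` p @^-1` P1) i.2]).
    split => /=.
      by apply: filterI; [exact: nU|apply: arr_rng_continuous; exact: open_nbhs_nbhs].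
    exists (setT, U `&` p @^-1` P1) => [|i []//]; split; first exact: filterT.
    by apply: filterI; [exact: nU|apply: arr_rng_continuous; exact: open_nbhs_nbhs].
  move=> [s' [g k]] [/= [Us' P2s'] [Uk P1k']] kg /= kgs.
  apply: (P12 (p s')) => //; first exact: UV.
  by rewrite -kgs arr_rng_mul.
have /arr_rngP[_ rks] := pks.
pose h : G1 := subp (fibre_div pks).
have hg : h <> g0.
  by move=> e; apply: nUkg; rewrite -e /= gmulVKl.
have Wh : W h.
  by apply: (UW _ Uk0); rewrite /= ?gmulVKl// rng_mul ?rng_inv ?src_inv.
have [_ [Q [[P1 oP1 <-] oQ /= P1h Qg P1Q]]] := hW _ _ Wh Wg0 hg.
have nP1 : nbhs (gmul (ginv k0) s) P1 by exact: open_nbhs_nbhs.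
have [A [B [nA nB AB]]] := gdiv_nbhs rks nP1.
exists (B `&` U, [set i | Q i.1 /\ (A `&` U) i.2]).
  split => /=; first by apply: filterI => //; exact: nU.
  exists (Q, A `&` U) => //; split; first exact: open_nbhs_nbhs.
  by apply: filterI => //; exact: nU.
move=> [s' [g k]] [/= [Bs' Us'] [Qg' [Ak Uk]]] kg /= kgs.
have kg' : src k = rng (\val g) := kg.
apply: (P1Q g) => //.
  by apply: (UW k Uk) => //; rewrite kgs.
have gE : \val g = gmul (ginv k) s' by rewrite -kgs; exact: esym (gmulKl kg').
suff : P1 (\val g) by [].
by rewrite gE; apply: AB => //; rewrite -kgs; exact: esym (rng_mul kg').
Qed.

(** * Continuity of the induced family *)

Section Continuity.
Variable lamdot : measure_family R p.
Hypothesis lamdotE : forall k (f : garr L -> R),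
  Cc (fun z : set_type (map_fibre p (p k)) => f (\val z)) ->
  family_integral lamdot f (p k) =
  family_integral lam (fun g : G1 => f (gmul k (\val g))) (src k).

(** The family [lam] is pulled back along the source map, with integrand f(kg). For k in U a nonzero
    value forces kg in U, so g lies in the compact C of [division_bounded]. *)
Lemma translate_integral_continuous (V : set Y) U (f : garr L -> R) k0 :
  open V -> hausdorff_on V -> open U -> hausdorff_on U -> U `<=` p @^-1` V ->
  division_bounded U -> elementary U f -> U k0 ->
  {for k0, continuous (fun k => family_integral lam (fun g : G1 => f (gmul k (\val g))) (src k))}.
Proof.
move=> oV hV oU hU UV [W [C [oW hW cC CW UC]]] fU Uk0.
have fC := elementary_qc oU hU fU.
have [lhG lcG _ _] := HG; have [_ clam _ _] := Hlam.
have [cf [S cS [SU S0]]] := fU.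
have nU a : U a -> nbhs a U by move=> Ua; exact: open_nbhs_nbhs.
have UC' k (g : G1) : U k -> rng (\val g) = src k -> U (gmul k (\val g)) -> C g.
  move=> Uk gk Ukg; apply: (UC k _ g Uk Ukg); first by rewrite arr_rng_mul.
  by rewrite gmulKl.
apply: (@pullback_continuous R (garr (fibre HF)) (gobj L) (@rng (fibre HF)) lam hL0
   (garr L) (@src L) (fun g k => f (gmul k (\val (g : G1)))) W C k0) => //.
- exact: rng_continuous.
- exact: fibre_rng_hausdorff.
- exact: src_continuous.
- apply: filterS (nU _ Uk0) => k Uk g gk nCg; apply: S0 => /SU Ukg.
  by apply: nCg; exact: UC' Ukg.
- move=> g e Cg gk0 e0.
  have gk0' : src k0 = rng (\val (g : G1)) := esym gk0.
  have [Ukg|nUkg] := pselect (U (gmul k0 (\val (g : G1)))).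
    have nfe : nbhs (gmul k0 (\val (g : G1))) [set b | `|f b - f (gmul k0 (\val (g : G1)))| < e].
      have /cvgrPdist_lt/(_ e e0) := cf _ Ukg.
      by apply: filterS => b; rewrite distrC.
    have [A [B [nA nB AB]]] := gmul_nbhs gk0' nfe.
    exists (\val @^-1` B, A); first by split => //; exact: (nbhs_val (z := (g : G1))).
    by move=> [g' k] [/= Bg' Ak] gk; exact: AB.
  (* The product is outside U and the integrand is 0 there. Nearby products may return to U, but not
     to the support S. *)
  rewrite S0; last by move=> /SU.
  have gW : forall k, U k -> forall g' : G1, rng (\val g') = src k ->
    U (gmul k (\val g')) -> W g' by move=> k Uk g' gk Ukg; apply: CW; exact: UC' Ukg.
  have [A [B [nA nB AB]]] :=
    translate_off_compact hV hW oU UV oW gW cS SU Uk0 (CW _ Cg) gk0' nUkg.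
  exists (A, B) => // -[g' k] [/= Ag' Bk] gk.
  by rewrite S0 ?subr0 ?normr0//; apply: AB => //; exact: esym gk.
- by apply: nearW => k; apply: fibre_translate_Cc; exact: fibre_restrict_Cc.
Qed.

(** A point of V outside the compact image of S has a neighbourhood in V missing it, because V is
    Hausdorff, and the integral vanishes there. Over the image of S, continuity comes from the
    translated integrals. *)
Lemma induced_integral_elementary (V : set Y) U (f : garr L -> R) :
  open V -> hausdorff_on V -> open U -> hausdorff_on U -> U `<=` p @^-1` V ->
  division_bounded U -> elementary U f ->
  exists2 S, compact S & [/\ S `<=` U, forall l, ~ S l -> f l = 0,
    forall y, ~ (p @` S) y -> family_integral lamdot f y = 0 &
    forall y, V y -> {for y, continuous (family_integral lamdot f)}].
Proof.
move=> oV hV oU hU UV dU fU; have fC := elementary_qc oU hU fU.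
have [_ [S cS [SU S0]]] := fU.
have off y : ~ (p @` S) y -> family_integral lamdot f y = 0.
  by move=> nSy; apply: family_integral_off => l ly; apply: S0 => Sl; apply: nSy; exists l.
exists S => //; split => // y Vy.
have [[k0 Sk0 ky]|nSy] := pselect ((p @` S) y); last first.
  have cpS : compact (p @` S).
    apply: continuous_compact => //; apply: continuous_subspaceT.
    exact: arr_rng_continuous.
  have pSV : p @` S `<=` V by move=> _ [l /SU/UV ? <-].
  have [P [oP Py] PS] := hausdorff_compact_sep hV pSV cpS Vy nSy.
  apply: near0_continuous.
  have : nbhs y (V `&` P) by apply: open_nbhs_nbhs; split; [exact: openI|].
  by apply: filterS => z [Vz Pz]; apply: off; exact: PS.
have lE k : family_integral lamdot f (p k) =
    family_integral lam (fun g : G1 => f (gmul k (\val g))) (src k).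
  by apply: lamdotE; exact: fibre_restrict_Cc.
have cpsi := translate_integral_continuous oV hV oU hU UV dU fU (SU _ Sk0).
(* Images of neighbourhoods of k0 are neighbourhoods of y, as (F, r) is open; so continuity in k
   descends to the base. *)
rewrite -ky => P; rewrite /continuous_at in cpsi; rewrite lE => /cpsi.
move=> /(arr_rng_nbhs HF); apply: filterS => _ [k Pk <-].
by rewrite /= lE.
Qed.

Lemma induced_integral_Cc (V : set Y) U (f : garr L -> R) :
  open V -> hausdorff_on V -> open U -> hausdorff_on U -> U `<=` p @^-1` V ->
  division_bounded U -> elementary U f -> elementary V (family_integral lamdot f).
Proof.
move=> oV hV oU hU UV dU fU.
have [S cS [SU S0 off cV]] := induced_integral_elementary oV hV oU hU UV dU fU.
split => //; exists (p @` S).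
  by apply: continuous_compact => //; apply: continuous_subspaceT; exact: arr_rng_continuous.
by split => // _ [l /SU/UV ? <-].
Qed.

Lemma family_integralD_qc (f g : garr L -> R) y : quasi_continuous f -> quasi_continuous g ->
  family_integral lamdot (fun l => f l + g l) y =
  family_integral lamdot f y + family_integral lamdot g y.
Proof. by move=> fC gC; apply: radon_integralD; exact: fibre_restrict_Cc. Qed.

Lemma induced_family_continuous : continuous_family lamdot.
Proof.
move=> V oV /hausdorff_onP hV f.
have oA : open (p @^-1` V) by apply: open_comp => // ? _; exact: arr_rng_continuous.
(* Nothing is known about f away from the preimage of V. Its restriction extended by 0 has the same
   integrals over V and can be treated on all of L. *)
move=> fC; pose f' := valL_ 0 (fun z : set_type (p @^-1` V) => f (\val z)).
have -> : (fun y : set_type V => family_integral lamdot f (\val y)) =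
    (fun y => family_integral lamdot f' (\val y)).
  apply/funext => y; apply: family_integral_eq => l ly.
  have Vl : (p @^-1` V) l by rewrite /preimage /= ly; exact: set_valP.
  by rewrite /f' -[l in RHS]/(\val (subp Vl)) valL_val.
suff [] : quasi_continuous f' /\ Cc (fun y : set_type V => family_integral lamdot f' (\val y)) by [].
move: fC; rewrite /f'; move: (fun z : set_type _ => _).
apply: (@qc_open_ind R (garr L) (fun F => quasi_continuous F /\
  Cc (fun y : set_type V => family_integral lamdot F (\val y))) division_bounded); first exact: oA.
- exact: lcL.
- exact: division_bounded_nbhs.
- exact: division_boundedS.
- split; first exact: quasi_continuous0.
  under eq_fun do rewrite family_integral_off//.
  exact: Cc0.
- move=> h g [hC hI] [gC gI]; split; first exact: quasi_continuousD.
  under eq_fun do rewrite family_integralD_qc//.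
  exact: CcD.
- move=> U h oU UV hU dU hE; split; first exact: elementary_qc hE.
  apply: (CcOn_Cc (U := setT)); first exact/hausdorff_onP.
  by apply: elementary_val => //; exact: induced_integral_Cc hE.
Qed.

End Continuity.

End InducedFamily.

(** * The induced Haar system *)

Section IteratedFamily.
Context {R : realType} {L H : topGroupoid} {F : groupoid_functor L H}.
Variable HF : is_fibration F.
Hypothesis HG : lhlc_groupoid (fibre HF).
Hypothesis HH : lhlc_groupoid H.
Variable lam : measure_family R (@rng (fibre HF)).
Hypothesis Hlam : haar_system lam.
Variable mu : measure_family R (@rng H).
Hypothesis Hmu : haar_system mu.

Local Notation p := (arr_rng F).
Local Notation Y := (set_type (rng_pullback F)).
Local Notation G1 := (set_type (fibre_arr F)).

Variable lamdot : measure_family R p.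
Hypothesis lamdotE : forall k (f : garr L -> R),
  Cc (fun z : set_type (map_fibre p (p k)) => f (\val z)) ->
  family_integral lamdot f (p k) =
  family_integral lam (fun g : G1 => f (gmul k (\val g))) (src k).

Let hL0 : hausdorff_space (gobj L).
Proof. by case: HG. Qed.

Let hH0 : hausdorff_space (gobj H).
Proof. by case: HH. Qed.

Let lhL : locally_hausdorff (garr L).
Proof. exact: total_locally_hausdorff HG HH. Qed.

Let lcL : lh_locally_compact (garr L).
Proof. exact: total_lhlc HG HH. Qed.

Let lhH : locally_hausdorff (garr H).
Proof. by case: HH. Qed.

Let lcH : lh_locally_compact (garr H).
Proof. by case: HH. Qed.

Lemma arr_fibre_rng (l : garr L) (y : Y) : p l = y -> rng l = (\val y).2.
Proof. by move=> <-. Qed.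

Local Notation Lx x := (set_type (map_fibre (@rng L) x)).

Lemma rng_restrict_Cc (f : garr L -> R) x : quasi_continuous f ->
  Cc (fun z : Lx x => f (\val z)).
Proof. by apply: qc_restrict; [exact: rng_fibre_closed|exact: rng_fibre_hausdorff]. Qed.

Lemma rng_fibre_extend (f : garr L -> R) x : Cc (fun z : Lx x => f (\val z)) ->
  exists2 f', quasi_continuous f' & forall l, rng l = x -> f' l = f l.
Proof.
move=> /(qc_extend lcL lhL (rng_fibre_closed hL0) (rng_fibre_hausdorff lhL hL0))[f' fC fE].
by exists f' => // l lx; exact: (fE (@subp _ (map_fibre (@rng L) x) l lx)).
Qed.

Lemma rng_fibre_sub_Cc (f : garr L -> R) (y : Y) : Cc (fun z : Lx (\val y).2 => f (\val z)) ->
  Cc (fun z : set_type (map_fibre p y) => f (\val z)).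
Proof.
move=> /rng_fibre_extend[f' fC fE].
have -> : (fun z : set_type (map_fibre p y) => f (\val z)) = (fun z => f' (\val z)).
  by apply/funext => z; rewrite fE//; exact: arr_fibre_rng (set_valP z).
exact: fibre_restrict_Cc.
Qed.

(** The second clause puts the image of U under (F, r) into a Hausdorff open part of the pull-back:
    over a Hausdorff chart of H the pull-back is Hausdorff, because L^0 is. *)
Definition graph_bounded (U : set (garr L)) := @division_bounded L H F U /\
  exists W, [/\ open W, hausdorff_on W & farr F @` U `<=` W].

Lemma graph_bounded_nbhs l : exists N, [/\ open N, N l & graph_bounded N].
Proof.
have [N [oN Nl dN]] := division_bounded_nbhs HG l.
have [W [oW Wl hW]] := iffLR locally_hausdorffP lhH (farr F l).
exists (N `&` farr F @^-1` W); split => //.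
- by apply: openI => //; apply: open_comp => // ? _; exact: farr_continuous.
- split; first by apply: division_boundedS dN => ? [].
  by exists W; split => // _ [a [_ Wa] <-].
Qed.

Lemma graph_boundedS (A B : set (garr L)) : A `<=` B -> graph_bounded B -> graph_bounded A.
Proof.
move=> AB [dB [W [oW hW BW]]]; split; first exact: division_boundedS dB.
by exists W; split => // _ [a Aa <-]; apply: BW; exists a => //; exact: AB.
Qed.

Lemma graph_elementary (U : set (garr L)) (f : garr L -> R) : open U -> hausdorff_on U ->
  graph_bounded U -> elementary U f -> exists S W,
  [/\ compact S, S `<=` U, forall l, ~ S l -> f l = 0, open W & hausdorff_on W] /\
  [/\ farr F @` S `<=` W, forall y, ~ (p @` S) y -> family_integral lamdot f y = 0 &
    forall y : Y, W (\val y).1 -> {for y, continuous (family_integral lamdot f)}].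
Proof.
move=> oU hU [dU [W [oW hW UW]]] fU.
pose V := [set y : Y | W (\val y).1].
have oY1 N : open N -> open [set y : Y | N (\val y).1].
  move=> oN; apply: (@open_comp _ _ (fun y : Y => (\val y).1)) => // y _.
  apply: (continuous_comp_fun (@val_continuous _ _)) => ?; exact: cvg_fst.
have oY2 N : open N -> open [set y : Y | N (\val y).2].
  move=> oN; apply: (@open_comp _ _ (fun y : Y => (\val y).2)) => // y _.
  apply: (continuous_comp_fun (@val_continuous _ _)) => ?; exact: cvg_snd.
have oV : open V by exact: oY1.
have hV : hausdorff_on V.
  move=> [[h x] e] [[h' x'] e'] /= Wh Wh' ne.
  have [hh|hh] := pselect (h = h').
    have [|N [N' [oN oN' Nx N'x NN']]] := iffLR hausdorff_onT hL0 x x' I I.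
      by move=> xx; apply: ne; apply: val_inj; rewrite /= hh xx.
    exists [set y : Y | N (\val y).2], [set y : Y | N' (\val y).2].
    by split; [exact: oY2|exact: oY2|by []|by []|move=> y _; exact: NN'].
  have [N [N' [oN oN' Nx N'x NN']]] := hW _ _ Wh Wh' hh.
  exists [set y : Y | N (\val y).1], [set y : Y | N' (\val y).1].
  by split; [exact: oY1|exact: oY1|by []|by []|move=> y; exact: NN'].
have UV : U `<=` p @^-1` V by move=> l Ul; apply: UW; exists l.
have [S cS [SU S0 off cV]] := induced_integral_elementary HG HH Hlam lamdotE oV hV oU hU UV dU fU.
by exists S, W; split; split => // _ [l /SU Ul <-]; apply: UW; exists l.
Qed.

Lemma rng_pair_continuous x : continuous (@rng_pair L H F x).
Proof.
apply: continuous_val_comp; apply: continuous_pair; first exact: val_continuous.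
by move=> ?; exact: cst_continuous.
Qed.

(** For an elementary f with support S, the inner integral vanishes off the image under F of the
    arrows of S with range x. This compact set is closed in the range fibre of H, which is
    Hausdorff, and around it the integral is continuous. *)
Lemma inner_Cc (f : garr L -> R) x : quasi_continuous f ->
  Cc (fun h => family_integral lamdot f (@rng_pair L H F x h)).
Proof.
move=> fC; suff [] : quasi_continuous f /\
  Cc (fun h => family_integral lamdot f (@rng_pair L H F x h)) by [].
have hX := rng_fibre_hausdorff (x := fobj F x) lhH hH0.
move: f fC; apply: (@qc_ind R (garr L) (fun f => quasi_continuous f /\
  Cc (fun h => family_integral lamdot f (@rng_pair L H F x h))) graph_bounded).
- exact: lcL.
- exact: graph_bounded_nbhs.
- exact: graph_boundedS.
- split; first exact: quasi_continuous0.
  under eq_fun do rewrite family_integral_off//.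
  exact: Cc0.
- move=> f g [fC fI] [gC gI]; split; first exact: quasi_continuousD.
  under eq_fun do rewrite family_integralD_qc//.
  exact: CcD.
- move=> U f oU hU gU fU; split; first exact: elementary_qc fU.
  have [S [W [[cS SU S0 oW hW] [SW off cI]]]] := graph_elementary oU hU gU fU.
  set X := set_type (map_fibre (@rng H) (fobj F x)).
  pose K : set X := \val @^-1` (farr F @` (S `&` map_fibre (@rng L) x)).
  have cK : compact K.
    apply: compact_preval; first by move=> _ [l [_ <-] <-]; exact: rng_farr.
    apply: continuous_compact.
      by apply: continuous_subspaceT; exact: farr_continuous.
    by apply: compact_closedI => //; exact: rng_fibre_closed.
  have clK : closed K by apply: compact_closed => //; exact/hausdorff_onP.
  have K0 (h : X) : ~ K h -> family_integral lamdot f (rng_pair h) = 0.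
    move=> nKh; apply: off => -[l Sl lh]; apply: nKh; exists l.
      by split => //; exact: (arr_fibre_rng lh).
    by have /(congr1 (fun y : Y => (\val y).1)) := lh.
  apply: (Cc_closed (K := K)) => // h; have [Kh|nKh] := pselect (K h).
    apply: (@continuous_comp _ _ _ (@rng_pair L H F x)).
      exact: rng_pair_continuous.
    have Wh : W (\val (rng_pair h)).1 by apply: SW; case: Kh => l [Sl _] lh; exists l.
    exact: cI Wh.
  apply: near0_continuous.
  have : nbhs h (~` K) by apply: open_nbhs_nbhs; split => //; exact: closed_openC.
  by apply: filterS => h' /K0.
Qed.

Definition iterated (f : garr L -> R) x : R :=
  radon_integral (mu (fobj F x)) (fun h => family_integral lamdot f (rng_pair h)).

Lemma iterated_eq (f g : garr L -> R) x : (forall l, rng l = x -> f l = g l) ->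
  iterated f x = iterated g x.
Proof.
move=> fg; congr radon_integral; apply/funext => h.
apply: family_integral_eq => l lh; apply: fg.
by have /(congr1 (fun y : Y => (\val y).2)) := lh.
Qed.

Lemma inner_fibre_Cc (f : garr L -> R) x : Cc (fun z : Lx x => f (\val z)) ->
  Cc (fun h => family_integral lamdot f (@rng_pair L H F x h)).
Proof.
move=> /rng_fibre_extend[f' fC fE].
have -> : (fun h => family_integral lamdot f (@rng_pair L H F x h)) =
    (fun h => family_integral lamdot f' (rng_pair h)).
  apply/funext => h; apply: family_integral_eq => l lh; rewrite fE//.
  by have /(congr1 (fun y : Y => (\val y).2)) := lh.
exact: inner_Cc.
Qed.

(** The Riesz theorem on the range fibre at x. The default 0 in [valL_ 0 g] is never sampled,
    because the fibre of (F, r) over (h, x) consists of arrows with range x. Linearity needs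
    integrability at both levels of the iterated integral. *)
Lemma iterated_family_exists x : exists m : radon_measure R (Lx x),
  forall f : garr L -> R, Cc (fun z : Lx x => f (\val z)) ->
  radon_integral m (fun z => f (\val z)) = iterated f x.
Proof.
have hX := iffRL (hausdorff_onP _) (rng_fibre_hausdorff (x := x) lhL hL0).
have lX := lhlc_closed (rng_fibre_closed (x := x) hL0) lcL.
pose Lam (g : Lx x -> R) := iterated (valL_ 0 g) x.
have ext (g : Lx x -> R) : Cc g -> Cc (fun z : Lx x => valL_ 0 g (\val z)).
  by under [X in _ -> Cc X]eq_fun do rewrite valL_val.
have LamD f g : Cc f -> Cc g -> Lam (fun x => f x + g x) = Lam f + Lam g.
  move=> /ext fC /ext gC.
  rewrite -radon_integralD; [|exact: inner_fibre_Cc..].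
  congr radon_integral; apply/funext => h.
  rewrite -radon_integralD; [|exact: rng_fibre_sub_Cc..].
  congr radon_integral; apply/funext => l.
  have lx : map_fibre (@rng L) x (\val l).
    by have /(congr1 (fun y : Y => (\val y).2)) := set_valP l.
  by rewrite -[\val l]/(\val (subp lx)) !valL_val.
have LamZ c f : Cc f -> Lam (fun x => c * f x) = c * Lam f.
  move=> /ext fC.
  rewrite -radon_integralZ; [|exact: inner_fibre_Cc..].
  congr radon_integral; apply/funext => h.
  rewrite -radon_integralZ; [|exact: rng_fibre_sub_Cc..].
  congr radon_integral; apply/funext => l.
  have lx : map_fibre (@rng L) x (\val l).
    by have /(congr1 (fun y : Y => (\val y).2)) := set_valP l.
  by rewrite -[\val l]/(\val (subp lx)) !valL_val.
have Lam_ge0 f : Cc f -> (forall x, 0 <= f x) -> 0 <= Lam f.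
  move=> /ext fC f0; apply: radon_integral_ge0 => h; apply: radon_integral_ge0 => l.
  have [lx|nlx] := pselect (map_fibre (@rng L) x (\val l)); last by rewrite valL_out.
  by rewrite -[\val l]/(\val (subp lx)) valL_val.
pose x0 := @subp _ (map_fibre (@rng L) x) _ (rng_one x).
exists (riesz_radon hX lX LamD LamZ Lam_ge0 x0) => f fC.
apply: etrans (@riesz_radonE _ _ hX lX Lam LamD LamZ Lam_ge0 x0 _ fC) _.
apply: iterated_eq => l lx.
by rewrite -[l]/(\val (@subp _ (map_fibre (@rng L) x) _ lx)) valL_val.
Qed.

Lemma iterated_family : exists nu : measure_family R (@rng L),
  forall x (f : garr L -> R), Cc (fun z : Lx x => f (\val z)) ->
  family_integral nu f x = iterated f x.
Proof.
exists (fun x => projT1 (cid (iterated_family_exists x))) => x f fC.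
by rewrite /family_integral; case: cid => m /= /(_ f fC) ->.
Qed.

(** Full support is used twice: the inner integral is positive at h = F(z) because its integrand
    f(zg) takes the value f(z) at the unit g at s(z), and then the outer integral is positive. *)
Lemma iterated_gt0 (f : garr L -> R) z x : rng z = x -> Cc (fun l : Lx x => f (\val l)) ->
  (forall l, rng l = x -> 0 <= f l) -> 0 < f z -> 0 < iterated f x.
Proof.
move=> <- fC f0 fz; have [_ _ slam _] := Hlam; have [_ _ smu _] := Hmu.
have zh : map_fibre (@rng H) (fobj F (rng z)) (farr F z) by exact: rng_farr.
have f0' (y : Y) : (\val y).2 = rng z -> forall l : set_type (map_fibre p y), 0 <= f (\val l).
  move=> yz l; apply: f0; rewrite -yz.
  by have /(congr1 (fun y : Y => (\val y).2)) := set_valP l.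
apply: (@radon_integral_gt0 _ _ _ _ (subp zh)) => //.
- exact: smu.
- exact: inner_fibre_Cc.
- by move=> h; apply: radon_integral_ge0; exact: f0'.
have -> : rng_pair (subp zh) = p z by exact: val_inj.
have fzC : Cc (fun l : set_type (map_fibre p (p z)) => f (\val l)).
  exact: rng_fibre_sub_Cc.
rewrite lamdotE//.
have uz : map_fibre (@rng (fibre HF)) (src z) (fibre_one F (src z)) by exact: rng_one.
apply: (@radon_integral_gt0 _ _ _ _ (subp uz)) => //.
- exact: slam.
- exact: (@fibre_translate_Cc R L H F HF z f fzC).
- by move=> g; apply: f0; rewrite rng_mul//; exact: fibre_valP.
- by rewrite /= gmul1r.
Qed.

Lemma rng_mulV k (l : Lx (rng k)) : map_fibre (@rng L) (src k) (gmul (ginv k) (\val l)).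
Proof.
by rewrite /map_fibre /= rng_mul ?rng_inv// src_inv; exact: esym (set_valP l).
Qed.

(** Only the restriction of l |-> f(kl) to the range fibre at s(k) is meaningful, since products of
    non-composable pairs are unconstrained. That fibre is carried homeomorphically to the one at
    r(k). *)
Lemma translate_Cc k (f : garr L -> R) : quasi_continuous f ->
  Cc (fun z : Lx (src k) => f (gmul k (\val z))).
Proof.
move=> /(@rng_restrict_Cc f (rng k)) fC.
have sz (z : Lx (src k)) : src k = rng (\val z) := esym (set_valP z).
have rz (z : Lx (rng k)) : rng k = rng (\val z) := esym (set_valP z).
pose a (z : Lx (src k)) : Lx (rng k) :=
  subp (rng_mul (sz z) : map_fibre (@rng L) (rng k) (gmul k (\val z))).
pose b (z : Lx (rng k)) : Lx (src k) := subp (rng_mulV z).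
have cv (A : topologicalType) (B : set A) := @val_continuous A B.
apply: (@Cc_homeo _ _ _ _ a b _ _ _ _ fC).
- apply: continuous_val_comp; apply: gmul_continuous2 => //; first by move=> ?; exact: cst_continuous.
  exact: cv.
- apply: continuous_val_comp; apply: gmul_continuous2; first by move=> ?; exact: cst_continuous.
    exact: cv.
  by move=> z; rewrite src_inv.
- by move=> z; apply: val_inj; rewrite /= gmulKl//; exact: sz.
- by move=> z; apply: val_inj; rewrite /= gmulVKl//; exact: rz.
Qed.

(** For l over (h, s(k)), the arrow kl lies over (F(k)h, r(k)), so the inner integral of f(k -) at
    the former point is that of f at the latter. Invariance of [mu] under F(k) then applies to a
    quasi-continuous extension J of the inner integral. *)
Lemma iterated_translate k (f : garr L -> R) : quasi_continuous f ->
  iterated (fun l => f (gmul k l)) (src k) = iterated f (rng k).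
Proof.
move=> fC; have [_ _ _ inv] := Hmu.
have iC := @inner_Cc f (rng k) fC.
have [J JC JE] := qc_extend lcH lhH (rng_fibre_closed (x := fobj F (rng k)) hH0)
  (rng_fibre_hausdorff (x := fobj F (rng k)) lhH hH0) iC.
have {}inv : family_integral mu (fun h => J (gmul (farr F k) h)) (src (farr F k)) =
  family_integral mu J (rng (farr F k)) := inv (farr F k) J JC.
have -> : iterated f (rng k) = family_integral mu J (fobj F (rng k)).
  by congr radon_integral; apply/funext => h; rewrite JE.
rewrite -rng_farr -inv src_farr; congr radon_integral; apply/funext => h.
have [l lh] := arr_rng_surj HF (rng_pair h).
have Fl : farr F l = \val h by have /(congr1 (fun y : Y => (\val y).1)) := lh.
have kl : src k = rng l by have /(congr1 (fun y : Y => (\val y).2)) := lh.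
have kh : map_fibre (@rng H) (fobj F (rng k)) (gmul (farr F k) (\val h)).
  by rewrite -Fl -farr_mul// /map_fibre /= rng_farr rng_mul.
rewrite (JE (subp kh) : J (gmul (farr F k) (\val h)) = _).
have -> : rng_pair (subp kh) = p (gmul k l).
  by apply: val_inj; rewrite /= farr_mul// Fl rng_mul.
rewrite -lh !lamdotE; last 2 first.
- exact: fibre_restrict_Cc.
- have := @translate_Cc k f fC; rewrite kl => tC.
  exact: (@rng_fibre_sub_Cc (fun l => f (gmul k l)) (p l) tC).
rewrite src_mul//; apply: family_integral_eq => g gl.
by rewrite gmulA//; exact: esym gl.
Qed.

(** The inner integral made total on pairs (h, x), as the integrand of [pullback_continuous]
    requires; the value 0 off the pull-back is never integrated. *)
Definition inner (f : garr L -> R) (x : gobj L) (h : garr H) : R :=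
  if pselect (rng h = fobj F x) is left e
  then family_integral lamdot f (@subp _ (rng_pullback F) (h, x) e) else 0.

Lemma innerE f x (h : garr H) (e : rng_pullback F (h, x)) :
  inner f x h = family_integral lamdot f (subp e).
Proof.
by rewrite /inner; case: pselect => // e'; congr family_integral; exact: val_inj.
Qed.

Lemma inner_rng_pair f x (h : set_type (map_fibre (@rng H) (fobj F x))) :
  inner f x (\val h) = family_integral lamdot f (rng_pair h).
Proof. rewrite (innerE _ (set_valP h : rng_pullback F (\val h, x))).
by congr family_integral; exact: val_inj. Qed.

(** The family [mu] is pulled back along the object map of F. The inner integral vanishes off the
    compact image of S in H, which lies in a Hausdorff chart W. *)
Lemma iterated_continuous (U : set (garr L)) (f : garr L -> R) :
  open U -> hausdorff_on U -> graph_bounded U -> elementary U f ->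
  continuous (iterated f).
Proof.
move=> oU hU gU fU x0; have fC := elementary_qc oU hU fU.
have [S [W [[cS SU S0 oW hW] [SW off cI]]]] := graph_elementary oU hU gU fU.
have [_ cmu _ _] := Hmu.
have -> : iterated f = (fun x => radon_integral (mu (fobj F x)) (fun h => inner f x (\val h))).
  by apply/funext => x; congr radon_integral; apply/funext => h; rewrite inner_rng_pair.
apply: (@pullback_continuous R (garr H) (gobj H) (@rng H) mu hH0
  (gobj L) (fobj F) (fun h x => inner f x h) W (farr F @` S) x0) => //.
- exact: rng_continuous.
- by move=> y; exact: rng_fibre_hausdorff.
- exact: fobj_continuous.
- by apply: continuous_compact => //; apply: continuous_subspaceT; exact: farr_continuous.
- apply: nearW => x h hx nSh; rewrite (innerE _ hx); apply: off => -[l Sl lh].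
  by apply: nSh; exists l => //; have /(congr1 (fun y : Y => (\val y).1)) := lh.
- move=> h e Sh hx0 e0; rewrite (innerE _ hx0).
  have /cvgrPdist_lt/(_ e e0) := cI (@subp _ (rng_pullback F) (h, x0) hx0) (SW _ Sh).
  move=> /nbhs_valP[N oN [Nh NE]].
  have nN : nbhs (h, x0) N by exact: open_nbhs_nbhs.
  have [[A B] [/= nA nB] AB] := nN.
  exists (A, B) => // -[h' x'] /= [Ah' Bx'] h'x'.
  have N' : N (h', x') by exact: AB.
  by rewrite (innerE _ h'x') distrC; exact: (NE (@subp _ (rng_pullback F) (h', x') h'x')).
- apply: nearW => x; under eq_fun do rewrite inner_rng_pair.
  exact: inner_Cc.
Qed.

Lemma iteratedD_qc (f g : garr L -> R) x : quasi_continuous f -> quasi_continuous g ->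
  iterated (fun l => f l + g l) x = iterated f x + iterated g x.
Proof.
move=> fC gC; rewrite -radon_integralD; [|exact: inner_Cc..].
by congr radon_integral; apply/funext => h; rewrite family_integralD_qc.
Qed.

Lemma iterated_off (f : garr L -> R) x : (forall l, rng l = x -> f l = 0) -> iterated f x = 0.
Proof.
move=> f0; rewrite (iterated_eq (g := fun=> 0))// /iterated.
have -> : (fun h => family_integral lamdot (fun=> 0) (rng_pair h)) =
    (fun h : set_type (map_fibre (@rng H) (fobj F x)) => 0).
  by apply/funext => h; exact: family_integral_off.
exact: radon_integral0.
Qed.

Lemma iterated_open_Cc (V : set (gobj L)) (f : garr L -> R) : open V ->
  quasi_continuous (fun l : set_type (@rng L @^-1` V) => f (\val l)) ->
  Cc (fun x : set_type V => iterated f (\val x)).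
Proof.
move=> oV.
have oA : open (@rng L @^-1` V) by apply: open_comp => // ? _; exact: rng_continuous.
move=> fC; pose f' := valL_ 0 (fun z : set_type (@rng L @^-1` V) => f (\val z)).
have -> : (fun x : set_type V => iterated f (\val x)) = (fun x => iterated f' (\val x)).
  apply/funext => x; apply: iterated_eq => l lx.
  have Vl : (@rng L @^-1` V) l by rewrite /preimage /= lx; exact: set_valP.
  by rewrite /f' -[l in RHS]/(\val (subp Vl)) valL_val.
suff [] : quasi_continuous f' /\ Cc (fun x : set_type V => iterated f' (\val x)) by [].
have hV : hausdorff_space (set_type V).
  by apply/hausdorff_onP; apply: hausdorff_onS (iffLR hausdorff_onT hL0) => ? _.
move: fC; rewrite /f'; move: (fun z : set_type _ => _).
apply: (@qc_open_ind R (garr L) (fun F => quasi_continuous F /\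
  Cc (fun x : set_type V => iterated F (\val x))) graph_bounded); first exact: oA.
- exact: lcL.
- exact: graph_bounded_nbhs.
- exact: graph_boundedS.
- split; first exact: quasi_continuous0.
  under eq_fun do rewrite iterated_off//.
  exact: Cc0.
- move=> g h [gC gI] [hC hI]; split; first exact: quasi_continuousD.
  under eq_fun do rewrite iteratedD_qc//.
  exact: (CcD gI hI).
- move=> U g oU UV hU gU gE; split; first exact: elementary_qc gE.
  have [_ [S cS [SU S0]]] := gE.
  pose K : set (set_type V) := \val @^-1` (@rng L @` S).
  have cK : compact K.
    apply: compact_preval; first by move=> _ [l /SU/UV Vl <-].
    by apply: continuous_compact => //; apply: continuous_subspaceT; exact: rng_continuous.
  apply: (Cc_closed (K := K)) => //.
  + apply: (continuous_comp_fun (@val_continuous _ _)).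
    exact: iterated_continuous gE.
  + exact: compact_closed.
  + move=> x nKx; apply: iterated_off => l lx; apply: S0 => Sl.
    by apply: nKx; exists l.
Qed.

(** Continuity and invariance are those of the iterated integral, with which [nu] agrees whenever
    the restriction to the range fibre is in [Cc]; full support follows from strict positivity by
    [radon_supportT]. *)
Lemma iterated_haar (nu : measure_family R (@rng L)) :
  (forall x (f : garr L -> R), Cc (fun z : Lx x => f (\val z)) ->
    family_integral nu f x = iterated f x) ->
  haar_system nu.
Proof.
move=> nuE; split.
- exact: total_lhlc_groupoid HG HH.
- move=> V oV _ f fC; suff -> : (fun x : set_type V => family_integral nu f (\val x)) =
      (fun x => iterated f (\val x)) by exact: iterated_open_Cc.
  have oA : open (@rng L @^-1` V) by apply: open_comp => // ? _; exact: rng_continuous.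
  have f'C x := @rng_restrict_Cc _ x (quasi_continuous_valL lcL oA fC).
  apply/funext => x; apply: nuE; have := f'C (\val x); congr Cc.
  apply/funext => l; have Vl : (@rng L @^-1` V) (\val l).
    by rewrite /preimage /= (set_valP l : rng (\val l) = \val x); exact: set_valP.
  by rewrite -[\val l in LHS]/(\val (subp Vl)) valL_val.
- move=> x; apply: radon_supportT.
  + by apply/hausdorff_onP; exact: rng_fibre_hausdorff.
  + by apply: lhlc_closed lcL; exact: rng_fibre_closed.
  + move=> f z fC f0 fz; have zx : rng (\val z) = x := set_valP z.
    have fE : (fun z : Lx x => valL_ 0 f (\val z)) = f by apply/funext => l; exact: valL_val.
    have -> : radon_integral (nu x) f = iterated (valL_ 0 f) x.
      by rewrite -nuE ?fE// /family_integral fE.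
    have pos l : rng l = x -> 0 <= valL_ 0 f l.
      move=> lx; rewrite -[l]/(\val (@subp _ (map_fibre (@rng L) x) l lx)) valL_val.
      exact: f0.
    have fz' : 0 < valL_ 0 f (\val z) by rewrite valL_val.
    by apply: (iterated_gt0 zx) => //; rewrite fE.
- move=> k f fC.
  have lE : family_integral nu (fun l => f (gmul k l)) (src k) =
    iterated (fun l => f (gmul k l)) (src k) by apply: nuE; exact: translate_Cc.
  have rE : family_integral nu f (rng k) = iterated f (rng k).
    by apply: nuE; exact: rng_restrict_Cc.
  by rewrite /family_integral in lE rE; rewrite lE rE iterated_translate.
Qed.

End IteratedFamily.

Unset Implicit Arguments.

Theorem theorem5p1 (R : realType) (L H : topGroupoid)
    (F : groupoid_functor L H) (HF : is_fibration F)
    (HG : lhlc_groupoid (fibre HF)) (HH : lhlc_groupoid H)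
    (lam : measure_family R (@rng (fibre HF))) (Hlam : haar_system lam)
    (mu : measure_family R (@rng H)) (Hmu : haar_system mu) :
  exists lamdot : measure_family R (arr_rng F),
    [/\ continuous_family lamdot,
        forall (f : garr L -> R), quasi_continuous f ->
        forall (hx : set_type (rng_pullback F)) (k : garr L),
          farr F k = (\val hx).1 -> rng k = (\val hx).2 ->
          radon_integral (lamdot hx) (fun l => f (\val l)) =
          radon_integral (lam (src k)) (fun g => f (gmul k (\val (\val g)))) &
        exists nu : measure_family R (@rng L),
          haar_system nu /\
          forall (f : garr L -> R), quasi_continuous f ->
          forall x : gobj L,
            radon_integral (nu x) (fun l => f (\val l)) =
            radon_integral (mu (fobj F x)) (fun h =>
              radon_integral (lamdot (rng_pair h)) (fun l => f (\val l)))].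
Proof.
have [lamdot lamdotE] := induced_family HG HH Hlam.
have [nu nuE] := iterated_family HG HH Hlam mu lamdotE.
exists lamdot; split.
- exact: induced_family_continuous lamdotE.
- move=> f fC hx k Fk rk.
  have khx : arr_rng F k = hx.
    apply: val_inj; apply: etrans (esym (surjective_pairing (\val hx))).
    by rewrite -Fk -rk.
  rewrite -khx; apply: lamdotE; exact: fibre_restrict_Cc.
- exists nu; split; first exact: (iterated_haar HG HH Hlam Hmu lamdotE nuE).
  move=> f fC x; apply: nuE; exact: (rng_restrict_Cc HG HH).
Qed.
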